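(* Let $n\ge 2$ and let $\Gamma\subset\mathrm{PO}(n,2)$ be a torsion-free $\mathrm{AdS}^{n+1}$-quasi-Fuchsian group with limit set $\Lambda$. The geodesic flow $\phi_t^{\mathrm{AdS}}$ on $N^1C(\Lambda)/\Gamma$ is ergodic with respect to the Bowen–Margulis measure $m$.
   Context: $\mathbb{R}^{n,2}$ is $\mathbb{R}^{n+2}$ with the form $\langle u|v\rangle=u_1v_1+\dots+u_nv_n-u_{n+1}v_{n+1}-u_{n+2}v_{n+2}$. $\mathrm{AdS}^{n+1}=\mathbb{H}^{n,1}=\{[u]\in\mathbb{RP}^{n+1}:\langle u|u\rangle<0\}$ with the Lorentzian metric given by $T_{[u]}\mathbb{H}^{n,1}\simeq u^\perp$ (for $\langle u|u\rangle=-1$), $\partial\mathrm{AdS}^{n+1}=\{[u]:\langle u|u\rangle=0\}$, isometry group $\mathrm{PO}(n,2)$. For $x\in\mathrm{AdS}^{n+1}$, $\tilde x$ is a lift with $\langle\tilde x|\tilde x\rangle=-1$; for $\xi\in\partial\mathrm{AdS}^{n+1}$, $\tilde\xi$ is any nonzero lift; used only in expressions independent of the lifts. $\Omega\subset\mathrm{AdS}^{n+1}$ is properly convex if its closure in $\mathbb{RP}^{n+1}$ is contained and convex in some affine chart. A discrete $\Gamma\subset\mathrm{PO}(n,2)$ is convex cocompact if it acts properly discontinuously and cocompactly on some $\Gamma$-invariant closed properly convex $\Omega\subset\mathrm{AdS}^{n+1}$ with nonempty interior such that $\overline\Omega\cap\partial\mathrm{AdS}^{n+1}$ contains no non-trivial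 segment. Its limit set $\Lambda$ is the set of accumulation points of the orbit of any point of $\Omega$; $\Gamma$ is quasi-Fuchsian if moreover $\Lambda$ is homeomorphic to $\mathbb{S}^{n-1}$. $C(\Lambda)$ is the intersection of $\mathrm{AdS}^{n+1}$ with the convex hull of $\Lambda$ in an affine chart containing such an $\overline\Omega$. $d_{\mathrm{AdS}}(x,y)=\operatorname{arccosh}(\max(1,|\langle\tilde x|\tilde y\rangle|))$ and $\delta_{\mathrm{AdS}}(\Gamma)=\limsup_{R\to\infty}\frac1R\log\#\{\gamma\in\Gamma:d_{\mathrm{AdS}}(\gamma o,o)\le R\}$ for any $o\in C(\Lambda)$ (independent of $o$). $T^1\mathrm{AdS}^{n+1}$ is the set of tangent vectors $v$ with $\langle v|v\rangle=1$; $v^+$ and $v^-$ in $\partial\mathrm{AdS}^{n+1}$ are the forward and backward endpoints of the spacelike geodesic tangent to $v$, and $\phi_t^{\mathrm{AdS}}$ is the geodesic flow. The non-wandering set is $N^1C(\Lambda)=\{v\in T^1C(\Lambda):v^\pm\in\Lambda\}$; it is invariant under $\Gamma$ and under $\phi_t^{\mathrm{AdS}}$, and $N^1C(\Lambda)/\Gamma$ is compact. For $\xi\in\Lambda$ and $x,y\in C(\Lambda)$, $\beta_\xi(x,y)=\ln|\langle\tilde\xi|\tilde x\rangle/\langle\tilde\xi|\tilde y\rangle|$. Let $(\nu_x)_{x\in C(\Lambda)}$ be the Patterson–Sullivan density: the family (unique up to scaling) of finite Borel measures on $\Lambda$ with support $\Lambda$, $\nu_x(\gamma^{-1}E)=\nu_{\gamma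 x}(E)$ for $\gamma\in\Gamma$, and $\frac{d\nu_x}{d\nu_y}(\xi)=e^{-\delta_{\mathrm{AdS}}(\Gamma)\beta_\xi(x,y)}$. With $d_x(\xi,\eta)=\sqrt{\left|\frac{\langle\tilde\xi|\tilde\eta\rangle}{2\langle\tilde\xi|\tilde x\rangle\langle\tilde x|\tilde\eta\rangle}\right|}$, the measure $d\mu(\xi,\eta)=\frac{d\nu_x(\xi)\,d\nu_x(\eta)}{d_x(\xi,\eta)^{2\delta_{\mathrm{AdS}}(\Gamma)}}$ on the set $\Lambda^{(2)}$ of pairs of distinct points of $\Lambda$ is independent of $x$ and $\Gamma$-invariant. The Bowen–Margulis measure on $N^1C(\Lambda)$ is defined, for continuous compactly supported $F$, by $\int F\,dm=\int_{\Lambda^{(2)}}\int_{\mathbb{R}}F(\dot c_{\xi\eta}(t))\,dt\,d\mu(\xi,\eta)$, where $c_{\xi\eta}$ is a unit-speed parametrization of the spacelike geodesic from $\xi$ to $\eta$. It is invariant under $\Gamma$ and $\phi_t^{\mathrm{AdS}}$ and descends to a finite $\phi_t^{\mathrm{AdS}}$-invariant measure on $N^1C(\Lambda)/\Gamma$, still denoted $m$. *)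

(* Defs.v *)
From HB Require Import structures.
From mathcomp Require Import all_boot all_order all_algebra.
From mathcomp Require Import all_classical all_reals all_analysis.
Import Order.TTheory GRing.Theory Num.Theory.
Import numFieldNormedType.Exports.

Set Implicit Arguments.
Unset Strict Implicit.
Unset Printing Implicit Defensive.

Local Open Scope classical_set_scope.
Local Open Scope ring_scope.
Local Open Scope quotient_scope.

(* The library's measurable types are pointed: [pointed_at t0] is [T] with
   distinguished point [t0], which plays no other role. *)
Definition pointed_at (T : Type) (t0 : T) : Type := T.
HB.instance Definition _ (T : topologicalType) (t0 : T) :=
  Topological.copy (pointed_at t0) T.
HB.instance Definition _ (T : topologicalType) (t0 : T) :=
  isPointed.Build (pointed_at t0) t0.

Notation borel_at t0 := (g_sigma_algebraType (@open (pointed_at t0))).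

Definition homeomorphic (X Y : topologicalType) : Prop :=
  exists (f : X -> Y) (g : Y -> X),
    [/\ continuous f, continuous g, cancel f g & cancel g f].

Definition ergodic (R : realType) (d : measure_display) (T : measurableType d)
    (m : set T -> \bar R) (phi : R -> T -> T) : Prop :=
  forall A : set T, measurable A -> (forall t, phi t @^-1` A = A) ->
    m A = 0%E \/ m (~` A) = 0%E.

Definition arccosh (R : realType) (a : R) : R := ln (a + Num.sqrt (a ^+ 2 - 1)).
Definition cosh (R : realType) (t : R) : R := (expR t + expR (- t)) / 2.
Definition sinh (R : realType) (t : R) : R := (expR t - expR (- t)) / 2.

Section AdS.
Variables (R : realType) (n : nat).

Local Notation vec := ('rV[R]_n.+2).
Local Notation mat := ('M[R]_n.+2).

Definition form_sign (i : 'I_n.+2) : R := if (i < n)%N then 1 else -1.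
Definition form (u v : vec) : R := \sum_i form_sign i * u 0 i * v 0 i.

Definition nonzero : set vec := [set u | u != 0].
Definition collinear (u v : nonzero) : bool :=
  `[< exists c : R, c != 0 /\ set_val v = c *: set_val u >].

Lemma collinear_refl : reflexive collinear.
Proof. by move=> u; apply/asboolP; exists 1; rewrite scale1r oner_neq0. Qed.

Lemma collinear_sym : symmetric collinear.
Proof.
have H u v : collinear u v -> collinear v u.
  move=> /asboolP[c [c0 E]]; apply/asboolP; exists c^-1.
  by rewrite invr_neq0// E scalerA mulVf// scale1r.
by move=> u v; apply/idP/idP; exact: H.
Qed.

Lemma collinear_trans : transitive collinear.
Proof.
move=> v u w /asboolP[c [c0 E1]] /asboolP[d [d0 E2]]; apply/asboolP.
by exists (d * c); rewrite mulf_neq0// E2 E1 scalerA.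
Qed.

Canonical collinear_equiv :=
  EquivRel collinear collinear_refl collinear_sym collinear_trans.

Definition RP : Type := quotient_topology {eq_quot collinear_equiv}.
HB.instance Definition _ := Topological.on RP.
HB.instance Definition _ := Quotient.on RP.

Lemma ones_nonzero : (const_mx 1 : vec) \in nonzero.
Proof.
apply/mem_set/eqP => /matrixP /(_ 0 0); rewrite !mxE => /eqP.
by rewrite oner_eq0.
Qed.

Definition ones : nonzero := exist (fun u => u \in nonzero) _ ones_nonzero.

(* The point [u] of the projective space; the value at u = 0 is irrelevant. *)
Definition proj (u : vec) : RP :=
  \pi_RP (insubd ones u).
HB.instance Definition _ := isPointed.Build RP (proj (const_mx 1)).

Definition lift (p : RP) : vec := set_val (repr p).

Definition AdS : set RP := [set p | form (lift p) (lift p) < 0].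
Definition bdAdS : set RP := [set p | form (lift p) (lift p) = 0].

(* For p in AdS, the lift of square -1 (well defined up to sign). *)
Definition ulift (p : RP) : vec :=
  (Num.sqrt (- form (lift p) (lift p)))^-1 *: lift p.

Definition isometry (A : mat) : Prop :=
  forall u v : vec, form (u *m A) (v *m A) = form u v.

Definition pmap (A : mat) (p : RP) : RP := proj (lift p *m A).

Lemma lift_neq0 p : lift p != 0.
Proof. by have := set_valP (repr p). Qed.

Lemma proj_eq u v : u != 0 -> v != 0 ->
  proj u = proj v <-> exists c : R, c != 0 /\ v = c *: u.
Proof.
move=> u0 v0; rewrite /proj.
split=> [/eqquotP/asboolP|[c cP]].
  by rewrite !set_valE/= !insubdK//; exact/mem_set.
by apply/eqquotP/asboolP; exists c; rewrite !set_valE/= !insubdK//; exact/mem_set.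
Qed.

Lemma liftK : cancel lift proj.
Proof.
move=> p; rewrite /proj -[RHS]reprK; congr (\pi_RP _); apply: val_inj.
rewrite val_insubd mem_set//; exact: lift_neq0.
Qed.

Lemma lift_proj u : u != 0 -> exists c : R, c != 0 /\ lift (proj u) = c *: u.
Proof. by move=> u0; apply/proj_eq; rewrite ?lift_neq0// liftK. Qed.

Lemma form_delta_r (u : vec) j : form u (delta_mx 0 j) = form_sign j * u 0 j.
Proof.
rewrite /form (bigD1 j)//= big1 => [|i ij]; last by rewrite !mxE (negPf ij) mulr0.
by rewrite addr0 !mxE !eqxx mulr1.
Qed.

Lemma isometry1 : isometry 1%:M.
Proof. by move=> u v; rewrite !mulmx1. Qed.

Lemma isometryM A B : isometry A -> isometry B -> isometry (A *m B).
Proof. by move=> iA iB u v; rewrite !mulmxA iB iA. Qed.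

Lemma isometry_unit A : isometry A -> A \in unitmx.
Proof.
move=> iA; rewrite -row_free_unit -kermx_eq0; apply/eqP/row_matrixP => i.
rewrite row0; have : row i (kermx A) *m A = 0.
  by apply/sub_kermxP; exact: row_sub.
move: (row i _) => u uA; apply/rowP => j; rewrite mxE.
have : form_sign j * u 0 j = 0.
  rewrite -form_delta_r -iA uA /form big1// => k _.
  by rewrite mxE mulr0 mul0r.
move/eqP; rewrite mulf_eq0 => /orP[|/eqP//].
by rewrite /form_sign; case: ifP => _; rewrite ?oppr_eq0 oner_eq0.
Qed.

Lemma isometryV A : isometry A -> isometry (invmx A).
Proof. by move=> iA u v; rewrite -iA !mulmxKV ?isometry_unit. Qed.

Lemma pmap1 : pmap 1%:M = id.
Proof. by apply/funext => p; rewrite /pmap mulmx1 liftK. Qed.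

Lemma pmapM A B : A \in unitmx -> B \in unitmx -> pmap (A *m B) = pmap B \o pmap A.
Proof.
have mul0 (C : mat) (u : vec) : C \in unitmx -> u != 0 -> u *m C != 0.
  by move=> uC; apply: contra_neq => E; rewrite -[u](mulmxK uC) E mul0mx.
move=> uA uB; apply/funext => p; rewrite /pmap/=.
have pA := mul0 _ _ uA (lift_neq0 p).
have [c [c0 ->]] := lift_proj pA; apply/proj_eq.
- by rewrite mulmxA; exact: mul0.
- by apply: mul0 => //; rewrite scaler_eq0 negb_or c0.
- by exists c; rewrite c0 -scalemxAl mulmxA.
Qed.

(* PO(n,2) is realised as a group of transformations of the projective space,
   on which it acts faithfully. *)
Definition PO : set (RP -> RP) := [set g | exists2 A, isometry A & g = pmap A].

Record subgroupPO := SubgroupPO {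
  carrier : set (RP -> RP);
  carrier_PO : carrier `<=` PO;
  carrier_id : carrier id;
  carrier_comp : forall g h, carrier g -> carrier h -> carrier (g \o h);
  carrier_inv : forall g, carrier g ->
    exists h, [/\ carrier h, cancel g h & cancel h g] }.

Implicit Types (Gamma : subgroupPO) (Omega Lambda : set RP).

Definition linear_lifts Gamma : set mat :=
  [set A | isometry A /\ carrier Gamma (pmap A)].

(* O(n,2) -> PO(n,2) is a finite covering, so a subgroup of PO(n,2) is discrete
   iff its preimage is. *)
Definition discrete_group Gamma : Prop :=
  linear_lifts Gamma `<=` isolated (linear_lifts Gamma).

Definition torsion_free Gamma : Prop :=
  forall g k, carrier Gamma g -> (0 < k)%N -> iter k g = id -> g = id.

(* The affine chart attached to f <> 0 is the complement of the hyperplane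
   P(ker f), identified with the affine hyperplane {u | f(u) = 1}. *)
Definition affine_chart (f : 'cV[R]_n.+2) : set RP :=
  [set p | lift p *m f != 0].
Definition in_chart (f : 'cV[R]_n.+2) (S : set RP) : set vec :=
  [set u | u *m f = 1 /\ S (proj u)].

Definition properly_convex Omega : Prop :=
  exists f, [/\ f != 0, closure Omega `<=` affine_chart f &
    @convex_set R vec (in_chart f (closure Omega))].

Definition contains_segment (S : set RP) : Prop :=
  exists u v : vec, [/\ u != 0, v != 0, proj u <> proj v &
    forall t : R, 0 <= t <= 1 -> S (proj ((1 - t) *: u + t *: v))].

Definition properly_discontinuous Gamma Omega : Prop :=
  forall K, compact K -> K `<=` Omega ->
    finite_set [set g | carrier Gamma g /\ (g @` K) `&` K !=set0].

Definition cocompact Gamma Omega : Prop :=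
  exists K, [/\ compact K, K `<=` Omega &
    Omega `<=` \bigcup_(g in carrier Gamma) g @` K].

Definition cc_domain Gamma Omega : Prop :=
  [/\ Omega `<=` AdS /\ closure Omega `&` AdS `<=` Omega,
      properly_convex Omega,
      interior Omega !=set0,
      ~ contains_segment (closure Omega `&` bdAdS) &
      [/\ forall g, carrier Gamma g -> g @` Omega = Omega,
          properly_discontinuous Gamma Omega &
          cocompact Gamma Omega]].

Definition limit_set Gamma (x : RP) : set RP :=
  limit_point [set g x | g in carrier Gamma].

Definition sphere (k : nat) : set 'rV[R]_k :=
  [set u | \sum_i u 0 i ^+ 2 = 1].

(* Gamma is AdS-quasi-Fuchsian, as witnessed by the convex domain Omega, and
   Lambda is its limit set, computed from the orbit of a point of Omega. *)
Definition quasi_Fuchsian Gamma Omega Lambda : Prop :=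
  [/\ discrete_group Gamma,
      cc_domain Gamma Omega,
      exists2 x, Omega x & Lambda = limit_set Gamma x &
      homeomorphic Lambda (@sphere n)].

Definition convex_hull (S : set vec) : set vec :=
  \bigcap_(K in [set K | @convex_set R vec K /\ S `<=` K]) K.

Definition convex_core Lambda (f : 'cV[R]_n.+2) : set RP :=
  AdS `&` (proj @` convex_hull (in_chart f Lambda)).

Definition dAdS (x y : RP) : R :=
  arccosh (Num.max 1 `|form (ulift x) (ulift y)|).

(* The limsup is finite for the groups under consideration. *)
Definition critical_exponent Gamma (o : RP) : R :=
  fine (limf_esup (fun r : R => ((r^-1)%:E *
    lne (counting [set g | carrier Gamma g /\ (dAdS (g o) o <= r)%R]))%E) (pinfty_nbhs R)).

(* A tangent vector to AdS is a class modulo sign of a pair (u, v) with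
   <u|u> = -1 and <u|v> = 0; u is the lift of the base point. *)
Definition upto_sign (p q : vec * vec) : bool := (q == p) || (q == - p).

Lemma upto_sign_refl : reflexive upto_sign.
Proof. by move=> p; rewrite /upto_sign eqxx. Qed.

Lemma upto_sign_sym : symmetric upto_sign.
Proof. by move=> p q; rewrite /upto_sign eq_sym [p == - q]eq_sym eqr_oppLR. Qed.

Lemma upto_sign_trans : transitive upto_sign.
Proof.
by move=> q p r /orP[]/eqP-> /orP[]/eqP->;
  rewrite /upto_sign ?opprK eqxx ?orbT.
Qed.

Canonical upto_sign_equiv :=
  EquivRel upto_sign upto_sign_refl upto_sign_sym upto_sign_trans.

Definition pairs : Type := quotient_topology {eq_quot upto_sign_equiv}.
HB.instance Definition _ := Topological.on pairs.
HB.instance Definition _ := Quotient.on pairs.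

Definition T1AdS : set pairs := [set w | let: (u, v) := repr w in
  [/\ form u u = -1, form v v = 1 & form u v = 0]].

Definition foot (w : pairs) : RP := proj (repr w).1.

(* The spacelike geodesic tangent to (u, v) is t |-> [cosh t u + sinh t v]. *)
Definition flow (t : R) (w : pairs) : pairs := let: (u, v) := repr w in
  \pi_pairs (cosh t *: u + sinh t *: v, sinh t *: u + cosh t *: v).
Definition forward_end (w : pairs) : RP := let: (u, v) := repr w in proj (u + v).
Definition backward_end (w : pairs) : RP := let: (u, v) := repr w in proj (u - v).

Definition act (A : mat) (w : pairs) : pairs :=
  let: (u, v) := repr w in \pi_pairs (u *m A, v *m A).

Definition nonwandering Lambda (C : set RP) : set pairs :=
  [set w | [/\ T1AdS w, C (foot w), Lambda (forward_end w) &
               Lambda (backward_end w)]].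

Lemma act1 w : act 1%:M w = w.
Proof.
by rewrite /act -[RHS]reprK; case: (repr w) => u v; rewrite !mulmx1.
Qed.

Lemma actM A B w : act B (act A w) = act (A *m B) w.
Proof.
rewrite /act; case: (repr w) => u v.
set z := \pi_pairs _; have /eqquotP : repr z = (u *m A, v *m A) %[mod pairs].
  by rewrite reprK.
case: (repr z) => u' v'; rewrite !mulmxA => /orP[/eqP[-> ->]//|/eqP[-> ->]].
by apply/eqquotP; apply/orP; right; apply/eqP; rewrite !mulNmx; congr (_, _); rewrite opprK.
Qed.

Section Quotient.
Variables (Gamma : subgroupPO) (N : set pairs).

(* For N invariant under the flow, this is the restriction of the flow to N. *)
Definition flow_on (t : R) (w : N) : N := insubd w (flow t (set_val w)).

Definition same_orbit (w w' : N) : bool :=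
  `[< exists2 A, linear_lifts Gamma A & set_val w' = act A (set_val w) >].

Lemma same_orbit_refl : reflexive same_orbit.
Proof.
move=> w; apply/asboolP; exists 1%:M; rewrite ?act1//.
by split; [exact: isometry1|rewrite pmap1; exact: carrier_id].
Qed.

Lemma same_orbit_sym : symmetric same_orbit.
Proof.
have H w w' : same_orbit w w' -> same_orbit w' w.
  move=> /asboolP[A [iA gA] E]; apply/asboolP; have uA := isometry_unit iA.
  exists (invmx A); last by rewrite E actM mulmxV// act1.
  split; first exact: isometryV.
  have [h [gh AhK hAK]] := carrier_inv gA; suff -> : pmap (invmx A) = h by [].
  apply/funext => p; rewrite -{1}[p]hAK.
  by rewrite -[LHS]/((pmap (invmx A) \o pmap A) _) -pmapM ?unitmx_inv// mulmxV// pmap1.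
by move=> w w'; apply/idP/idP; exact: H.
Qed.

Lemma same_orbit_trans : transitive same_orbit.
Proof.
move=> w' w w'' /asboolP[A [iA gA] E] /asboolP[B [iB gB] E'].
apply/asboolP; exists (A *m B); last by rewrite E' E actM.
split; first exact: isometryM.
by rewrite pmapM ?isometry_unit//; exact: carrier_comp.
Qed.

Canonical same_orbit_equiv :=
  EquivRel same_orbit same_orbit_refl same_orbit_sym same_orbit_trans.

Definition orbit_space : Type := quotient_topology {eq_quot same_orbit_equiv}.
HB.instance Definition _ := Topological.on orbit_space.
HB.instance Definition _ := Quotient.on orbit_space.

Definition orbit_of (w : N) : orbit_space := \pi_orbit_space w.

Definition quotient_flow (t : R) (q : orbit_space) : orbit_space :=
  orbit_of (flow_on t (repr q)).

(* mbar is the measure on the quotient locally equal to m: the two agree on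
   every Borel set on which the projection is injective. *)
Definition descends_to (w0 : N)
    (m : {measure set (borel_at w0) -> \bar R})
    (mbar : {measure set (borel_at (orbit_of w0)) -> \bar R}) : Prop :=
  forall E : set (borel_at w0), measurable E -> set_inj E orbit_of ->
    mbar (orbit_of @` E) = m E.

End Quotient.

Definition busemann (xi x y : RP) : R :=
  ln `|form (lift xi) (ulift x) / form (lift xi) (ulift y)|.

Local Notation borelRP := (g_sigma_algebraType (@open RP)).

Definition support (mu : set borelRP -> \bar R) : set RP :=
  [set p | forall U : set RP, open U -> U p -> (0 < mu U)%E].

Definition Patterson_Sullivan Gamma Lambda (C : set RP) (delta : R)
    (nu : RP -> {finite_measure set borelRP -> \bar R}) : Prop :=
  [/\ forall x, C x -> nu x (~` Lambda) = 0%E /\ support (nu x) = Lambda,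
      forall g x (E : set borelRP), carrier Gamma g -> C x -> measurable E ->
        nu x (g @^-1` E) = nu (g x) E &
      forall x y (E : set borelRP), C x -> C y -> measurable E ->
        nu x E =
        (\int[nu y]_(xi in E) (expR (- delta * busemann xi x y))%:E)%E].

Definition gromov_dist (x xi eta : RP) : R :=
  Num.sqrt `|form (lift xi) (lift eta) /
    (2 * form (lift xi) (ulift x) * form (ulift x) (lift eta))|.

Definition distinct_pairs Lambda : set (borelRP * borelRP) :=
  [set p | [/\ Lambda p.1, Lambda p.2 & p.1 <> p.2]].

(* mu is the measure d(nu x nu) / d_x^(2 delta) on distinct_pairs Lambda; its
   values on sets not contained in distinct_pairs Lambda are irrelevant. *)
Definition geodesic_current Lambda (delta : R) (x : RP)
    (nu : {finite_measure set borelRP -> \bar R})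
    (mu : {measure set (borelRP * borelRP) -> \bar R}) : Prop :=
  forall E : set (borelRP * borelRP),
    measurable E -> E `<=` distinct_pairs Lambda ->
    mu E = (\int[nu \x nu]_(p in E)
              (gromov_dist x p.1 p.2 `^ (- (2 * delta)))%:E)%E.

Definition unit_speed_param (N : set pairs) (xi eta : RP) (c : R -> N) : Prop :=
  [/\ backward_end (set_val (c 0)) = xi, forward_end (set_val (c 0)) = eta &
      forall t, set_val (c t) = flow t (set_val (c 0))].

(* [c xi eta t] is the velocity vector at time t of the geodesic from xi to
   eta.  The inner integral does not depend on the parametrization. *)
Definition Bowen_Margulis Lambda (N : set pairs) (delta : R) (x : RP)
    (nu : {finite_measure set borelRP -> \bar R}) (w0 : N)
    (m : {measure set (borel_at w0) -> \bar R}) : Prop :=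
  exists (mu : {measure set (borelRP * borelRP) -> \bar R})
         (c : RP -> RP -> R -> N),
    [/\ geodesic_current Lambda delta x nu mu,
        forall p, distinct_pairs Lambda p -> unit_speed_param p.1 p.2 (c p.1 p.2) &
        forall F : N -> R, continuous F -> compact (closure [set w | F w != 0]) ->
          (\int[m]_w (F w)%:E =
           \int[mu]_(p in distinct_pairs Lambda)
             \int[@lebesgue_measure R]_t (F (c p.1 p.2 t))%:E)%E].

End AdS.

(* Main.v *)
(* Hopf's argument, without Birkhoff's theorem.  The vector tangent to (u, v) is
   encoded by the null vectors P = u + v and Q = u - v, normalised by the chart
   so that the geodesic flow becomes (e^t P, e^-t Q) and Gamma acts linearly.
   Two geodesics with the same forward endpoint have, up to the choice of the
   time origin, the same P; since N^1 C(Lambda) / Gamma is compact and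
   <Q | Q'> is multiplied by e^-2t, their images in the quotient become
   arbitrarily close.  Hence they cannot visit two given disjoint compact sets
   at the same large times.  Let A be an invariant Borel set, and choose closed
   sets inside A and inside its complement that exhaust the finite measure mbar
   up to a small error.  Because m is invariant and is a product of the current
   mu and of Lebesgue measure, at suitable times t_j -> +oo the endpoints of the
   geodesics which at time t_j are in neither of the two closed sets have small
   mass; so, up to a null set, membership of a geodesic in A depends on its
   forward endpoint only.  Reversing time, it also depends on its backward
   endpoint only.  Since mu is equivalent to nu x nu off the diagonal and the
   support Lambda of nu has at least three points, A is null or conull. *)
Require Import Defs.
From HB Require Import structures.
From mathcomp Require Import all_boot all_order all_algebra.
From mathcomp Require Import all_classical all_reals all_analysis.
From mathcomp Require Import measurable_realfun ring lra.
Import Order.TTheory GRing.Theory Num.Theory.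
Import numFieldNormedType.Exports.
(* The libraries shadow [form] and [lift]. *)
Import Defs.
Local Open Scope classical_set_scope.
Local Open Scope ring_scope.

Set Implicit Arguments.
Unset Strict Implicit.
Unset Printing Implicit Defensive.

(** * Product measures *)

(** The obstacle is that the metric is Lorentzian and gives no distance in which to express
    contraction. Proximity is measured by the norm of vectors, after an element of [Gamma] has
    brought one of the two tangent vectors back to a fixed compact set. What [Gamma] preserves is
    [<Q | Q'>]. There it controls [Q - Q'], because the form is strictly negative on positive lifts
    of distinct limit points and because [<P | Q> = <P | Q'> = -2] turns collinear [Q] and [Q'] into
    equal ones. Invariance of the measure controls the mass of a flow box of unit length, not that
    of a single time slice; Fubini's theorem extracts from each box one good time, in [[i, i + 1]].
    Good times tending to infinity suffice, so no average has to converge. The measure [mbar] is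
    known only on Borel sets where the projection is injective. Proper discontinuity and
    torsion-freeness supply finitely many open ones whose images cover the quotient, and every
    estimate on [mbar] passes through them. *)

Lemma cvge_exists_lt (R : realType) (u : nat -> \bar R) (l b : \bar R) :
  u @ \oo --> l -> (l < b)%E -> exists j, (u j < b)%E.
Proof.
move=> ul lb; have : \forall j \near \oo, (u j < b)%E.
  apply: (ul [set y | (y < b)%E]).
  by apply: open_nbhs_nbhs; split => //; exact: open_ereal_lt_ereal.
by case=> j _ /(_ j (leqnn _)); exists j.
Qed.

Section Products.
Local Open Scope ereal_scope.
Context d d' (S : measurableType d) (T : measurableType d') (R : realType).

Lemma integral_ge0_eq0 (m : {measure set S -> \bar R}) (f : S -> \bar R) :
  measurable_fun setT f -> (forall x, 0 <= f x) -> \int[m]_x f x = 0 ->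
  m [set x | 0 < f x] = 0.
Proof.
move=> mf f0 If; have If' : \int[m]_x `|f x| = 0.
  by rewrite -[RHS]If; apply: eq_integral => x _; rewrite gee0_abs.
have /(ae_eq_integral_abs m measurableT mf)[N [mN N0 sN]] := If'.
apply/eqP; rewrite eq_le measure_ge0 andbT -[leRHS]N0 le_measure ?inE//.
  by rewrite -[X in measurable X]setTI; exact: emeasurable_fun_o_infty.
by move=> x /= fx; apply: sN => /= /(_ I) E; rewrite E ltxx in fx.
Qed.

Lemma prod_xsection_null (m1 : {measure set S -> \bar R})
    (m2 : {sigma_finite_measure set T -> \bar R}) (E : set (S * T)) :
  measurable E -> (m1 \x m2) E = 0 -> m1 [set x | 0 < m2 (xsection E x)] = 0.
Proof.
move=> mE E0; apply: integral_ge0_eq0 => //.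
exact: measurable_fun_xsection.
Qed.

Lemma prod_ysectionE (m1 : {sigma_finite_measure set S -> \bar R})
    (m2 : {sigma_finite_measure set T -> \bar R}) (E : set (S * T)) :
  measurable E -> (m1 \x m2) E = \int[m2]_y m1 (ysection E y).
Proof.
move=> mE; have := @product_measure_unique _ _ _ _ _ m1 m2 (m1 \x^ m2) _ _ mE.
by apply=> A B mA mB; exact: product_measure2E.
Qed.

End Products.

Lemma measurable_preimage d d' (S : measurableType d) (T : measurableType d')
    (f : S -> T) (B : set T) :
  measurable_fun setT f -> measurable B -> measurable (f @^-1` B).
Proof. by move=> mf mB; rewrite -[X in measurable X]setTI; exact: mf. Qed.

Section FiberConst.
Local Open Scope ereal_scope.
Context d (S : measurableType d) (R : realType).
Variable nu : {finite_measure set S -> \bar R}.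
Local Notation nu2 := (nu \x nu).
Local Notation nu3 := (nu2 \x nu).

(** A triple [((x, y), x')] encodes the two pairs [(x, y)] and [(x', y)] with a common second
    entry. *)
Definition pair_left (q : S * S * S) : S * S := q.1.
Definition pair_right (q : S * S * S) : S * S := (q.2, q.1.2).

Lemma measurable_pair_left : measurable_fun setT pair_left.
Proof. exact: measurable_fst. Qed.

Lemma measurable_pair_right : measurable_fun setT pair_right.
Proof.
apply/measurable_fun_pairP; split; first exact: measurable_snd.
exact: (measurableT_comp measurable_snd measurable_fst).
Qed.

Lemma measurable_swap : measurable_fun setT (fun p : S * S => (p.2, p.1)).
Proof.
by apply/measurable_fun_pairP; split;
  [exact: measurable_snd|exact: measurable_fst].
Qed.

Lemma nu2_swap (Q : set (S * S)) : measurable Q ->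
  nu2 ((fun p => (p.2, p.1)) @^-1` Q) = nu2 Q.
Proof.
move=> mQ; rewrite prod_ysectionE; last first.
  exact: (measurable_preimage measurable_swap).
by apply: eq_integral => y _; congr (nu _).
Qed.

Lemma nu3_left (Q : set (S * S)) : measurable Q ->
  nu3 (pair_left @^-1` Q) = nu2 Q * nu setT.
Proof.
move=> mQ; rewrite -[RHS]product_measure1E//.
by congr (nu3 _); apply/seteqP; split => // q /= [].
Qed.

Lemma nu3_right (Q : set (S * S)) : measurable Q ->
  nu3 (pair_right @^-1` Q) = nu2 Q * nu setT.
Proof.
move=> mQ; transitivity (\int[nu2]_p nu (ysection Q p.2)).
  by apply: eq_integral => p _; congr (nu _).
rewrite (fubini_tonelli2 (fun p => nu (ysection Q p.2)))//; last first.
  apply: (@measurableT_comp _ _ _ _ _ _ (fun y => nu (ysection Q y)) _ snd) => //.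
  exact: measurable_fun_ysection.
transitivity (\int[nu]_y (nu (ysection Q y) * nu setT)).
  by apply: eq_integral => y _; rewrite -[RHS]integral_cst.
rewrite ge0_integralZr//; last exact: measurable_fun_ysection.
by rewrite prod_ysectionE.
Qed.

(* In the application [y] is the forward endpoint of a geodesic, and [C1 j] and
   [C2 j] are the geodesics that lie at time [t j] in closed subsets of [A] and
   of its complement: two geodesics with the same forward endpoint cannot belong
   to both for large [j], as they become close in the quotient. *)
Lemma fiber_const_null (V H : set (S * S)) :
  measurable V -> measurable H ->
  (forall e : R, (0 < e)%R -> exists C1 C2 : nat -> set (S * S),
    [/\ forall j, measurable (C1 j) /\ measurable (C2 j),
        forall j, C1 j `<=` H /\ C2 j `<=` ~` H,
        forall j, nu2 (V `\` (C1 j `|` C2 j)) <= e%:E &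
        forall x x' y, V (x, y) -> V (x', y) ->
          \forall j \near \oo, ~ (C1 j (x, y) /\ C2 j (x', y))]) ->
  nu3 [set q | (V `&` H) (pair_left q) /\ (V `\` H) (pair_right q)] = 0.
Proof.
move=> mV mH cH; set S3 := [set q | _ ].
have mS3 : measurable S3.
  rewrite [S3](_ : _ = pair_left @^-1` (V `&` H) `&`
                       pair_right @^-1` (V `\` H)); last by [].
  apply: measurableI.
    by apply: (measurable_preimage measurable_pair_left); exact: measurableI.
  by apply: (measurable_preimage measurable_pair_right); exact: measurableD.
have nuT : nu setT \is a fin_num by exact: fin_num_measure.
pose K := fine (nu setT); have K0 : (0 <= K)%R by exact: fine_ge0.
apply/eqP; rewrite eq_le measure_ge0 andbT; apply/lee_addgt0Pr => e e0.
rewrite add0e.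
(* The final bound has three terms: two exceptional sets of mass at most [e' * K] each, and a tail
   of mass at most [e']. *)
pose e' := (e / (2 * K + 1))%R.
have K1 : (0 < 2 * K + 1)%R by rewrite ltr_wpDl// mulr_ge0.
have e'0 : (0 < e')%R by rewrite divr_gt0.
have [C1 [C2 [mC CH Ce Cn]]] := cH _ e'0.
pose T j := pair_left @^-1` (V `&` C1 j) `&` pair_right @^-1` (V `&` C2 j).
have mT j : measurable (T j).
  have [mC1 mC2] := mC j; apply: measurableI.
    by apply: (measurable_preimage measurable_pair_left); exact: measurableI.
  by apply: (measurable_preimage measurable_pair_right); exact: measurableI.
(* Each triple lies in only finitely many [T i], so these tails decrease to the empty set and, [nu3]
   being finite, their masses tend to 0. *)
pose U j := \bigcup_(i >= j) T i.
have mU j : measurable (U j) by apply: bigcup_measurable.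
have nu3T : nu3 setT < +oo.
  have nu2T : nu2 setT \is a fin_num.
    by rewrite -setXTT product_measure1E// fin_numM.
  by rewrite -setXTT product_measure1E// ltey_eq fin_numM.
have Ucvg : nu3 (U j) @[j --> \oo] --> 0.
  have <- : nu3 (\bigcap_j U j) = 0.
    rewrite (_ : \bigcap_j U j = set0) ?measure0//; apply/seteqP; split=> // q UU.
    have [i _ [[/= Vl _] [/= Vr _]]] := UU 0%N I.
    case: q UU Vl Vr => [[x y] x'] UU /= Vl Vr.
    have [j _ /(_ _ _) jn] := Cn _ _ _ Vl Vr.
    by have [k /= jk [[/= _ c1] [/= _ c2]]] := UU j I; exact: (jn k).
  apply: nonincreasing_cvg_mu => //.
  - by apply: le_lt_trans nu3T; rewrite le_measure ?inE.
  - exact: bigcapT_measurable.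
  - move=> i j ij; apply/subsetPset => q [k /= jk Tk]; exists k => //=.
    exact: leq_trans jk.
have [j Uj] : exists j, nu3 (U j) < e'%:E.
  by apply: (cvge_exists_lt Ucvg); rewrite lte_fin.
have [mC1 mC2] := mC j; have [CH1 CH2] := CH j.
pose Q := V `\` (C1 j `|` C2 j).
have mQ : measurable Q by apply: measurableD => //; exact: measurableU.
have mQl : measurable (pair_left @^-1` Q).
  exact: (measurable_preimage measurable_pair_left).
have mQr : measurable (pair_right @^-1` Q).
  exact: (measurable_preimage measurable_pair_right).
(* If neither pair of the triple is exceptional at step [j], each lies in [C1 j] or [C2 j], and its
   position with respect to [H] decides which one; the triple is then in [T j]. *)
have S3sub : S3 `<=` pair_left @^-1` Q `|` pair_right @^-1` Q `|` U j.
  move=> q [[Vl Hl] [Vr Hr]].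
  have [Ql|/not_andP[//|/contrapT cl]] := pselect (Q (pair_left q)).
    by left; left.
  have [Qr|/not_andP[//|/contrapT cr]] := pselect (Q (pair_right q)).
    by left; right.
  right; exists j; rewrite /=//; split; split => //.
    by case: cl => // /CH2.
  by case: cr => // /CH1.
apply: (@le_trans _ _ (nu3 (pair_left @^-1` Q) + nu3 (pair_right @^-1` Q) +
                      nu3 (U j))).
  apply: (@le_trans _ _ (nu3 (pair_left @^-1` Q `|` pair_right @^-1` Q `|` U j))).
    rewrite le_measure ?inE//; apply: measurableU => //; exact: measurableU.
  apply: (le_trans (measureU2 _ _ _)) => //; first exact: measurableU.
  by rewrite leeD2r// measureU2.
rewrite nu3_left// nu3_right//.
have -> : e%:E = e'%:E * nu setT + e'%:E * nu setT + e'%:E.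
  rewrite -(fineK nuT) -/K -!EFinM -!EFinD; congr (_%:E).
  by rewrite /e'; field; rewrite gt_eqF.
by rewrite !leeD// ?lee_wpmul2r// ?Ce// ltW.
Qed.

End FiberConst.
Arguments pair_left {d S} q.
Arguments pair_right {d S} q.

Lemma null_measureU d (T : measurableType d) (R : realType)
    (m : {measure set T -> \bar R}) (A B : set T) :
  measurable A -> measurable B -> m A = 0%E -> m B = 0%E -> m (A `|` B) = 0%E.
Proof.
move=> mA mB A0 B0; apply/eqP; rewrite eq_le measure_ge0 andbT.
by apply: (le_trans (measureU2 _ mA mB)); rewrite [X in (X + _)%E]A0 [X in (_ + X)%E]B0 adde0.
Qed.

Section Split.
Local Open Scope ereal_scope.
Context d (S : measurableType d) (R : realType).
Variable nu : {finite_measure set S -> \bar R}.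
Local Notation nu2 := (nu \x nu).
Local Notation nu3 := (nu2 \x nu).

Lemma nu2_le0 (A B : set (S * S)) : measurable A -> measurable B ->
  A `<=` B -> nu2 B = 0 -> nu2 A = 0.
Proof.
move=> mA mB AB B0; apply/eqP; rewrite eq_le measure_ge0 andbT -[leRHS]B0.
by rewrite le_measure ?inE.
Qed.

(** [P] is the set of those [y] over which the fibre of [V \ H] is null. For [(x, y)] in [V & H],
    the section of the null set of triples is exactly that fibre, so Fubini's theorem puts almost
    every such [y] in [P]. *)
Lemma fiber_const_split (V H : set (S * S)) :
  measurable V -> measurable H ->
  nu3 [set q | (V `&` H) (pair_left q) /\ (V `\` H) (pair_right q)] = 0 ->
  exists P : set S, [/\ measurable P,
    nu2 ((V `&` H) `&` [set p | ~ P p.2]) = 0 &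
    nu2 ((V `\` H) `&` [set p | P p.2]) = 0].
Proof.
move=> mV mH; set S3 := [set q | _] => S30.
have mVH : measurable (V `&` H) by exact: measurableI.
have mVD : measurable (V `\` H) by exact: measurableD.
have mS3 : measurable S3.
  rewrite [S3](_ : _ = pair_left @^-1` (V `&` H) `&`
                       pair_right @^-1` (V `\` H)); last by [].
  apply: measurableI; first exact: (measurable_preimage (@measurable_pair_left _ _)).
  exact: (measurable_preimage (@measurable_pair_right _ _)).
pose b y := nu (ysection (V `\` H) y).
have mb : measurable_fun setT b by exact: measurable_fun_ysection.
pose P := [set y | b y = 0].
have mP : measurable P := measurable_preimage mb (emeasurable_set1 0).
have mP2 : measurable [set p : S * S | P p.2].
  exact: (measurable_preimage (@measurable_snd _ _ S S)).
exists P; split => //.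
  have := prod_xsection_null mS3 S30.
  set X := [set x | _] => X0.
  have mX : measurable X.
    rewrite -[X]setTI; apply: emeasurable_fun_o_infty => //.
    exact: measurable_fun_xsection.
  apply: (nu2_le0 _ mX _ X0).
    by apply: measurableI => //; exact: measurableC.
  move=> [x y] [VHxy /= nP]; rewrite /X /=.
  rewrite (_ : xsection S3 (x, y) = ysection (V `\` H) y).
    by rewrite lt0e measure_ge0 andbT; apply/eqP.
  apply/seteqP; split => x'; rewrite /xsection/ysection/= !inE /S3/=.
    by case.
  by split.
rewrite prod_ysectionE; last exact: measurableI.
rewrite integral0_eq// => y _.
have [Py|nPy] := pselect (P y).
  rewrite -[RHS]Py; congr (nu _); apply/seteqP; split => x'.
    by rewrite /ysection/= !inE => -[].
  by rewrite /ysection/= !inE.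
rewrite (_ : ysection _ _ = set0) ?measure0//; apply/seteqP; split => // x'.
by rewrite /ysection/= inE => -[].
Qed.

(* Off the diagonal, [H] coincides almost everywhere with [P p.2] and with
   [Q p.1]; comparing them on [W i * W j] and [W i * W k], for [i], [j], [k]
   distinct, shows that [P] is null or conull. *)
Lemma product_ergodic (D H : set (S * S)) (L : set S) (W : 'I_3 -> set S) :
  measurable D -> measurable H -> measurable L -> nu (~` L) = 0 ->
  (forall i, measurable (W i) /\ 0 < nu (W i)) -> \bigcup_i W i = setT ->
  (forall x y i j, L x -> L y -> W i x -> W j y -> i != j -> D (x, y)) ->
  nu3 [set q | (D `&` H) (pair_left q) /\ (D `\` H) (pair_right q)] = 0 ->
  (let tr (A : set (S * S)) := (fun p => (p.2, p.1)) @^-1` A in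
   nu3 [set q | (tr D `&` tr H) (pair_left q) /\
                (tr D `\` tr H) (pair_right q)] = 0) ->
  nu2 (D `&` H) = 0 \/ nu2 (D `\` H) = 0.
Proof.
move=> mD mH mL L0 WP WT WD /fiber_const_split[//|//|P [mP PH PD]] trDH.
have mtr (A : set (S * S)) : measurable A ->
    measurable ((fun p : S * S => (p.2, p.1)) @^-1` A).
  by move=> mA; exact: (measurable_preimage (@measurable_swap _ _)).
have [Q [mQ QH QD]] := fiber_const_split (mtr _ mD) (mtr _ mH) trDH.
have mC (A : set S) : measurable A -> measurable (~` A) by exact: measurableC.
have mfst (A : set S) : measurable A -> measurable [set p : S * S | A p.1].
  by move=> mA; exact: (measurable_preimage (@measurable_fst _ _ S S)).
have msnd (A : set S) : measurable A -> measurable [set p : S * S | A p.2].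
  by move=> mA; exact: (measurable_preimage (@measurable_snd _ _ S S)).
have mDH : measurable (D `&` H) by exact: measurableI.
have mDD : measurable (D `\` H) by exact: measurableD.
have {}QH : nu2 ((D `&` H) `&` [set p | ~ Q p.1]) = 0.
  rewrite -nu2_swap; last by apply: measurableI => //; exact: (mfst _ (mC _ mQ)).
  by rewrite -[RHS]QH.
have {}QD : nu2 ((D `\` H) `&` [set p | Q p.1]) = 0.
  rewrite -nu2_swap; last by apply: measurableI => //; exact: mfst.
  by rewrite -[RHS]QD.
have nu2U (A B : set (S * S)) : measurable A -> measurable B ->
    nu2 A = 0 -> nu2 B = 0 -> nu2 (A `|` B) = 0.
  by move=> *; exact: null_measureU.
have LE (A : set S) : measurable A -> nu (A `&` L) = nu A.
  move=> mA; apply/eqP; rewrite eq_le; apply/andP; split.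
    by rewrite le_measure ?inE//; exact: measurableI.
  rewrite -[leRHS]adde0 -[X in _ + X]L0.
  apply: (@le_trans _ _ (nu ((A `&` L) `|` ~` L))).
    rewrite le_measure ?inE//; first by apply: measurableU; [exact: measurableI|exact: mC].
    by move=> x Ax; have [Lx|nLx] := pselect (L x); [left|right].
  by rewrite measureU2//; [exact: measurableI|exact: mC].
(* For [i != j] the rectangle [W i * W j] over [L] lies in [D], and a rectangle is null only if one
   of its sides is. *)
have key (A B : set S) i j : measurable A -> measurable B -> i != j ->
    nu2 (D `&` [set p | A p.1 /\ B p.2]) = 0 ->
    nu (A `&` W i) = 0 \/ nu (B `&` W j) = 0.
  move=> mA mB ij AB0; have [mWi _] := WP i; have [mWj _] := WP j.
  have mAW : measurable (A `&` W i) by exact: measurableI.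
  have mBW : measurable (B `&` W j) by exact: measurableI.
  have : nu2 (((A `&` W i) `&` L) `*` ((B `&` W j) `&` L)) = 0.
    apply: (nu2_le0 _ _ _ AB0).
    - by apply: measurableX; exact: measurableI.
    - by apply: measurableI => //; apply: measurableI; [exact: mfst|exact: msnd].
    - move=> [x y] /= [[[Ax Wx] Lx] [[By Wy] Ly]]; split => //.
      exact: (WD _ _ i j).
  rewrite product_measure1E; [|exact: measurableI|exact: measurableI].
  by move/eqP; rewrite mule_eq0 => /orP[/eqP|/eqP] E0; [left|right];
    rewrite -LE.
have mPH : measurable (D `&` H `&` [set p | ~ P p.2]).
  by apply: measurableI => //; exact: (msnd _ (mC _ mP)).
have mPD : measurable ((D `\` H) `&` [set p | P p.2]).
  by apply: measurableI => //; exact: msnd.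
have mQH : measurable (D `&` H `&` [set p | ~ Q p.1]).
  by apply: measurableI => //; exact: (mfst _ (mC _ mQ)).
have mQD : measurable ((D `\` H) `&` [set p | Q p.1]).
  by apply: measurableI => //; exact: mfst.
(* Whether or not such a pair is in [H], it violates one of the two descriptions of [H], by [P] or
   by [Q]; hence it lies in a null set. *)
have QP : nu2 (D `&` [set p | Q p.1 /\ (~` P) p.2]) = 0.
  apply: (nu2_le0 _ _ _ (nu2U _ _ mPH mQD PH QD)).
  - by apply: measurableI => //; apply: measurableI; [exact: (mfst _ mQ)|exact: (msnd _ (mC _ mP))].
  - exact: measurableU.
  - move=> p [Dp [Qp nPp]]; have [Hp|nHp] := pselect (H p).
      by left; split; [split|].
    by right; split; [split|].
have PQ : nu2 (D `&` [set p | (~` Q) p.1 /\ P p.2]) = 0.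
  apply: (nu2_le0 _ _ _ (nu2U _ _ mPD mQH PD QH)).
  - by apply: measurableI => //; apply: measurableI; [exact: (mfst _ (mC _ mQ))|exact: (msnd _ mP)].
  - exact: measurableU.
  - move=> p [Dp [Qp nPp]]; have [Hp|nHp] := pselect (H p).
      by right; split; [split|].
    by left; split; [split|].
have nu0W (A : set S) : measurable A ->
    (forall i, nu (A `&` W i) = 0) -> nu A = 0.
  move=> mA AW.
  have AE : A = A `&` W ord0 `|` A `&` W (inord 1) `|` A `&` W (inord 2).
    rewrite -!setIUr; apply/seteqP; split => [x Ax|x []//]; split => //.
    have : (\bigcup_i W i) x by rewrite WT.
    move=> [[[|[|[|//]]] ki] _ Wx].
    - by left; left; move: Wx; congr (W _ x); exact: val_inj.
    - by left; right; move: Wx; congr (W _ x); apply: val_inj; rewrite /= inordK.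
    - by right; move: Wx; congr (W _ x); apply: val_inj; rewrite /= inordK.
  have mAW i : measurable (A `&` W i) by apply: measurableI => //; case: (WP i).
  rewrite AE; apply: (null_measureU _ _ _ (AW _)) => //; first exact: measurableU.
  by apply: (null_measureU _ _ (AW _) (AW _)).
have mX (A : set S) : measurable A -> measurable (setT `*` A : set (S * S)).
  by move=> mA; exact: measurableX.
have X0 (A : set S) : measurable A -> nu A = 0 -> nu2 (setT `*` A) = 0.
  by move=> mA A0; rewrite product_measure1E// [X in _ * X]A0 mule0.
have mCP := mC _ mP.
have [P0|nP0] := eqVneq (nu P) 0.
  left; apply: (nu2_le0 _ _ _ (nu2U _ _ mPH (mX _ mP) PH (X0 _ mP P0))) => //.
    by apply: measurableU => //; exact: mX.
  by move=> p DHp; have [Pp|nPp] := pselect (P p.2); [right; split|left; split].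
have [nP1|nP1] := eqVneq (nu (~` P)) 0.
  right; apply: (nu2_le0 _ _ _ (nu2U _ _ mPD (mX _ mCP) PD (X0 _ mCP nP1))) => //.
    by apply: measurableU => //; exact: mX.
  by move=> p DHp; have [Pp|nPp] := pselect (P p.2); [left; split|right; split].
exfalso.
have [j Pj] : exists j, nu (P `&` W j) != 0.
  apply: contrapT => /forallNP nPW; move/eqP: nP0; apply; apply: nu0W => // i.
  by have /negP/negPn/eqP := nPW i.
have [k Pk] : exists k, nu (~` P `&` W k) != 0.
  apply: contrapT => /forallNP nPW; move/eqP: nP1; apply.
  apply: nu0W => [|i]; first exact: mC.
  by have /negP/negPn/eqP := nPW i.
(* Three sets are used so that some [i] avoids both [j] and [k], which may differ; on [W i], both
   [Q] and its complement then turn out to be null. *)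
have [i /norP[ij ik]] : exists i : 'I_3, ~~ ((i == j) || (i == k)).
  apply/existsP; rewrite -negb_forall; apply/negP => /forallP jk.
  have : (#|'I_3| <= #|pred2 j k|)%N.
    by apply: subset_leq_card; apply/fintype.subsetP => i _; exact: jk.
  by rewrite card_ord card2; case: (_ != _).
have [mWi Wi0] := WP i.
have Q1 : nu (Q `&` W i) = 0.
  by have [//|/eqP] := key _ _ i k mQ (mC _ mP) ik QP; rewrite (negPf Pk).
have Q2 : nu (~` Q `&` W i) = 0.
  by have [//|/eqP] := key _ _ i j (mC _ mQ) mP ij PQ; rewrite (negPf Pj).
suff W0 : nu (W i) = 0 by rewrite W0 ltxx in Wi0.
rewrite (_ : W i = (Q `&` W i) `|` (~` Q `&` W i)).
  by apply: null_measureU => //; apply: measurableI => //; exact: mC.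
by rewrite -setIUl setUv setTI.
Qed.

End Split.

(** * Regularity of finite Borel measures *)

Section Regularity.
Local Open Scope ereal_scope.
Context (T : ptopologicalType) (R : realType).
Local Notation borelT := (g_sigma_algebraType (@open T)).
Variable m : {measure set borelT -> \bar R}.
Hypothesis mT : m setT < +oo.

Lemma open_borel (U : set borelT) : open (U : set T) -> measurable U.
Proof. exact: sub_sigma_algebra. Qed.

Lemma closed_borel (C : set borelT) : closed (C : set T) -> measurable C.
Proof.
move=> cC; rewrite -(setCK C); apply: measurableC; apply: open_borel.
exact: closed_openC.
Qed.

Let finm (A : set borelT) : measurable A -> m A < +oo.
Proof. by move=> mA; apply: le_lt_trans mT; rewrite le_measure ?inE. Qed.

(** Finite unions of the [C i] are closed, and continuity from above makes one of them good enough;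
    the strict inequality leaves the room needed. *)
Let union_approx (U : set borelT) (C : nat -> set borelT) (e : R) :
  measurable U -> (forall i, closed (C i : set T)) ->
  m (U `\` \bigcup_i C i) < e%:E ->
  exists D : set borelT,
    [/\ closed (D : set T), D `<=` \bigcup_i C i & m (U `\` D) <= e%:E].
Proof.
move=> mU cC me.
pose D n : set borelT := \bigcup_(i in `I_n) C i.
have cD n : closed (D n : set T) by apply: closed_bigcup.
have mD n := closed_borel (cD n).
have mUD n : measurable (U `\` D n) by exact: measurableD.
have mUC : measurable (U `\` \bigcup_i C i).
  by apply: measurableD => //; apply: bigcupT_measurable => i; exact: closed_borel.
have UD : \bigcap_n (U `\` D n) = U `\` \bigcup_i C i.
  apply/seteqP; split => [x UDx|x [Ux nC] n _].
    split; first by case: (UDx 0%N I).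
    by move=> [i _ Ci]; have [_] := UDx i.+1 I; apply; exists i => /=.
  by split => // -[i _ Ci]; apply: nC; exists i.
have cv : m (U `\` D n) @[n --> \oo] --> m (U `\` \bigcup_i C i).
  rewrite -UD; apply: nonincreasing_cvg_mu => //.
  - exact: finm.
  - by rewrite UD.
  - move=> i j ij; apply/subsetPset => x [Ux nD]; split => // -[k /= ki Ck].
    by apply: nD; exists k => //=; exact: leq_trans ij.
have [n /ltW mn] := cvge_exists_lt cv me.
by exists (D n); split => // x [i _ Ci]; exists i.
Qed.

Hypothesis open_Fsigma : forall U : set T, open U ->
  exists F : nat -> set T, (forall i, closed (F i)) /\ U = \bigcup_i F i.

(** The sets squeezed between a closed and an open set up to any error form a sigma-algebra; the
    open outer set is what makes the class stable under complement. Open sets belong to it because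
    they are countable unions of closed sets. *)
Lemma closed_inner_regular (A : set borelT) (e : R) :
  measurable A -> (0 < e)%R ->
  exists C : set borelT,
    [/\ closed (C : set T), C `<=` A & m (A `\` C) <= e%:E].
Proof.
pose Reg := [set A : set borelT | measurable A /\ forall e : R, (0 < e)%R ->
  exists C U : set borelT, [/\ closed (C : set T), open (U : set T), C `<=` A,
    A `<=` U & m (U `\` C) <= e%:E]].
move=> mA e0; have : Reg A; last first.
  move=> [_ /(_ _ e0) [C [U [cC oU CA AU UC]]]]; exists C; split => //.
  have mC := closed_borel cC; have mU := open_borel oU.
  apply: le_trans UC; rewrite le_measure ?inE//; [exact: measurableD..|].
  exact: setSD.
apply: (@smallest_sub _ (sigma_algebra setT) (@open T)) mA => {A e e0}; last first.
  move=> U oU; split; first exact: open_borel.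
  move=> e e0; have [F [cF UF]] := open_Fsigma oU.
  have [|D [cD DF mD]] := @union_approx U F e (open_borel oU) cF.
    by rewrite -UF setDv measure0 lte_fin.
  by exists D, U; split => //; rewrite UF.
split.
- split=> [|e e0]; first exact: measurable0.
  exists set0, set0; split => //; [exact: closed0|exact: open0|].
  by rewrite setDv measure0 lee_fin ltW.
- move=> A [mA rA]; rewrite setTD; split; first exact: measurableC.
  move=> e /rA[C [U [cC oU CA AU UC]]]; exists (~` U), (~` C); split.
  + exact: open_closedC.
  + exact: closed_openC.
  + exact: subsetC.
  + exact: subsetC.
  + by rewrite setDE setCK setIC -setDE.
- move=> A rA; split; first by apply: bigcupT_measurable => i; case: (rA i).
  (* The errors [e2 / 2^(i+1)] add up to [e2], which must be strictly below [e] for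
     [union_approx]. *)
  move=> e e0; pose e2 := (e / 4)%R; have e20 : (0 < e2)%R by rewrite divr_gt0.
  have epos i : (0 < e2 / (2 ^ i.+1)%:R)%R.
    by rewrite divr_gt0// ltr0n expn_gt0.
  have /choice[CU CUP] : forall i, exists CU : set borelT * set borelT,
    [/\ closed (CU.1 : set T), open (CU.2 : set T), CU.1 `<=` A i,
       A i `<=` CU.2 & m (CU.2 `\` CU.1) <= (e2 / (2 ^ i.+1)%:R)%:E].
    move=> i; have [_ /(_ _ (epos i)) [C [U ?]]] := rA i.
    by exists (C, U).
  pose U := \bigcup_i (CU i).2; pose F i := (CU i).1.
  have oU : open (U : set T) by apply: bigcup_open => i _; case: (CUP i).
  have mU := open_borel oU.
  have mF i : measurable (F i) by apply: closed_borel; case: (CUP i).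
  have mUi i : measurable (CU i).2 by apply: open_borel; case: (CUP i).
  have UFe : m (U `\` \bigcup_i F i) < e%:E.
    apply: (@le_lt_trans _ _ e2%:E); last first.
      by rewrite lte_fin /e2; lra.
    apply: (@le_trans _ _ (\sum_(i <oo) m ((CU i).2 `\` F i))).
      apply: measure_sigma_subadditive.
      - by move=> i; exact: measurableD.
      - apply: measurableD => //; exact: bigcupT_measurable.
      - move=> x [[i _ Ux] nF]; exists i => //; split => // Fx.
        by apply: nF; exists i.
    apply: le_trans (epsilon_trick0 xpredT (ltW e20)).
    by apply: lee_nneseries => // i _; case: (CUP i).
  have [|D [cD DF mD]] := @union_approx U F e mU _ UFe.
    by move=> i; case: (CUP i).
  exists D, U; split => //.
  + apply: (subset_trans DF) => x [i _ Fx]; exists i => //.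
    by case: (CUP i) => _ _ + _ _; apply.
  + move=> x [i _ Ax]; exists i => //.
    by case: (CUP i) => _ _ _ + _; apply.
Qed.

End Regularity.

(** * Compactness through embeddings, and translations of the Lebesgue measure *)

(** When all open sets of [X] are pulled back from [Y], a cluster point of the image filter gives
    one of the filter itself. This is how compactness in a subtype or in the tangent bundle is read
    off in a space of vectors. *)
Lemma compact_embedding (X Y : topologicalType) (f : X -> Y) (A : set X) :
  (forall U, open U -> exists2 W, open W & U = f @^-1` W) ->
  compact (f @` A) -> compact A.
Proof.
move=> emb cfA F PF FA.
have fFA : (f @ F) (f @` A).
  by rewrite -[_ (_ @` _)]/(F (f @^-1` (f @` A))); apply: filterS FA => x Ax; exists x.
have [_ [[a Aa <-] clu]] := cfA (f @ F) _ fFA.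
exists a; split => // B U FB; rewrite nbhsE => -[V [oV Va] VU].
have [W oW VW] := emb _ oV; rewrite VW in Va VU.
have fB : (f @ F) (f @` (B `&` A)).
  rewrite -[_ (_ @` _)]/(F (f @^-1` (f @` (B `&` A)))).
  by apply: filterS (filterI FB FA) => x [Bx Ax]; exists x.
have nW : nbhs (f a) W by rewrite nbhsE; exists W.
have [_ [[b [Bb _] <-] Wb]] := clu _ W fB nW.
by exists b; split => //; exact: VU.
Qed.

Section Translation.
Local Open Scope ereal_scope.
Context (R : realType).
Local Notation lambda := (@lebesgue_measure R).

Lemma lebesgue_measure_shift (c : R) (A : set R) : measurable A ->
  lambda ((fun t => (t + c)%R) @^-1` A) = lambda A.
Proof.
move=> mA; rewrite -[LHS]/(pushforward lambda
  (fun t : R => (t + c)%R : measurableTypeR R) A).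
apply/esym/lebesgue_measure_unique => //=; first exact: measurable_funD.
move=> _ _ [[a b] _ <-]; rewrite /pushforward.
rewrite (_ : _ @^-1` _ = `](a - c)%R, (b - c)%R]%classic).
  rewrite !lebesgue_measure_itv/= !lte_fin ltrD2r.
  by case: ifPn => // _; rewrite -!EFinB; congr (_%:E); lra.
apply/seteqP; split => t /=; rewrite !in_itv/= => /andP[? ?]; apply/andP; split; lra.
Qed.

Lemma lebesgue_measure_reflect (c : R) (A : set R) : measurable A ->
  lambda ((fun t => (c - t)%R) @^-1` A) = lambda A.
Proof.
move=> mA; rewrite -[RHS](lebesgue_measure_shift c)//.
rewrite -[RHS]lebesgue_measureN; last first.
  by rewrite -[X in measurable X]setTI; apply: measurable_funD.
by congr (lambda _); apply/seteqP; split => t /=; rewrite addrC.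
Qed.

End Translation.

(** * Projective space *)

Lemma open_neq0 (R : realType) : open [set r : R | r != 0].
Proof.
rewrite (_ : [set r | _] = ~` [set (0 : R)]).
  by apply: closed_openC; exact: closed_eq.
by apply/seteqP; split=> r /= /eqP.
Qed.

Section Form.
Context (R : realType) (n : nat).
Local Notation vec := ('rV[R]_n.+2).
Implicit Types (u v w : vec) (p q : RP R n).

Lemma formC u v : form u v = form v u.
Proof. by apply: eq_bigr => i _; rewrite mulrAC. Qed.

Lemma formDl u v w : form (u + v) w = form u w + form v w.
Proof.
by rewrite /form -big_split; apply: eq_bigr => i _; rewrite !mxE mulrDr mulrDl.
Qed.

Lemma formZl (a : R) u v : form (a *: u) v = a * form u v.
Proof.
by rewrite /form big_distrr; apply: eq_bigr => i _ /=; rewrite !mxE; ring.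
Qed.

Lemma formDr u v w : form w (u + v) = form w u + form w v.
Proof. by rewrite formC formDl !(formC w). Qed.

Lemma formZr (a : R) u v : form u (a *: v) = a * form u v.
Proof. by rewrite formC formZl formC. Qed.

Lemma formNl u v : form (- u) v = - form u v.
Proof. by rewrite -scaleN1r formZl mulN1r. Qed.

Lemma formNr u v : form u (- v) = - form u v.
Proof. by rewrite formC formNl formC. Qed.

Lemma form_continuous : continuous (fun p : vec * vec => form p.1 p.2).
Proof.
rewrite /form => p.
have -> : (fun q : vec * vec => \sum_i form_sign R i * q.1 0 i * q.2 0 i) =
          \sum_i (fun q : vec * vec => form_sign R i * q.1 0 i * q.2 0 i).
  by apply/funext => q; rewrite fct_sumE.
elim/big_ind : _ => [|g h cg ch|i _].
- exact: cst_continuous.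
- exact: continuousD.
- have c1 : (q : vec * vec).1 0 i @[q --> p] --> (p : vec * vec).1 0 i.
    apply: (@continuous_comp _ _ _ (fst : vec * vec -> vec) (fun v : vec => v 0 i) p).
      exact: cvg_fst.
    exact: coord_continuous.
  have c2 : (q : vec * vec).2 0 i @[q --> p] --> (p : vec * vec).2 0 i.
    apply: (@continuous_comp _ _ _ (snd : vec * vec -> vec) (fun v : vec => v 0 i) p).
      exact: cvg_snd.
    exact: coord_continuous.
  by apply: cvgM => //; apply: cvgM => //; exact: cvg_cst.
Qed.

Lemma cvg_form (T : Type) (F : set_system T) (FF : Filter F) (g h : T -> vec) u v :
  g @ F --> u -> h @ F --> v -> form (g x) (h x) @[x --> F] --> form u v.
Proof.
move=> gu hv; apply: (@cvg_comp _ _ _ (fun x => (g x, h x)) (fun p : vec * vec => form p.1 p.2)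
  F (nbhs (u, v))).
  exact: (cvg_pair gu hv).
exact: (@form_continuous (u, v)).
Qed.

Variable f : 'cV[R]_n.+2.

Definition chart_form u : R := (u *m f) 0 0.
Local Notation phi := chart_form.

Lemma phiD u v : phi (u + v) = phi u + phi v.
Proof. by rewrite /chart_form mulmxDl mxE. Qed.

Lemma phiZ (a : R) u : phi (a *: u) = a * phi u.
Proof. by rewrite /chart_form -scalemxAl mxE. Qed.

Lemma phi0 : phi 0 = 0.
Proof. by rewrite /chart_form mul0mx mxE. Qed.

Lemma phi_neq0 u : phi u != 0 -> u != 0.
Proof. by apply: contra_neq => ->; exact: phi0. Qed.

Lemma phiE u : (u *m f = 1) <-> (phi u = 1).
Proof.
split=> [|pu]; first by rewrite /chart_form => ->; rewrite mxE.
by apply/matrixP => i j; rewrite !ord1 [RHS]mxE/= -/(phi u).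
Qed.

Lemma phi_continuous : continuous phi.
Proof.
move=> u; rewrite /chart_form.
have -> : (fun v : vec => (v *m f) 0 0) = \sum_i (fun v : vec => v 0 i * f i 0).
  by apply/funext => v; rewrite fct_sumE mxE.
elim/big_ind : _ => [|g h cg ch|i _].
- exact: cst_continuous.
- exact: continuousD.
- apply: (@continuous_comp _ _ _ (fun v : vec => v 0 i) (fun r : R => r * f i 0) u).
    exact: coord_continuous.
  exact: mulrr_continuous.
Qed.

Lemma affine_chartE p : affine_chart f p <-> phi (lift p) != 0.
Proof.
split; apply: contra_neq => E; last by rewrite /chart_form E mxE.
by apply/matrixP => i j; rewrite !ord1 [RHS]mxE -/(phi _).
Qed.

Lemma affine_chart_proj u : u != 0 -> affine_chart f (proj u) <-> phi u != 0.
Proof.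
move=> u0; rewrite affine_chartE; have [c [c0 ->]] := lift_proj u0.
by rewrite phiZ mulf_eq0 (negPf c0).
Qed.

(* Off the chart, [sec p = 0]. *)
Definition sec p : vec := locked ((phi (lift p))^-1 *: lift p).

Lemma sec_proj u : phi u != 0 -> sec (proj u) = (phi u)^-1 *: u.
Proof.
move=> pu; have [c [c0 E]] := lift_proj (phi_neq0 pu).
by rewrite /sec -lock E phiZ scalerA invfM mulrAC mulVf// mul1r.
Qed.

Lemma phi_sec p : affine_chart f p -> phi (sec p) = 1.
Proof. by move/affine_chartE => p0; rewrite /sec -lock phiZ mulVf. Qed.

Lemma projZ (a : R) u : a != 0 -> u != 0 -> proj (a *: u) = proj u.
Proof.
move=> a0 u0; apply/esym/proj_eq => //; first by rewrite scaler_eq0 negb_or a0.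
by exists a.
Qed.

Lemma proj_sec p : affine_chart f p -> proj (sec p) = p.
Proof.
by move/affine_chartE => p0; rewrite /sec -lock projZ ?invr_eq0 ?lift_neq0// liftK.
Qed.

Lemma sec_neq0 p : affine_chart f p -> sec p != 0.
Proof. by move=> pf; apply: phi_neq0; rewrite phi_sec ?oner_neq0. Qed.

Lemma sec_eq p u : phi u = 1 -> proj u = p -> sec p = u.
Proof.
by move=> u1 <-; rewrite sec_proj u1 ?oner_neq0// invr1 scale1r.
Qed.

Lemma open_nonzero : open [set u : vec | u != 0].
Proof.
rewrite (_ : [set u | _] = ~` [set 0]); last first.
  by apply/seteqP; split=> u /= /eqP.
by apply: closed_openC; apply: accessible_closed_set1;
  apply: hausdorff_accessible; exact: norm_hausdorff.
Qed.

(** [RP] is a quotient of a subtype; here its open sets become open cones of nonzero vectors, on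
    which continuity is checked directly. *)
Lemma open_RP (U : set (RP R n)) :
  open U <-> open [set u : vec | u != 0 /\ U (proj u)].
Proof.
have projE (x : @nonzero R n) : proj (set_val x) = \pi_(RP R n)%qT x.
  rewrite /proj; congr (\pi_(RP R n)%qT _); apply: val_inj.
  by rewrite val_insubd mem_set//; exact: (set_valP x).
split=> [[W oW OU]|oU].
  rewrite (_ : [set u | _] = W `&` [set u | u != 0]).
    by apply: openI => //; exact: open_nonzero.
  apply/seteqP; split => u /=.
    move=> [u0 Uu]; split => //.
    have : (set_val @^-1` W) (exist _ u (mem_set u0) : @nonzero R n).
      by rewrite OU /= -projE.
    by [].
  move=> [Wu u0]; split => //.
  have : (set_val @^-1` W) (exist _ u (mem_set u0) : @nonzero R n) by [].
  by rewrite OU /= -projE.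
exists [set u : vec | u != 0 /\ U (proj u)] => //.
apply/seteqP; split => x /=; rewrite projE; first by case.
by move=> Ux; split => //; exact: (set_valP x).
Qed.

Lemma proj_continuous u : u != 0 -> {for u, continuous (@proj R n)}.
Proof.
move=> u0 U /=; rewrite nbhsE => -[V [/open_RP oV Vu] VU].
have : nbhs u [set u : vec | u != 0 /\ V (proj u)] by exact: open_nbhs_nbhs.
by apply: filterS => v [_ /VU].
Qed.

Lemma open_affine_chart : open (affine_chart f).
Proof.
apply/open_RP; rewrite (_ : [set u | _] = [set u | phi u != 0]).
  rewrite (_ : [set u | _] = phi @^-1` [set r | r != 0])//.
  apply: open_comp; first by move=> *; exact: phi_continuous.
  exact: open_neq0.
apply/seteqP; split => u /=; first by move=> [u0 /(affine_chart_proj u0)].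
by move=> pu; have u0 := phi_neq0 pu; split => //; apply/affine_chart_proj.
Qed.

Lemma sec_continuous p : affine_chart f p -> {for p, continuous sec}.
Proof.
move=> pf O /=; rewrite nbhsE => -[W [oW Wp] WO].
pose U := [set q | affine_chart f q /\ W (sec q)].
suff oU : open U.
  have : nbhs p U by exact: open_nbhs_nbhs.
  by apply: filterS => q [_ /WO].
apply/open_RP; rewrite (_ : [set u | _] =
  [set u : vec | phi u != 0 /\ W ((phi u)^-1 *: u)]); last first.
  apply/seteqP; split => u /=.
    by move=> [u0 [/(affine_chart_proj u0) pu]]; rewrite sec_proj.
  move=> [pu Wu]; have u0 := phi_neq0 pu; split => //.
  by split; [apply/affine_chart_proj|rewrite sec_proj].
rewrite openE => u [pu Wu].
have cu : (phi v)^-1 *: v @[v --> u] --> (phi u)^-1 *: u.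
  have FF := nbhs_filter u.
  apply: (@cvgZ _ _ _ _ FF); last exact: cvg_id.
  by apply: (@cvgV _ _ _ FF) => //; exact: phi_continuous.
have n1 : nbhs u [set v | W ((phi v)^-1 *: v)].
  by apply: cu; exact: open_nbhs_nbhs.
have n2 : nbhs u [set v | phi v != 0].
  have o0 : open_nbhs (phi u) [set r : R | r != 0] by split => //; exact: open_neq0.
  exact: (@phi_continuous u _ (open_nbhs_nbhs o0)).
by apply: filterS2 n1 n2 => v.
Qed.

End Form.

Lemma convex_setP (R : realType) (E : lmodType R) (A : set E) (x y : E) (t : R) :
  @convex_set R E A -> A x -> A y -> 0 <= t <= 1 -> A (t *: x + (1 - t) *: y).
Proof.
move=> cA Ax Ay /andP[t0 t1].
by have := cA x y (Itv01 t0 t1) (mem_set Ax) (mem_set Ay); rewrite inE.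
Qed.

(** * Projective isometries, and convexity of the domain in the given chart *)

Section Geometry.
Context (R : realType) (n : nat).
Local Notation vec := ('rV[R]_n.+2).
Local Notation mat := ('M[R]_n.+2).
Implicit Types (u v w : vec) (p q : RP R n) (A : mat).

Lemma mulmxr_continuous A : continuous (fun u : vec => u *m A).
Proof.
move=> u; have -> : (fun v : vec => v *m A) = \sum_i (fun v : vec => v 0 i *: row i A).
  by apply/funext => v; rewrite fct_sumE mulmx_sum_row.
elim/big_ind : _ => [|g h cg ch|i _].
- exact: cst_continuous.
- exact: continuousD.
- apply: (@continuous_comp _ _ _ (fun v : vec => v 0 i) (fun r : R => r *: row i A) u).
    exact: coord_continuous.
  exact: scalel_continuous.
Qed.

Lemma mulmx_neq0 A u : A \in unitmx -> u != 0 -> u *m A != 0.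
Proof. by move=> uA; apply: contra_neq => E; rewrite -[u](mulmxK uA) E mul0mx. Qed.

Lemma pmap_proj A u : A \in unitmx -> u != 0 -> pmap A (proj u) = proj (u *m A).
Proof.
move=> uA u0; rewrite /pmap; have [c [c0 ->]] := lift_proj u0.
by rewrite -scalemxAl projZ// mulmx_neq0.
Qed.

Lemma pmap_continuous A : A \in unitmx -> continuous (pmap A : RP R n -> RP R n).
Proof.
move=> uA; apply/continuousP => U /open_RP oU; apply/open_RP.
rewrite (_ : [set u | _] = (fun u : vec => u *m A) @^-1`
    [set u : vec | u != 0 /\ U (proj u)]).
  by apply: open_comp => // x _; exact: (@mulmxr_continuous A x).
apply/seteqP; split => u /=.
  by move=> [u0]; rewrite pmap_proj// => Uu; split => //; exact: mulmx_neq0.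
move=> [uA0 Uu]; have u0 : u != 0 by apply: contraNneq uA0 => ->; rewrite mul0mx.
by rewrite pmap_proj.
Qed.

Variables (Gamma : subgroupPO R n) (Omega Lambda : set (RP R n)).
Variable f : 'cV[R]_n.+2.
Hypothesis qF : quasi_Fuchsian Gamma Omega Lambda.
Hypothesis f_chart : closure Omega `<=` affine_chart f.
Local Notation phi := (chart_form f).

Lemma carrier_lift g : carrier Gamma g ->
  exists2 A, linear_lifts Gamma A & g = pmap A.
Proof.
move=> cg; have [A iA gA] := carrier_PO cg.
by exists A => //; split => //; rewrite -gA.
Qed.

Lemma limit_set_invariant g p : carrier Gamma g -> Lambda p -> Lambda (g p).
Proof.
case: qF => _ _ [x Ox ->] _ cg; rewrite /limit_set => lp U nU.
have [A [iA _] gA] := carrier_lift cg.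
have cgp : {for p, continuous g}.
  by rewrite gA; exact: (pmap_continuous (isometry_unit iA)).
have [z [zp [h ch hz] Uz]] := lp _ (cgp _ nU).
have [k [_ gK _]] := carrier_inv cg.
exists (g z); split => //; last by rewrite -hz; exists (g \o h) => //; exact: carrier_comp.
by rewrite (inj_eq (can_inj gK)).
Qed.

Lemma limit_set_closure : Lambda `<=` closure Omega.
Proof.
case: qF => _ [_ _ _ _ [Oinv _ _]] [x Ox ->] _ p /subset_limit_point.
by apply: closureS => _ [g cg <-]; rewrite -(Oinv g cg); exists x.
Qed.

Lemma limit_set_chart p : Lambda p -> affine_chart f p.
Proof. by move=> /limit_set_closure /f_chart. Qed.

(** Proper convexity provides some chart [f0], in general different from [f]. A segment for [f] is
    one for [f0] as soon as [f0] has the same sign at both ends; otherwise the segment for [f0]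
    would cross the hyperplane at infinity of [f], which the closure of [Omega] avoids. *)
Lemma closure_domain_convex u v (t : R) : phi u = 1 -> phi v = 1 ->
  closure Omega (proj u) -> closure Omega (proj v) -> 0 <= t <= 1 ->
  closure Omega (proj ((1 - t) *: u + t *: v)).
Proof.
move=> u1 v1 Ou Ov /andP[t0 t1].
case: qF => _ [_ [f0 [_ f0_chart cvx]] _ _ _] _ _.
have u0 : u != 0 by apply: (@phi_neq0 _ _ f); rewrite u1 oner_neq0.
have v0 : v != 0 by apply: (@phi_neq0 _ _ f); rewrite v1 oner_neq0.
set a := chart_form f0 u; set b := chart_form f0 v.
have a0 : a != 0 by apply/affine_chart_proj => //; exact: f0_chart.
have b0 : b != 0 by apply/affine_chart_proj => //; exact: f0_chart.
pose y s := s *: (a^-1 *: u) + (1 - s) *: (b^-1 *: v).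
have cy s : 0 <= s <= 1 -> chart_form f0 (y s) = 1 /\ closure Omega (proj (y s)).
  move=> s01; have [] := convex_setP (x := a^-1 *: u) (y := b^-1 *: v) cvx _ _ s01.
  - by split; [apply/phiE; rewrite phiZ mulVf|rewrite projZ// invr_eq0].
  - by split; [apply/phiE; rewrite phiZ mulVf|rewrite projZ// invr_eq0].
  - by move=> /phiE.
have py s : 0 <= s <= 1 -> s / a + (1 - s) / b != 0.
  move=> /cy[y1 Oy]; have y0 : y s != 0.
    by apply: (@phi_neq0 _ _ f0); rewrite y1 oner_neq0.
  have /affine_chart_proj-/(_ y0) := f_chart Oy.
  by rewrite /y phiD !phiZ u1 v1 !mulr1.
have ab : 0 < a * b.
  rewrite lt_neqAle eq_sym mulf_neq0//= leNgt; apply/negP => ab.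
  have ba : a - b != 0.
    by apply: contraTneq ab => /subr0_eq ->; rewrite -leNgt -expr2 sqr_ge0.
  (* At this parameter [s / a + (1 - s) / b], the value of [phi] on the point of the segment,
     vanishes. *)
  have /py : 0 <= a / (a - b) <= 1.
    have ab2 : 0 < (a - b) ^+ 2 by rewrite exprn_even_gt0.
    have -> : a / (a - b) = (a ^+ 2 - a * b) / (a - b) ^+ 2 by field.
    apply/andP; split.
      by rewrite divr_ge0 ?(ltW ab2)//; have := sqr_ge0 a; lra.
    by rewrite ler_pdivrMr// mul1r sqrrB; have := sqr_ge0 b; lra.
  by move/eqP; apply; field; rewrite a0 b0 ba.
(* [D] is the value of [f0] at the target point; divided by [D], this point has parameter
   [(1 - t) * a / D] on the segment for [f0]. *)
pose D := (1 - t) * a + t * b.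
have sq : 0 < D * a.
  have a20 : 0 < a ^+ 2 by rewrite exprn_even_gt0.
  rewrite /D mulrDl -!mulrA [b * a]mulrC -expr2.
  have [->|tneq1] := eqVneq t 1; first by rewrite subrr mul0r mul1r add0r.
  apply: ltr_pwDl; last by rewrite mulr_ge0// ltW.
  by rewrite mulr_gt0// subr_gt0 lt_neqAle tneq1.
have D0 : D != 0 by apply: contraTneq sq => ->; rewrite mul0r ltxx.
have aD : 0 < a / D.
  have -> : a / D = (D * a) / D ^+ 2 by field.
  by rewrite divr_gt0// exprn_even_gt0.
have bD : 0 < b / D.
  have -> : b / D = (a * b) / (a * D) by field; rewrite ?a0 ?D0.
  by rewrite divr_gt0// mulrC.
have /cy[_] : 0 <= (1 - t) * a / D <= 1.
  rewrite -mulrA mulr_ge0 ?subr_ge0//=; last exact: ltW.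
  have -> : (1 - t) * (a / D) = 1 - t * (b / D) by rewrite /D; field; exact: D0.
  by rewrite lerBlDr lerDl mulr_ge0// ltW.
have -> : y ((1 - t) * a / D) = D^-1 *: ((1 - t) *: u + t *: v).
  rewrite /y scalerDr !scalerA; congr (_ *: _ + _ *: _).
    by field; rewrite ?a0 ?D0.
  by rewrite /D; field; rewrite ?b0 ?andbT; exact: D0.
rewrite projZ ?invr_eq0//.
by apply: (@phi_neq0 _ _ f); rewrite phiD !phiZ u1 v1; lra.
Qed.

Lemma form_lift_proj u : u != 0 -> exists2 c : R, 0 < c &
  form (lift (proj u)) (lift (proj u)) = c * form u u.
Proof.
move=> u0; have [c [c0 ->]] := lift_proj u0; exists (c ^+ 2).
  by rewrite exprn_even_gt0.
by rewrite formZl formZr mulrA.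
Qed.

Lemma AdS_proj u : u != 0 -> AdS (proj u) <-> form u u < 0.
Proof.
move=> u0; rewrite /AdS/=; have [c c0 ->] := form_lift_proj u0.
by rewrite pmulr_rlt0.
Qed.

Lemma closure_domain_le0 u : u != 0 -> closure Omega (proj u) -> form u u <= 0.
Proof.
move=> u0 Ou; rewrite leNgt; apply/negP => fu.
pose U : set (RP R n) := [set p | 0 < form (lift p) (lift p)].
have oU : open U.
  apply/open_RP; rewrite (_ : [set v | _] = [set v : vec | v != 0] `&`
      ((fun v : vec => form v v) @^-1` [set r | 0 < r])).
    apply: openI; first exact: open_nonzero.
    apply: open_comp; last exact: open_gt.
    by move=> v _; apply: (cvg_form (nbhs_filter v)); exact: cvg_id.
  apply/seteqP; split=> v /= [v0]; have [c c0 E] := form_lift_proj v0;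
    by rewrite /U/= E pmulr_rgt0.
have Uu : U (proj u).
  by rewrite /U/=; have [c c0 ->] := form_lift_proj u0; rewrite pmulr_rgt0.
have [p [Op Up]] := Ou U (open_nbhs_nbhs (conj oU Uu)).
case: qF => _ [[OA _] _ _ _ _] _ _.
by have := OA _ Op; rewrite /AdS/= => /lt_trans/(_ Up); rewrite ltxx.
Qed.

End Geometry.

(** * Compactness and three points, transported from the sphere *)

Section Sphere.
Context (R : realType).

Lemma sphere_compact (k : nat) : compact (@sphere R k).
Proof.
apply: bounded_closed_compact.
  exists 1; split => // M M1 u /= su.
  apply: le_trans (ltW M1); rewrite /Num.norm/= mx_normrE.
  apply: bigmax_le => // -[i j] _ /=; rewrite ord1.
  rewrite -(@ler_pXn2r _ 2)// ?nnegrE//= expr1n real_normK ?num_real// -su.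
  by rewrite (bigD1 j)//= lerDl sumr_ge0// => l _; exact: sqr_ge0.
rewrite (_ : @sphere R k = (fun u : 'rV[R]_k => \sum_i u 0 i ^+ 2) @^-1` [set 1])//.
apply: preimage_closed; last exact: closed_eq.
move=> u _; have -> : (fun v : 'rV[R]_k => \sum_i v 0 i ^+ 2) =
    \sum_i (fun v : 'rV[R]_k => v 0 i ^+ 2).
  by apply/funext => v; rewrite fct_sumE.
elim/big_ind : _ => [|g h cg ch|i _].
- exact: cst_continuous.
- exact: continuousD.
- apply: (@continuous_comp _ _ _ (fun v : 'rV[R]_k => v 0 i) (fun r : R => r ^+ 2) u).
    exact: coord_continuous.
  exact: exprn_continuous.
Qed.

Lemma sphere_three_points (k : nat) : (2 <= k)%N ->
  exists u v w : 'rV[R]_k, [/\ sphere u, sphere v, sphere w & [/\ u != v, u != w & v != w]].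
Proof.
case: k => [//|[//|k]] _.
pose e (i : 'I_k.+2) : 'rV[R]_k.+2 := delta_mx 0 i.
have sP (a : R) i : a ^+ 2 = 1 -> sphere (a *: e i).
  move=> a1; rewrite /sphere/= (bigD1 i)//= !mxE !eqxx mulr1 a1 big1 ?addr0//.
  by move=> j ji; rewrite !mxE (negPf ji) andbF mulr0 expr0n.
pose j1 : 'I_k.+2 := fintype.lift ord0 ord0.
exists (1 *: e ord0), ((-1) *: e ord0), (1 *: e j1).
split; [exact/sP/expr1n|by apply: sP; rewrite sqrrN expr1n|exact/sP/expr1n|].
split; apply/eqP => /matrixP /(_ 0 ord0) /eqP; rewrite !mxE/= ?mulr1 ?mulr0.
- by rewrite -subr_eq0 opprK -mulr2n pnatr_eq0.
- by rewrite oner_eq0.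
- by rewrite oppr_eq0 oner_eq0.
Qed.

Lemma homeomorphic_compact (X : topologicalType) (A : set X) (k : nat) :
  homeomorphic A (@sphere R k) -> compact A.
Proof.
move=> [h [g [_ cg hK gK]]].
have cS : compact [set: @sphere R k].
  apply: (@compact_embedding _ _ (set_val : @sphere R k -> _)).
    by move=> U [W oW <-]; exists W.
  rewrite (_ : _ @` _ = @sphere R k); first exact: sphere_compact.
  apply/seteqP; split => [_ [u _ <-]|u su]; first exact: set_valP.
  by exists (exist _ u (mem_set su)).
rewrite (_ : A = (set_val \o g) @` setT).
  apply: continuous_compact => //; apply: continuous_subspaceT => x.
  by apply: continuous_comp; [exact: cg|exact: initial_continuous].
apply/seteqP; split => [x Ax|_ [u _ <-]]; last exact: set_valP.
by exists (h (exist _ x (mem_set Ax))) => //=; rewrite hK.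
Qed.

Lemma homeomorphic_three_points (X : topologicalType) (A : set X) (k : nat) :
  (2 <= k)%N -> homeomorphic A (@sphere R k) ->
  exists x : 'I_3 -> X, injective x /\ forall i, A (x i).
Proof.
move=> k2 [h [g [_ cg hK gK]]].
have [u [v [w [su sv sw [uv uw vw]]]]] := sphere_three_points k2.
pose s := [:: u; v; w].
have ss (i : 'I_3) : sphere (s`_i) by case: i => -[|[|[|//]]].
pose x i : X := set_val (g (exist (fun z => z \in @sphere R k) _ (mem_set (ss i)))).
exists x; split; last by move=> i; exact: set_valP.
move=> i j /val_inj /(can_inj gK) /(congr1 val) /= /eqP.
by case: i j => -[|[|[|//]]] ? [[|[|[|//]]] ?] /=;
  rewrite ?(negPf uv) ?(negPf uw) ?(negPf vw) ?[v == u]eq_sym ?[w == u]eq_sym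
    ?[w == v]eq_sym ?(negPf uv) ?(negPf uw) ?(negPf vw)// => _; apply: val_inj.
Qed.

End Sphere.

(** * Null coordinates on the unit tangent bundle *)

Section Pairs.
Local Open Scope quotient_scope.
Context (R : realType) (n : nat).
Local Notation vec := ('rV[R]_n.+2).
Implicit Types (a b P Q : vec) (w : pairs R n).

Lemma repr_pi a b : let w := \pi_(pairs R n) (a, b) in
  repr w = (a, b) \/ repr w = (- a, - b).
Proof.
move=> w; have /eqquotP : repr w = (a, b) %[mod pairs R n] by rewrite reprK.
by move=> /orP[/eqP ->|/eqP E]; [left|right; rewrite -[repr w]opprK -E].
Qed.

Lemma pi_opp a b : \pi_(pairs R n) (- a, - b) = \pi_(pairs R n) (a, b).
Proof. by apply/eqquotP/orP; right; apply/eqP; rewrite -[(a, b)]opprK. Qed.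

(* The tangent vector with null coordinates [P = u + v] and [Q = u - v]. *)
Definition tvec (z : vec * vec) : pairs R n :=
  \pi_(pairs R n) (2^-1 *: (z.1 + z.2), 2^-1 *: (z.1 - z.2)).

Lemma tvecN P Q : tvec (- P, - Q) = tvec (P, Q).
Proof. by rewrite /tvec -pi_opp/= -!scalerN !opprD !opprK. Qed.

Lemma half_add P Q : 2^-1 *: (P + Q) + 2^-1 *: (P - Q) = P.
Proof. by apply/rowP => i; rewrite !mxE; field. Qed.

Lemma half_sub P Q : 2^-1 *: (P + Q) - 2^-1 *: (P - Q) = Q.
Proof. by rewrite -scalerN opprB [P + Q]addrC half_add. Qed.

Lemma repr_tvec P Q : let w := tvec (P, Q) in
  repr w = (2^-1 *: (P + Q), 2^-1 *: (P - Q)) \/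
  repr w = (- (2^-1 *: (P + Q)), - (2^-1 *: (P - Q))).
Proof. exact: repr_pi. Qed.

Lemma tvec_repr w : w = tvec ((repr w).1 + (repr w).2, (repr w).1 - (repr w).2).
Proof.
rewrite /tvec/= -[LHS]reprK; case: (repr w) => u v /=; congr (\pi_(pairs R n) (_, _)).
  by rewrite scalerDr half_add.
by rewrite scalerBr half_sub.
Qed.

Lemma half_oppD P Q : - (2^-1 *: (P + Q)) + - (2^-1 *: (P - Q)) = - P.
Proof. by rewrite -opprD half_add. Qed.

Lemma half_oppB P Q : - (2^-1 *: (P + Q)) - - (2^-1 *: (P - Q)) = - Q.
Proof. by rewrite -opprD half_sub. Qed.

Lemma projN P : P != 0 -> proj (- P) = proj P.
Proof. by move=> P0; rewrite -scaleN1r projZ// oppr_eq0 oner_eq0. Qed.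

Lemma forward_end_tvec P Q : P != 0 -> forward_end (tvec (P, Q)) = proj P.
Proof.
move=> P0; rewrite /forward_end; have [->|->] := repr_tvec P Q.
  by rewrite half_add.
by rewrite half_oppD projN.
Qed.

Lemma backward_end_tvec P Q : Q != 0 -> backward_end (tvec (P, Q)) = proj Q.
Proof.
move=> Q0; rewrite /backward_end; have [->|->] := repr_tvec P Q.
  by rewrite half_sub.
by rewrite half_oppB projN.
Qed.

Lemma foot_tvec P Q : P + Q != 0 -> foot (tvec (P, Q)) = proj (P + Q).
Proof.
have h0 : 2^-1 != 0 :> R by rewrite invr_eq0 pnatr_eq0.
move=> PQ0; rewrite /foot; have [->|->] /= := repr_tvec P Q.
  by rewrite projZ.
by rewrite -scalerN projZ ?oppr_eq0// projN.
Qed.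

Lemma T1AdS_tvec P Q : T1AdS (tvec (P, Q)) <->
  [/\ form P P = 0, form Q Q = 0 & form P Q = -2].
Proof.
have E1 : form (2^-1 *: (P + Q)) (2^-1 *: (P + Q)) =
    (form P P + form Q Q) / 4 + form P Q / 2.
  by rewrite formZl formZr formDl !formDr [form Q P]formC; field.
have E2 : form (2^-1 *: (P - Q)) (2^-1 *: (P - Q)) =
    (form P P + form Q Q) / 4 - form P Q / 2.
  by rewrite formZl formZr formDl !formDr !formNl !formNr [form Q P]formC; field.
have E3 : form (2^-1 *: (P + Q)) (2^-1 *: (P - Q)) =
    (form P P - form Q Q) / 4.
  by rewrite formZl formZr formDl !formDr !formNr [form Q P]formC; field.
rewrite /T1AdS/=; have [->|->] := repr_tvec P Q;
  rewrite ?formNl ?formNr ?opprK E1 E2 E3;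
  (split=> -[h1 h2 h3]; split; lra).
Qed.

Lemma flow_tvec (t : R) P Q :
  flow t (tvec (P, Q)) = tvec (expR t *: P, expR (- t) *: Q).
Proof.
have E1 : cosh t *: (2^-1 *: (P + Q)) + sinh t *: (2^-1 *: (P - Q)) =
    2^-1 *: (expR t *: P + expR (- t) *: Q).
  by apply/rowP => i; rewrite !mxE /cosh /sinh; field.
have E2 : sinh t *: (2^-1 *: (P + Q)) + cosh t *: (2^-1 *: (P - Q)) =
    2^-1 *: (expR t *: P - expR (- t) *: Q).
  by apply/rowP => i; rewrite !mxE /cosh /sinh; field.
rewrite /flow; have [->|->] := repr_tvec P Q.
  by rewrite E1 ?E2.
by rewrite !scalerN -!opprD pi_opp E1 ?E2.
Qed.

Lemma act_tvec (A : 'M[R]_n.+2) P Q : act A (tvec (P, Q)) = tvec (P *m A, Q *m A).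
Proof.
rewrite /act; have [->|->] := repr_tvec P Q.
  by rewrite /tvec/= -!scalemxAl mulmxDl mulmxBl.
by rewrite !mulNmx pi_opp /tvec/= -!scalemxAl mulmxDl mulmxBl.
Qed.

End Pairs.

(* The parametrizations in the definition of the Bowen-Margulis measure provide a
   spacelike geodesic between any two points of the limit set; this is the only
   way in which [setting_geodesic] is obtained. *)
Record setting (R : realType) (n : nat) (Gamma : subgroupPO R n)
    (Omega Lambda : set (RP R n)) (f : 'cV[R]_n.+2) : Prop := Setting {
  setting_dim : (2 <= n)%N;
  setting_tf : torsion_free Gamma;
  setting_qF : quasi_Fuchsian Gamma Omega Lambda;
  setting_chart : closure Omega `<=` affine_chart f;
  setting_geodesic : forall xi eta, Lambda xi -> Lambda eta -> xi <> eta ->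
    exists w, [/\ nonwandering Lambda (convex_core Lambda f) w,
                  backward_end w = xi & forward_end w = eta] }.

(** * Signs of the form on the cone over the limit set *)

Section Cone.
Context (R : realType) (n : nat) (Gamma : subgroupPO R n).
Context (Omega Lambda : set (RP R n)) (f : 'cV[R]_n.+2).
Hypothesis S : setting Gamma Omega Lambda f.
Local Notation vec := ('rV[R]_n.+2).
Local Notation mat := ('M[R]_n.+2).
Local Notation phi := (chart_form f).
Local Notation sec := (sec f).
Local Notation core := (convex_core Lambda f).
Implicit Types (u v P Q : vec) (xi eta p : RP R n) (A : mat).

Let qF := setting_qF S.
Let f_chart := setting_chart S.

Lemma form_neq0 P Q : form P Q = -2 -> P != 0 /\ Q != 0.
Proof.
move=> PQ; split; apply: contra_eq_neq PQ => ->; rewrite -[0](scale0r 0).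
  by rewrite formZl mul0r eq_sym oppr_eq0 pnatr_eq0.
by rewrite formZr mul0r eq_sym oppr_eq0 pnatr_eq0.
Qed.

(** Keeping only the lifts that are positive in the chart removes the sign ambiguity, so that the
    sign of [form] between two limit points makes sense. *)
Definition cone : set vec := [set u | 0 < phi u /\ Lambda (proj u)].

Lemma phi_sec1 xi : Lambda xi -> phi (sec xi) = 1.
Proof. by move=> Lx; apply/phi_sec/(limit_set_chart qF f_chart). Qed.

Lemma proj_sec1 xi : Lambda xi -> proj (sec xi) = xi.
Proof. by move=> Lx; apply/proj_sec/(limit_set_chart qF f_chart). Qed.

Lemma cone_sec xi : Lambda xi -> cone (sec xi).
Proof. by move=> Lx; rewrite /cone/= phi_sec1// proj_sec1. Qed.

Lemma cone_neq0 u : cone u -> u != 0.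
Proof. by move=> [u0 _]; apply: (@phi_neq0 _ _ f); rewrite gt_eqF. Qed.

Lemma coneZ (a : R) u : 0 < a -> cone u -> cone (a *: u).
Proof.
move=> a0 cu; have u0 := cone_neq0 cu; case: cu => pu Lu.
by split; rewrite ?phiZ ?mulr_gt0// projZ// gt_eqF.
Qed.

Lemma cone_secE u : cone u -> u = phi u *: sec (proj u).
Proof.
by move=> [u0 _]; rewrite sec_proj ?gt_eqF// scalerA mulfV ?gt_eqF// scale1r.
Qed.

Lemma limit_set_three_points :
  exists x : 'I_3 -> RP R n, injective x /\ forall i, Lambda (x i).
Proof. by case: qF => _ _ _; exact: homeomorphic_three_points (setting_dim S). Qed.

Lemma limit_set_neq xi : exists2 eta, Lambda eta & eta <> xi.
Proof.
have [x [xi_inj Lx]] := limit_set_three_points.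
have [E|] := pselect (x ord0 = xi); last by exists (x ord0).
by exists (x ord_max) => //; rewrite -E => /xi_inj.
Qed.

Lemma nonwandering_tvec w : nonwandering Lambda core w -> exists P Q,
  [/\ w = tvec (P, Q), form P P = 0, form Q Q = 0, form P Q = -2 &
      Lambda (proj P) /\ Lambda (proj Q)].
Proof.
rewrite [w]tvec_repr; set P := _ + _; set Q := _ - _ => -[T _ fw bw].
have /T1AdS_tvec[PP QQ PQ] := T; exists P, Q; split => //.
have [P0 Q0] := form_neq0 PQ.
by rewrite forward_end_tvec// in fw; rewrite backward_end_tvec// in bw.
Qed.

(** A limit point is the forward endpoint of a spacelike geodesic issued from another limit point,
    and such endpoints are null. *)
Lemma form_sec0 xi : Lambda xi -> form (sec xi) (sec xi) = 0.
Proof.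
move=> Lx; have [eta Le ex] := limit_set_neq xi.
have [w [Nw bw fw]] := setting_geodesic S Le Lx ex.
have [P [Q [wE PP QQ PQ _]]] := nonwandering_tvec Nw.
have [P0 _] := form_neq0 PQ.
move: fw; rewrite wE forward_end_tvec// => <-.
by rewrite /sec -lock; have [c [_ ->]] := lift_proj P0; rewrite !(formZl, formZr) PP !mulr0.
Qed.

(** The midpoint of the two lifts lies over the closure of [Omega], where the form is nonpositive;
    the lifts being null, its square there is half of their product. *)
Lemma form_sec_le0 xi eta : Lambda xi -> Lambda eta -> form (sec xi) (sec eta) <= 0.
Proof.
move=> Lx Le; have h01 : 0 <= (2^-1 : R) <= 1 by apply/andP; split; lra.
have := closure_domain_convex qF f_chart (phi_sec1 Lx) (phi_sec1 Le) _ _ h01.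
rewrite !proj_sec1// => /(_ (limit_set_closure qF Lx) (limit_set_closure qF Le)).
move=> Om; have := closure_domain_le0 qF _ Om.
have -> : (1 - 2^-1) *: sec xi + 2^-1 *: sec eta != 0.
  by apply: (@phi_neq0 _ _ f); rewrite phiD !phiZ !phi_sec1// !mulr1 subrK oner_neq0.
move=> /(_ isT); have := form_sec0 Lx; have := form_sec0 Le.
move: (sec xi) (sec eta) => a b bb aa.
rewrite formDl !formDr !formZl !formZr aa bb [form b a]formC; lra.
Qed.

(** The null coordinates of the geodesic joining the two points have product -2, so the product of
    the lifts cannot vanish. *)
Lemma form_sec_lt0 xi eta : Lambda xi -> Lambda eta -> xi <> eta ->
  form (sec xi) (sec eta) < 0.
Proof.
move=> Lx Le xe; rewrite lt_neqAle form_sec_le0// andbT.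
have [w [Nw bw fw]] := setting_geodesic S Lx Le xe.
have [P [Q [wE PP QQ PQ [LP LQ]]]] := nonwandering_tvec Nw.
have [P0 Q0] := form_neq0 PQ.
move: fw bw; rewrite wE forward_end_tvec// backward_end_tvec// => fw bw.
have pP : phi P != 0.
  by apply/(affine_chart_proj f P0)/(limit_set_chart qF f_chart).
have pQ : phi Q != 0.
  by apply/(affine_chart_proj f Q0)/(limit_set_chart qF f_chart).
rewrite -fw -bw !sec_proj// formZl formZr formC PQ.
by rewrite !mulf_neq0// ?invr_eq0// oppr_eq0 pnatr_eq0.
Qed.

Lemma cone_null u : cone u -> form u u = 0.
Proof.
move=> cu; have [_ Lu] := cu.
by rewrite (cone_secE cu) formZl formZr form_sec0// !mulr0.
Qed.

Lemma cone_le0 u v : cone u -> cone v -> form u v <= 0.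
Proof.
move=> cu cv; have [u0 Lu] := cu; have [v0 Lv] := cv.
rewrite (cone_secE cu) (cone_secE cv) formZl formZr mulrA.
by rewrite mulr_ge0_le0 ?form_sec_le0// mulr_ge0 ?ltW.
Qed.

Lemma cone_lt0 u v : cone u -> cone v -> proj u <> proj v -> form u v < 0.
Proof.
move=> cu cv uv; have [u0 Lu] := cu; have [v0 Lv] := cv.
rewrite (cone_secE cu) (cone_secE cv) formZl formZr mulrA.
by rewrite pmulr_rlt0 ?form_sec_lt0// mulr_gt0.
Qed.

(* The pairs [(u + v, u - v)], for [(u, v)] tangent to the non-wandering set and of
   the sign for which the chart is positive. *)
Definition null_pairs : set (vec * vec) :=
  [set z | [/\ cone z.1, cone z.2 & form z.1 z.2 = -2]].

Lemma convex_core_sum P Q : cone P -> cone Q -> form P Q < 0 -> core (proj (P + Q)).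
Proof.
move=> cP cQ PQ; have [P0 LP] := cP; have [Q0 LQ] := cQ.
have pPQ : 0 < phi (P + Q) by rewrite phiD addr_gt0.
have PQ0 : P + Q != 0 by apply: (@phi_neq0 _ _ f); rewrite gt_eqF.
split.
  apply/AdS_proj => //; rewrite formDl !formDr !cone_null// [form Q P]formC; lra.
exists ((phi (P + Q))^-1 *: (P + Q)); last by rewrite projZ// invr_eq0 gt_eqF.
move=> K [cK LK].
pose t := phi P / phi (P + Q).
have t01 : 0 <= t <= 1.
  apply/andP; split; first by apply: divr_ge0; exact: ltW.
  by rewrite /t ler_pdivrMr// mul1r phiD lerDl ltW.
have KP xi : Lambda xi -> K (sec xi).
  by move=> Lx; apply: LK; split; [apply/phiE; exact: phi_sec1|rewrite proj_sec1].
have := convex_setP cK (KP _ LP) (KP _ LQ) t01; congr (K _).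
have -> : (phi (P + Q))^-1 *: (P + Q) =
    (phi (P + Q))^-1 *: (phi P *: sec (proj P) + phi Q *: sec (proj Q)).
  by rewrite -(cone_secE cP) -(cone_secE cQ).
rewrite scalerDr !scalerA; congr (_ *: _ + _ *: _).
  by rewrite mulrC.
by rewrite /t phiD; field; rewrite -phiD gt_eqF.
Qed.

Lemma nonwandering_null_pair z : null_pairs z -> nonwandering Lambda core (tvec z).
Proof.
case: z => P Q [/= cP cQ PQ]; have PQ0 : form P Q < 0 by rewrite PQ; lra.
have cc := convex_core_sum cP cQ PQ0.
split.
- by apply/T1AdS_tvec; rewrite !cone_null.
- rewrite foot_tvec//; apply: (@phi_neq0 _ _ f).
  by rewrite phiD gt_eqF// addr_gt0//; [case: cP|case: cQ].
- by rewrite forward_end_tvec ?cone_neq0//; case: cP.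
- by rewrite backward_end_tvec ?cone_neq0//; case: cQ.
Qed.

(** Since [form P Q = -2] while the form is nonpositive on positive lifts, [phi P] and [phi Q] have
    the same sign; if both are negative, [(- P, - Q)] represents the same tangent vector. *)
Lemma null_pair_exists w : nonwandering Lambda core w ->
  exists2 z, null_pairs z & w = tvec z.
Proof.
move=> Nw; have [P [Q [wE PP QQ PQ [LP LQ]]]] := nonwandering_tvec Nw.
have [P0 Q0] := form_neq0 PQ.
have pP : phi P != 0.
  by apply/(affine_chart_proj f P0)/(limit_set_chart qF f_chart).
have pQ : phi Q != 0.
  by apply/(affine_chart_proj f Q0)/(limit_set_chart qF f_chart).
have PE : P = phi P *: sec (proj P) by rewrite sec_proj// scalerA mulfV// scale1r.
have QE : Q = phi Q *: sec (proj Q) by rewrite sec_proj// scalerA mulfV// scale1r.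
have pPQ : 0 < phi P * phi Q.
  have := form_sec_le0 LP LQ; move: PQ; rewrite {1}PE {1}QE formZl formZr mulrA => E.
  by move: (form _ _) E => s E s0; nra.
have [P1|P1] := ltP 0 (phi P).
  exists (P, Q) => //; split => //; split => //=.
  by rewrite -(pmulr_rgt0 _ P1).
exists (- P, - Q); last by rewrite tvecN.
have pN u : phi (- u) = - phi u by rewrite -scaleN1r phiZ mulN1r.
have {}P1 : phi P < 0 by rewrite lt_neqAle pP.
split => /=; last by rewrite formNl formNr opprK.
- by split; rewrite ?pN ?oppr_gt0// projN.
- by split; rewrite ?pN ?oppr_gt0 ?projN// -(nmulr_rgt0 _ P1).
Qed.

Definition section_set : set vec := [set u | phi u = 1 /\ Lambda (proj u)].

Lemma section_set_compact : compact section_set.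
Proof.
have -> : section_set = sec @` Lambda.
  apply/seteqP; split => [u [u1 Lu]|_ [xi Lx <-]]; last first.
    by split; rewrite ?phi_sec1// proj_sec1.
  by exists (proj u) => //; exact: sec_eq.
apply: continuous_compact.
  apply: continuous_in_subspaceT => xi; rewrite inE => Lx.
  exact/sec_continuous/(limit_set_chart qF f_chart).
by case: qF => _ _ _; exact: homeomorphic_compact.
Qed.

End Cone.

Section ContinuousPair.
Context (T U V : topologicalType).

Lemma continuous_pair (f : T -> U) (g : T -> V) (x : T) :
  {for x, continuous f} -> {for x, continuous g} ->
  {for x, continuous (fun y => (f y, g y))}.
Proof. by move=> cf cg; apply: (cvg_pair (FF := nbhs_filter x)). Qed.

Lemma continuous_fst : continuous (@fst U V).
Proof. by move=> x; exact: cvg_fst. Qed.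

Lemma continuous_snd : continuous (@snd U V).
Proof. by move=> x; exact: cvg_snd. Qed.

End ContinuousPair.

(** * Continuity of the null coordinates *)

Section NullCoordinates.
Local Open Scope quotient_scope.
Context (R : realType) (n : nat) (f : 'cV[R]_n.+2).
Local Notation vec := ('rV[R]_n.+2).
Local Notation phi := (chart_form f).
Implicit Types (z : vec * vec) (w : pairs R n).

(** A tangent vector is a pair up to sign, and positivity of the chart on the first coordinate
    selects the sign; [null_coord] thereby inverts [tvec]. *)
Definition positive_rep z : vec * vec :=
  if 0 < phi z.1 then z else (- z.1, - z.2).

Definition null_coord w : vec * vec :=
  positive_rep ((repr w).1 + (repr w).2, (repr w).1 - (repr w).2).

Lemma phiN (u : vec) : phi (- u) = - phi u.
Proof. by rewrite -scaleN1r phiZ mulN1r. Qed.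

Lemma null_coord_tvec z : 0 < phi z.1 -> null_coord (tvec z) = z.
Proof.
case: z => P Q /= P0; rewrite /null_coord/positive_rep.
have [->|->] /= := repr_tvec P Q; first by rewrite half_add half_sub P0.
by rewrite half_oppD half_oppB phiN oppr_gt0 ltNge ltW//= !opprK.
Qed.

Lemma tvec_null_coord w : tvec (null_coord w) = w.
Proof.
rewrite /null_coord /positive_rep; case: ifP => _; rewrite ?tvecN.
all: by rewrite -tvec_repr.
Qed.

Lemma open_null_coord (W : set (vec * vec)) : open W ->
  open [set w : pairs R n | 0 < phi (null_coord w).1 /\ W (null_coord w)].
Proof.
move=> oW; rewrite -[open _]/(open (\pi_(pairs R n) @^-1` _)).
pose s : vec * vec -> vec * vec := fun z => (z.1 + z.2, z.1 - z.2).
pose W1 := [set z : vec * vec | 0 < phi z.1] `&` W.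
have oW1 : open W1.
  apply: openI => //.
  rewrite (_ : [set z | _] = (fun z : vec * vec => phi z.1) @^-1` [set r | 0 < r])//.
  apply: open_comp; last exact: open_gt.
  move=> z _; apply: (@continuous_comp _ _ _ fst phi); first exact: continuous_fst.
  exact: phi_continuous.
have cs : continuous s.
  move=> z; apply: (@continuous_pair _ vec vec (fun z : vec * vec => z.1 + z.2)
    (fun z : vec * vec => z.1 - z.2)).
    by apply: continuousD; [exact: continuous_fst|exact: continuous_snd].
  by apply: continuousB; [exact: continuous_fst|exact: continuous_snd].
have csN : continuous (fun z => - s z).
  by move=> z; apply: continuousN; exact: cs.
rewrite (_ : _ @^-1` _ = s @^-1` W1 `|` (fun z => - s z) @^-1` W1).
  by apply: openU; apply: open_comp => // z _; exact: csN.
apply/seteqP; split => -[a b] /=.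
  rewrite /null_coord /positive_rep; have [->|->] /= := repr_pi a b.
    by case: ifPn => _ [p0 Wp]; [left|right].
  case: ifPn => _ [p0 Wp]; [right|left]; split => //=.
  - by rewrite opprD.
  - by move: Wp; rewrite /s/=; congr (W _); rewrite -[- (_, _)]/(- _, - _) !opprD.
  - by move: p0; rewrite -opprD !opprK.
  - by move: Wp; rewrite /s/=; congr (W (_, _)); rewrite -opprD opprK.
have E z : W1 z -> 0 < phi (null_coord (tvec z)).1 /\ W (null_coord (tvec z)).
  by move=> [p0 Wz]; rewrite null_coord_tvec.
have sK : tvec (s (a, b)) = \pi_(pairs R n) (a, b).
  by rewrite /tvec/s/=; congr (\pi_(pairs R n) (_, _)); apply/rowP => i;
    rewrite !mxE; field.
move=> [/E|/E]; first by rewrite sK.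
by rewrite -[- s (a, b)]/(- (a + b), - (a - b)) tvecN sK.
Qed.

End NullCoordinates.

(** * The flow and the action of [Gamma] in null coordinates *)

Section NonWandering.
Local Open Scope quotient_scope.
Context (R : realType) (n : nat) (Gamma : subgroupPO R n).
Context (Omega Lambda : set (RP R n)) (f : 'cV[R]_n.+2).
Hypothesis S : setting Gamma Omega Lambda f.
Local Notation vec := ('rV[R]_n.+2).
Local Notation mat := ('M[R]_n.+2).
Local Notation phi := (chart_form f).
Local Notation N := (nonwandering Lambda (convex_core Lambda f)).
Local Notation quo := (@orbit_of R n Gamma N).
Local Notation cone := (cone Lambda f).
Local Notation null_pairs := (null_pairs Lambda f).
Implicit Types (A B : mat) (z : vec * vec) (w : N).

(** An embedding of the non-wandering set into pairs of vectors, injective with the induced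
    topology: topological questions about [N] are settled through it. *)
Definition nc w : vec * vec := null_coord f (set_val w).

Lemma nc_null w : null_pairs (nc w).
Proof.
have [z nz E] := null_pair_exists S (set_valP w).
by rewrite /nc set_valE E null_coord_tvec//; case: nz => -[].
Qed.

Lemma tvec_nc w : tvec (nc w) = set_val w.
Proof. exact: tvec_null_coord. Qed.

Lemma nc_inj : injective nc.
Proof. by move=> w w' E; apply: val_inj; rewrite -[LHS]tvec_nc E tvec_nc. Qed.

Definition of_null z (nz : null_pairs z) : N :=
  exist (fun q => q \in N) (tvec z) (mem_set (nonwandering_null_pair S nz)).

Lemma nc_of_null z (nz : null_pairs z) : nc (of_null nz) = z.
Proof. by rewrite /nc set_valE null_coord_tvec//; case: nz => -[]. Qed.

Lemma nc_eq w z : null_pairs z -> set_val w = tvec z -> nc w = z.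
Proof. by move=> nz E; rewrite /nc E null_coord_tvec//; case: nz => -[]. Qed.

Lemma open_nc (U : set N) : open U -> exists2 W, open W & U = nc @^-1` W.
Proof.
move=> [V oV VU]; pose T z := tvec z : pairs R n.
have cT : continuous T.
  move=> z; apply: (@continuous_comp _ _ _
    (fun z : vec * vec => (2^-1 *: (z.1 + z.2), 2^-1 *: (z.1 - z.2))) (\pi_(pairs R n))).
    apply: (@continuous_pair _ vec vec (fun z : vec * vec => 2^-1 *: (z.1 + z.2))
      (fun z : vec * vec => 2^-1 *: (z.1 - z.2))).
      apply: (@continuous_comp _ _ _ (fun z : vec * vec => z.1 + z.2) ( *:%R 2^-1)).
        by apply: continuousD; [exact: continuous_fst|exact: continuous_snd].
      exact: scaler_continuous.
    apply: (@continuous_comp _ _ _ (fun z : vec * vec => z.1 - z.2) ( *:%R 2^-1)).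
      by apply: continuousB; [exact: continuous_fst|exact: continuous_snd].
    exact: scaler_continuous.
  exact: pi_continuous.
exists (T @^-1` V); first by apply: open_comp => // z _; exact: cT.
by rewrite -VU; apply/seteqP; split => w /=; rewrite /T tvec_nc.
Qed.

Lemma nc_continuous : continuous nc.
Proof.
apply/continuousP => W oW.
exists [set w | 0 < phi (null_coord f w).1 /\ W (null_coord f w)].
  exact: open_null_coord.
by apply/seteqP; split => w /=; [case|move=> Ww; split => //; case: (nc_null w) => -[]].
Qed.

Lemma continuous_nc (T : topologicalType) (g : T -> N) (x : T) :
  {for x, continuous (nc \o g)} -> {for x, continuous g}.
Proof.
move=> cg U; rewrite nbhsE => -[V [/open_nc[W oW ->] Wx] VU].
have : nbhs x ((nc \o g) @^-1` W) by apply: cg; exact: open_nbhs_nbhs.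
by apply: filterS => y Wy; exact: VU.
Qed.

Lemma compact_nc (K : set N) : compact (nc @` K) -> compact K.
Proof. exact: compact_embedding open_nc. Qed.

Lemma null_pairs_flow (t : R) z :
  null_pairs z -> null_pairs (expR t *: z.1, expR (- t) *: z.2).
Proof.
move=> [c1 c2 E]; split => /=; [exact: (coneZ (expR_gt0 _))..|].
by rewrite formZl formZr E mulrA -expRD subrr expR0 mul1r.
Qed.

Lemma nc_flow (t : R) w :
  nc (flow_on t w) = (expR t *: (nc w).1, expR (- t) *: (nc w).2).
Proof.
have nz := null_pairs_flow t (nc_null w).
apply: nc_eq => //; rewrite /flow_on.
have fE : flow t (set_val w) = tvec (expR t *: (nc w).1, expR (- t) *: (nc w).2).
  by rewrite -tvec_nc -flow_tvec; case: (nc w).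
rewrite [LHS]val_insubd fE ifT//; apply/mem_set.
exact: (nonwandering_null_pair S nz).
Qed.

Lemma flow_onD (s t : R) w : flow_on s (flow_on t w) = flow_on (s + t) w.
Proof.
by apply: nc_inj; rewrite !nc_flow/= !scalerA -!expRD opprD.
Qed.

Lemma flow_on0 w : flow_on 0 w = w.
Proof. by apply: nc_inj; rewrite nc_flow oppr0 expR0 !scale1r; case: (nc w). Qed.

Lemma flow_on_continuous (t : R) : continuous (flow_on t : N -> N).
Proof.
move=> w; apply: continuous_nc.
have -> : nc \o flow_on t =
    fun w : N => (expR t *: (nc w).1, expR (- t) *: (nc w).2).
  by apply/funext => w' /=; rewrite nc_flow.
apply: (@continuous_pair _ vec vec (fun w : N => expR t *: (nc w).1)
    (fun w : N => expR (- t) *: (nc w).2)).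
  apply: (@continuous_comp _ _ _ (fst \o nc) ( *:%R (expR t))).
    by apply: continuous_comp; [exact: nc_continuous|exact: continuous_fst].
  exact: scaler_continuous.
apply: (@continuous_comp _ _ _ (snd \o nc) ( *:%R (expR (- t)))).
  by apply: continuous_comp; [exact: nc_continuous|exact: continuous_snd].
exact: scaler_continuous.
Qed.

(* Linear lifts of the elements of [Gamma] preserving the cone over the limit
   set; each element of [Gamma] has exactly one. *)
Definition pos_lift A : Prop :=
  linear_lifts Gamma A /\ forall u, cone u -> cone (u *m A).

Lemma linear_lifts_unit A : linear_lifts Gamma A -> A \in unitmx.
Proof. by case=> iA _; exact: isometry_unit. Qed.

Lemma linear_liftsN A : linear_lifts Gamma A -> linear_lifts Gamma (- A).
Proof.
move=> lA; have uA := linear_lifts_unit lA; case: lA => iA cA; split.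
  by move=> u v; rewrite !mulmxN formNl formNr opprK iA.
suff -> : pmap (- A) = pmap A by [].
by apply/funext => p; rewrite /pmap mulmxN projN// mulmx_neq0// lift_neq0.
Qed.

Lemma linear_lifts_sign A u : linear_lifts Gamma A -> cone u ->
  cone (u *m A) \/ cone (- (u *m A)).
Proof.
move=> lA cu; have uA := linear_lifts_unit lA; have u0 := cone_neq0 cu.
have [_ Lu] := cu; have uA0 := mulmx_neq0 uA u0.
have LuA : Lambda (proj (u *m A)).
  by rewrite -pmap_proj//; apply: (limit_set_invariant (setting_qF S)) => //; case: lA.
have : phi (u *m A) != 0.
  apply/(affine_chart_proj f uA0).
  exact: (limit_set_chart (setting_qF S) (setting_chart S)).
rewrite neq_lt => /orP[pu|pu]; [right|left]; split => //.
  by rewrite phiN oppr_gt0.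
by rewrite projN.
Qed.

(** The form is negative on positive lifts of distinct limit points. If [A] kept one of two such
    lifts positive and reversed the other, it would not preserve this sign. *)
Lemma linear_lifts_pos A : linear_lifts Gamma A -> pos_lift A \/ pos_lift (- A).
Proof.
move=> lA; have lNA := linear_liftsN lA.
have [[u [cu cuA]]|nA] := pselect (exists u, cone u /\ cone (u *m A)); last first.
  right; split => // u cu; rewrite mulmxN.
  have [cuA|//] := linear_lifts_sign lA cu.
  by exfalso; apply: nA; exists u.
left; split => // v cv; have [//|cvA] := linear_lifts_sign lA cv; exfalso.
have [iA _] := lA.
have key a b : cone a -> cone b -> proj a <> proj b ->
    cone (a *m A) -> ~ cone (- (b *m A)).
  move=> ca cb ab caA cbA; have := cone_lt0 S ca cb ab.
  rewrite -iA => h; have := cone_le0 S caA cbA.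
  by rewrite formNr oppr_le0 leNgt h.
(* Lifts of the same limit point cannot be compared directly; both are compared with a lift of a
   third point [eta]. *)
have [E|uv] := pselect (proj u = proj v); last exact: (key u v).
have [eta Le eu] := limit_set_neq S (proj u).
have cs := cone_sec S Le.
have se : proj (sec f eta) = eta by exact: proj_sec1 S _ Le.
have [csA|csA] := linear_lifts_sign lA cs.
  by apply: (key _ _ cs cv _ csA cvA); rewrite se -E.
by apply: (key _ _ cu cs _ cuA csA); rewrite se => /esym.
Qed.

Lemma pos_lift_inv A : pos_lift A -> pos_lift (invmx A).
Proof.
move=> [lA cA]; have uA := linear_lifts_unit lA.
have lI : linear_lifts Gamma (invmx A).
  case: lA => iA gA; split; first exact: isometryV.
  have [h [gh AhK hAK]] := carrier_inv gA; suff -> : pmap (invmx A) = h by [].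
  apply/funext => p; rewrite -{1}[p]hAK.
  by rewrite -[LHS]/((pmap (invmx A) \o pmap A) _) -pmapM ?unitmx_inv// mulmxV// pmap1.
have [//|[_ cNI]] := linear_lifts_pos lI; exfalso.
have [eta Le _] := limit_set_neq S (proj (const_mx 1)).
have cs := cone_sec S Le.
have := cNI _ (cA _ cs); rewrite mulmxN mulmxK// => -[+ _].
rewrite phiN oppr_gt0 => /ltW; rewrite leNgt; case: cs => -> _; exact/negP.
Qed.

Lemma pos_lift_null A z : pos_lift A -> null_pairs z ->
  null_pairs (z.1 *m A, z.2 *m A).
Proof.
move=> [[iA _] cA] [c1 c2 E]; split => /=; [exact: cA..|by rewrite iA].
Qed.

Definition actN A (pA : pos_lift A) w : N := of_null (pos_lift_null pA (nc_null w)).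

Lemma nc_actN A (pA : pos_lift A) w :
  nc (actN pA w) = ((nc w).1 *m A, (nc w).2 *m A).
Proof. exact: nc_of_null. Qed.

Lemma actN_continuous A (pA : pos_lift A) : continuous (actN pA).
Proof.
move=> w; apply: continuous_nc.
have -> : nc \o actN pA = fun w : N => ((nc w).1 *m A, (nc w).2 *m A).
  by apply/funext => w' /=; rewrite nc_actN.
apply: (@continuous_pair _ vec vec (fun w : N => (nc w).1 *m A)
    (fun w : N => (nc w).2 *m A)).
  apply: (@continuous_comp _ _ _ (fst \o nc) (fun u : vec => u *m A)).
    by apply: continuous_comp; [exact: nc_continuous|exact: continuous_fst].
  exact: mulmxr_continuous.
apply: (@continuous_comp _ _ _ (snd \o nc) (fun u : vec => u *m A)).
  by apply: continuous_comp; [exact: nc_continuous|exact: continuous_snd].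
exact: mulmxr_continuous.
Qed.

Lemma same_orbitP w w' :
  quo w = quo w' <-> exists A (pA : pos_lift A), w' = actN pA w.
Proof.
split=> [/eqquotP/asboolP[A lA E]|[A [pA ->]]].
  have act_eq B (pB : pos_lift B) : act B (set_val w) = act A (set_val w) ->
      w' = actN pB w.
    move=> EB; apply: val_inj; rewrite -[LHS]/(set_val w') E -EB -tvec_nc.
    by rewrite -[RHS]/(set_val _) -tvec_nc nc_actN -act_tvec; case: (nc w).
  have [pA|pA] := linear_lifts_pos lA; first by exists A, pA; exact: act_eq.
  exists (- A), pA; apply: act_eq; rewrite -tvec_nc; case: (nc w) => P Q.
  by rewrite !act_tvec !mulmxN tvecN.
apply/eqquotP/asboolP; exists A; first by case: pA.
by rewrite -tvec_nc nc_actN -act_tvec -[in RHS]tvec_nc; case: (nc w).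
Qed.

Lemma actN_flow A (pA : pos_lift A) (t : R) w :
  actN pA (flow_on t w) = flow_on t (actN pA w).
Proof.
by apply: nc_inj; rewrite nc_actN !nc_flow nc_actN/= -!scalemxAl.
Qed.

Lemma quotient_flow_orbit (t : R) w :
  quotient_flow t (quo w) = quo (flow_on t w).
Proof.
rewrite /quotient_flow; have : quo (repr (quo w)) = quo w.
  exact: reprK.
move: (repr _) => w' /same_orbitP[A [pA ->]].
by apply/same_orbitP; exists A, pA; rewrite actN_flow.
Qed.

Lemma open_orbit_image (U : set N) : open U -> open (quo @` U).
Proof.
move=> oU; rewrite -[open _]/(open (quo @^-1` _)).
rewrite (_ : _ @^-1` _ = \bigcup_(B in [set B : {A | pos_lift A} | True])
    actN (proj2_sig B) @^-1` U); last first.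
  apply/seteqP; split => w.
    move=> [w' Uw' /esym/same_orbitP[A [pA E]]].
    by exists (exist _ A pA) => //=; rewrite -E.
  move=> [[A pA] _ /= Uw]; exists (actN pA w) => //.
  by apply/esym/same_orbitP; exists A, pA.
by apply: bigcup_open => B _; apply: open_comp => // w _; exact: actN_continuous.
Qed.

End NonWandering.

(** * Compactness and proper discontinuity *)

Lemma continuous_mul (R : realType) (T : topologicalType) (g h : T -> R) (x : T) :
  {for x, continuous g} -> {for x, continuous h} ->
  {for x, continuous (fun y => g y * h y)}.
Proof. by move=> cg ch; apply: (cvgM (FF := nbhs_filter x)). Qed.

Lemma continuous_form (R : realType) (n : nat) (T : topologicalType)
    (g h : T -> 'rV[R]_n.+2) (x : T) :
  {for x, continuous g} -> {for x, continuous h} ->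
  {for x, continuous (fun y => form (g y) (h y))}.
Proof. by move=> cg ch; apply: (cvg_form (nbhs_filter x)). Qed.

Lemma continuous_phi (R : realType) (n : nat) (f : 'cV[R]_n.+2)
    (T : topologicalType) (g : T -> 'rV[R]_n.+2) (x : T) :
  {for x, continuous g} -> {for x, continuous (fun y => chart_form f (g y))}.
Proof.
move=> cg; apply: (@continuous_comp _ _ _ g (chart_form f)) => //; exact: phi_continuous.
Qed.

Section Compactness.
Context (R : realType) (n : nat) (Gamma : subgroupPO R n).
Context (Omega Lambda : set (RP R n)) (f : 'cV[R]_n.+2).
Hypothesis S : setting Gamma Omega Lambda f.
Local Notation vec := ('rV[R]_n.+2).
Local Notation mat := ('M[R]_n.+2).
Local Notation phi := (chart_form f).
Local Notation N := (nonwandering Lambda (convex_core Lambda f)).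
Local Notation cone := (cone Lambda f).
Local Notation null_pairs := (null_pairs Lambda f).
Local Notation pos_lift := (pos_lift Gamma Lambda f).
Local Notation nc := (@nc R n Lambda f).
Implicit Types (A B : mat) (z : vec * vec) (w : N) (M : R).

(* The height is proper on the non-wandering set, and its reciprocal is the
   Lorentzian norm of the normalised lift of the foot point, up to a factor. *)
Definition height w : R := phi (nc w).1 + phi (nc w).2.

Definition sublevel M : set N := [set w | height w <= M].

Lemma height_gt0 w : 0 < height w.
Proof. by have [[p1 _] [p2 _] _] := nc_null S w; rewrite addr_gt0. Qed.

Lemma height_continuous : continuous height.
Proof.
move=> w; apply: (@continuousD _ _ _ (fun w => phi (nc w).1) (fun w => phi (nc w).2));
  apply: continuous_phi.
  by apply: (@continuous_comp _ _ _ nc fst); [exact: (nc_continuous S)|exact: continuous_fst].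
by apply: (@continuous_comp _ _ _ nc snd); [exact: (nc_continuous S)|exact: continuous_snd].
Qed.

(** A null pair is [(a *: u, b *: v)] with [u], [v] in the compact section, and a height bound keeps
    [a] and [b] in [[0, M]]. The remaining conditions are closed, and [a * b * <u | v> = -2]
    excludes the limits [a = 0] and [b = 0]. *)
Lemma sublevel_compact M : compact (sublevel M).
Proof.
apply: (compact_nc).
pose T := ((vec * vec) * (R * R))%type.
pose F (q : T) : vec * vec := (q.2.1 *: q.1.1, q.2.2 *: q.1.2).
pose Z : set T := (section_set Lambda f `*` section_set Lambda f) `*`
  (`[0, M]%classic `*` `[0, M]%classic).
pose Y : set T := (fun q : T => q.2.1 * q.2.2 * form q.1.1 q.1.2) @^-1` [set -2] `&`
  (fun q : T => q.2.1 + q.2.2) @^-1` [set r | r <= M].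
have c11 : continuous (fun q : T => q.1.1).
  by move=> q; apply: (@continuous_comp _ _ _ fst fst); exact: continuous_fst.
have c12 : continuous (fun q : T => q.1.2).
  by move=> q; apply: (@continuous_comp _ _ _ fst snd);
    [exact: continuous_fst|exact: continuous_snd].
have c21 : continuous (fun q : T => q.2.1).
  by move=> q; apply: (@continuous_comp _ _ _ snd fst);
    [exact: continuous_snd|exact: continuous_fst].
have c22 : continuous (fun q : T => q.2.2).
  by move=> q; apply: (@continuous_comp _ _ _ snd snd); exact: continuous_snd.
rewrite (_ : _ @` _ = F @` (Z `&` Y)).
  apply: continuous_compact.
    apply: continuous_subspaceT => q.
    apply: (@continuous_pair _ vec vec (fun q : T => q.2.1 *: q.1.1)
      (fun q : T => q.2.2 *: q.1.2)).
      by apply: continuousZ; [exact: c21|exact: c11].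
    by apply: continuousZ; [exact: c22|exact: c12].
  apply: compact_closedI.
    have cL := section_set_compact S.
    by apply: compact_setX; apply: compact_setX => //; exact: segment_compact.
  apply: closedI; apply: preimage_closed.
  - move=> q _; apply: (@continuous_mul _ _ (fun q : T => q.2.1 * q.2.2)
      (fun q : T => form q.1.1 q.1.2)).
      by apply: (@continuous_mul _ _ (fun q : T => q.2.1)); [exact: c21|exact: c22].
    by apply: (@continuous_form _ _ _ (fun q : T => q.1.1)); [exact: c11|exact: c12].
  - exact: closed_eq.
  - by move=> q _; apply: (@continuousD _ _ _ (fun q : T => q.2.1));
      [exact: c21|exact: c22].
  - exact: closed_le.
apply/seteqP; split => [_ [w wM <-]|z [[[u v] [a b]] [[[[/= u1 Lu] [v1 Lv]] []]]]].
  have [c1 c2 E] := nc_null S w.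
  have [p1 L1] := c1; have [p2 L2] := c2.
  exists ((sec f (proj (nc w).1), sec f (proj (nc w).2)), (phi (nc w).1, phi (nc w).2)).
    move: wM; rewrite /sublevel/=/height => wM; split; split => /=.
    - by split; split; rewrite ?(phi_sec1 S)// (proj_sec1 S).
    - by split; rewrite in_itv/= ?(ltW p1) ?(ltW p2)/=; lra.
    - by rewrite -E [in RHS](cone_secE c1) [in RHS](cone_secE c2) formZl formZr mulrA.
    - by [].
  by rewrite /F/= -(cone_secE c1) -(cone_secE c2); case: (nc w).
rewrite /= !in_itv/= => /andP[a0 _] /andP[b0 _] [/= ab abM] <-.
have a1 : 0 < a.
  by rewrite lt_neqAle a0 andbT; apply: contra_eq_neq ab => <-; rewrite !mul0r eq_sym oppr_eq0 pnatr_eq0.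
have b1 : 0 < b.
  by rewrite lt_neqAle b0 andbT; apply: contra_eq_neq ab => <-; rewrite mulr0 mul0r eq_sym oppr_eq0 pnatr_eq0.
have cu : cone u by split => //; rewrite u1.
have cv : cone v by split => //; rewrite v1.
have nz : null_pairs (a *: u, b *: v).
  by split => /=; rewrite ?formZl ?formZr ?mulrA//; exact: coneZ.
exists (of_null S nz); last by rewrite nc_of_null.
by rewrite /sublevel/= /height nc_of_null/= !phiZ u1 v1 !mulr1.
Qed.

Lemma closed_compact_nc (K : set N) : compact K -> closed K.
Proof.
move=> cK; rewrite (_ : K = nc @^-1` (nc @` K)).
  apply: preimage_closed; first by move=> w _; exact: (nc_continuous S).
  apply: compact_closed; first exact: norm_hausdorff.
  by apply: continuous_compact => //; apply: continuous_subspaceT; exact: (nc_continuous S).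
apply/seteqP; split => w /=; first by exists w.
by move=> [w' Kw' /nc_inj <-].
Qed.

Definition footN w : RP R n := proj ((nc w).1 + (nc w).2).

Lemma phi_nc_sum w : phi ((nc w).1 + (nc w).2) = height w.
Proof. by rewrite phiD. Qed.

Lemma nc_sum_neq0 w : (nc w).1 + (nc w).2 != 0.
Proof. by apply: (@phi_neq0 _ _ f); rewrite phi_nc_sum gt_eqF// height_gt0. Qed.

Lemma footN_continuous : continuous footN.
Proof.
move=> w; apply: (@continuous_comp _ _ _ (fun w => (nc w).1 + (nc w).2) (@proj R n)).
  apply: continuousD.
    by apply: (@continuous_comp _ _ _ nc fst); [exact: (nc_continuous S)|exact: continuous_fst].
  by apply: (@continuous_comp _ _ _ nc snd); [exact: (nc_continuous S)|exact: continuous_snd].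
by apply: proj_continuous; exact: nc_sum_neq0.
Qed.

Lemma form_nc_sum w : form ((nc w).1 + (nc w).2) ((nc w).1 + (nc w).2) = -4.
Proof.
have [c1 c2 E] := nc_null S w.
rewrite formDl !formDr (cone_null S c1) (cone_null S c2) [form (nc w).2 _]formC E; lra.
Qed.

(** The foot is a negative vector on the segment joining two limit points, and [Omega] contains the
    part of its closure lying in [AdS]. Cocompactness and proper discontinuity pass from [Omega] to
    [N] through this map. *)
Lemma footN_Omega w : Omega (footN w).
Proof.
have qF := setting_qF S; have [c1 c2 E] := nc_null S w.
have := qF => -[_ [[_ OA] _ _ _ _] _ _]; apply: OA; split; last first.
  by apply/AdS_proj; rewrite ?nc_sum_neq0// form_nc_sum oppr_lt0.
have [p1 L1] := c1; have [p2 L2] := c2.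
pose t := phi (nc w).2 / height w.
have h0 := height_gt0 w.
have t01 : 0 <= t <= 1.
  apply/andP; split; first by apply: divr_ge0; exact: ltW.
  by rewrite /t ler_pdivrMr// mul1r /height lerDr ltW.
have := closure_domain_convex qF (setting_chart S)
  (phi_sec1 S L1) (phi_sec1 S L2) _ _ t01.
rewrite !(proj_sec1 S)// => /(_ (limit_set_closure qF L1) (limit_set_closure qF L2)).
have -> : (1 - t) *: sec f (proj (nc w).1) + t *: sec f (proj (nc w).2) =
    (height w)^-1 *: ((nc w).1 + (nc w).2).
  rewrite [in RHS](cone_secE c1) [in RHS](cone_secE c2) scalerDr !scalerA.
  congr (_ *: _ + _ *: _); last by rewrite mulrC.
  by rewrite /t /height; field; rewrite gt_eqF.
by rewrite projZ ?nc_sum_neq0// invr_eq0 gt_eqF.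
Qed.

Lemma footN_actN A (pA : pos_lift A) w : footN (actN S pA w) = pmap A (footN w).
Proof.
rewrite /footN nc_actN/= pmap_proj ?nc_sum_neq0 ?mulmxDl//.
by apply: (linear_lifts_unit (proj1 pA)).
Qed.

(** An element of [Gamma] brings the foot into the compact set [K], on which the square of the
    normalised lift is bounded away from 0; this square is [- 4 / height ^ 2]. *)
Lemma cocompact_sublevel : exists M, forall w, exists A (pA : pos_lift A),
  sublevel M (actN S pA w).
Proof.
have qF := setting_qF S.
have := qF => -[_ [[OA _] _ _ _ [_ _ [K [cK KO OK]]]] _ _].
have Kf p : K p -> affine_chart f p.
  by move=> /KO/subset_closure; exact: (setting_chart S).
pose h p := form (sec f p) (sec f p).
have ch : {within K, continuous h}.
  apply: continuous_in_subspaceT => p; rewrite inE => /Kf Kp.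
  by apply: continuous_form; exact: sec_continuous.
have [K0|nK] := pselect (K !=set0); last first.
  exists 0 => w; exfalso; have [g _ [k Kk _]] := OK _ (footN_Omega w).
  by apply: nK; exists k.
have [c cK' cmax] := compact_EVT_max K0 cK ch.
have hc : h c < 0.
  rewrite inE in cK'; apply/(AdS_proj (sec_neq0 (Kf _ cK'))).
  by rewrite (proj_sec (Kf _ cK')); exact/OA/KO.
(* From [height ^ 2 <= q] with [q = 4 / (- h c)] and [(height - 1) ^ 2 >= 0] one gets
   [height <= 1 + q] without square roots. *)
exists (1 + 4 / (- h c)) => w.
have [g cg [k Kk gk]] := OK _ (footN_Omega w).
have [g' [cg' gK g'K]] := carrier_inv cg.
have [A lA g'E] := carrier_lift cg'.
have [B [pB BE]] : exists B, exists pB : pos_lift B, footN (actN S pB w) = k.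
  have E C (pC : pos_lift C) : pmap C = g' -> footN (actN S pC w) = k.
    by move=> CE; rewrite footN_actN CE -gk gK.
  have [pA|pA] := linear_lifts_pos S lA; first by exists A, pA; exact: E.
  exists (- A), pA; apply: E; rewrite g'E; apply/funext => p.
  by rewrite /pmap mulmxN projN// mulmx_neq0 ?lift_neq0// (linear_lifts_unit lA).
exists B, pB; rewrite /sublevel/=; set w' := actN _ _ _.
have h0 := height_gt0 w'.
have : h k <= h c by apply: cmax; rewrite inE.
have -> : h k = - (4 / height w' ^+ 2).
  rewrite /h -BE -/w' /footN sec_proj ?phi_nc_sum ?gt_eqF//.
  rewrite formZl formZr form_nc_sum; field; rewrite gt_eqF//.
rewrite lerNl => hh.
have h2 : 0 < height w' ^+ 2 by rewrite exprn_gt0.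
have : height w' ^+ 2 <= 4 / - h c.
  by rewrite ler_pdivlMr ?oppr_gt0// mulrC -ler_pdivlMr.
have : 0 <= (height w' - 1) ^+ 2 := sqr_ge0 _.
rewrite sqrrB1; move: (4 / _) (height w') h0 => q r; nra.
Qed.

Definition return_set M : set (RP R n -> RP R n) :=
  [set g | exists A (pA : pos_lift A), g = pmap A /\
    exists w, sublevel M w /\ sublevel M (actN S pA w)].

Lemma return_set_finite M : finite_set (return_set M).
Proof.
have := setting_qF S => -[_ [_ _ _ _ [_ pd _]] _ _].
have cK : compact (footN @` sublevel M).
  apply: continuous_compact; last exact: sublevel_compact.
  by apply: continuous_subspaceT; exact: footN_continuous.
have KO : footN @` sublevel M `<=` Omega by move=> _ [w _ <-]; exact: footN_Omega.
apply: sub_finite_set (pd _ cK KO) => g [A [pA [-> [w [w1 w2]]]]].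
split; first by have [[]] := pA.
exists (footN (actN S pA w)); split; last by exists (actN S pA w).
by exists (footN w); [exists w|rewrite footN_actN].
Qed.

(** By proper discontinuity the stabiliser of a point of [Omega] is finite, so two iterates
    coincide, and torsion-freeness concludes. *)
Lemma pmap_footN_free A (pA : pos_lift A) w : pmap A (footN w) = footN w ->
  pmap A = id.
Proof.
move=> Aw; have [[_ cg] _] := pA.
have := setting_qF S => -[_ [_ _ _ _ [_ pd _]] _ _].
have K1 : [set footN w] `<=` Omega by move=> _ ->; exact: footN_Omega.
have fin := pd _ (@compact_set1 _ (footN w)) K1.
have it k : carrier Gamma (iter k (pmap A)) /\ iter k (pmap A) (footN w) = footN w.
  elim: k => [|k [ck Ek]]; first by split => //; exact: carrier_id.
  split; last by rewrite iterS Ek.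
  have -> : iter k.+1 (pmap A) = pmap A \o iter k (pmap A) by apply/funext.
  exact: carrier_comp.
have [g [gc gK Kg]] := carrier_inv cg.
have iK k x : iter k g (iter k (pmap A) x) = x.
  elim: k x => // k IH x; rewrite iterSr iterS gK; exact: IH.
have [i [j [ij Eij]]] : exists i j, (i < j)%N /\ iter i (pmap A) = iter j (pmap A).
  apply: contrapT => nij; apply: infinite_nat.
  have inj : {in setT &, injective (fun k => iter k (pmap A))}.
    move=> i j _ _ E; have [ij|ji|//] := ltngtP i j; exfalso; apply: nij.
      by exists i, j.
    by exists j, i.
  rewrite -(eq_finite_set (inj_card_eq inj)); apply: sub_finite_set fin.
  move=> _ [k _ <-]; have [ck Ek] := it k; split => //.
  by exists (footN w); split => //; exists (footN w).
apply: (setting_tf S cg (_ : 0 < j - i)%N); first by rewrite subn_gt0.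
apply/funext => x; rewrite -[LHS](iK i) -iterD subnKC ?(ltnW ij)// -Eij.
exact: iK.
Qed.

(** Acting trivially on lines, [A] multiplies [P], [Q] and [P + Q] by scalars, which must agree;
    invariance of [<P | Q>] gives the square 1 and positivity excludes -1. *)
Lemma actN_id A (pA : pos_lift A) w : pmap A = id -> actN S pA w = w.
Proof.
move=> A1; apply: nc_inj; rewrite nc_actN.
have uA := linear_lifts_unit (proj1 pA).
have [c1 c2 E] := nc_null S w; have [[iA _] cA] := pA.
case: (nc w) c1 c2 E (nc_sum_neq0 w) => P Q /= cP cQ PQ PQ0.
have key (u : vec) : u != 0 -> exists c, u *m A = c *: u.
  move=> u0; have : proj u = proj (u *m A) by rewrite -pmap_proj// A1.
  by move/proj_eq => /(_ u0 (mulmx_neq0 uA u0))[c [_ ->]]; exists c.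
have [a aE] := key _ (cone_neq0 cP); have [b bE] := key _ (cone_neq0 cQ).
have [c] := key _ PQ0; rewrite mulmxDl aE bE scalerDr => cE.
have ac : a = c.
  have := congr1 (form Q) cE; rewrite !formDr !formZr (cone_null S cQ) [form Q P]formC PQ; lra.
have bc : b = c.
  have := congr1 (form P) cE; rewrite !formDr !formZr (cone_null S cP) PQ; lra.
have a0 : 0 < a.
  have [+ _] := cA _ cP; rewrite aE phiZ; case: cP => p0 _.
  by rewrite pmulr_lgt0.
have : a * b = 1.
  have := iA P Q; rewrite aE bE formZl formZr PQ; lra.
rewrite ac -bc => bb; have b1 : b = 1.
  by move: a0; rewrite ac -bc => b0; nra.
by rewrite b1 !scale1r.
Qed.

End Compactness.

(** * Contraction along the flow *)

Lemma compact_open_margin (R : realType) (V : normedModType R) (K W : set V) :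
  compact K -> open W -> K `<=` W ->
  exists2 e : R, 0 < e & forall x y, K x -> `|x - y| < e -> W y.
Proof.
move=> cK oW KW.
pose P (e : R) (x : V) : Prop := forall y, `|x - y| < e -> W y.
have near_cov : \forall e \near (0 : R)^'+, K `<=` P e.
  apply: ((compact_near_coveringP K).1 cK R (0 : R)^'+ P) => x Kx.
  have : nbhs x W by apply: open_nbhs_nbhs; split => //; exact: KW.
  move=> /nbhs_ballP[r /= r0 rW].
  have r20 : 0 < r / 2 by rewrite divr_gt0.
  exists (ball x (r / 2), [set e | e < r / 2]); first split => /=.
  - exact: nbhsx_ballx.
  - exact: nbhs_right_lt.
  - move=> [x' e] /= [xx' er] y xy; apply: rW; rewrite -ball_normE/=.
    move: xx'; rewrite -ball_normE/= => xx'.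
    rewrite (splitr r); apply: le_lt_trans (ler_distD x' _ _) _.
    by rewrite ltrD// (lt_trans xy).
have : \forall e \near (0 : R)^'+, 0 < e by exact: nbhs_right_gt.
move=> pos; have /filter_ex[e [e0 Ke]] : \forall e \near (0 : R)^'+, 0 < e /\ K `<=` P e.
  by apply: filterS2 pos near_cov => e.
by exists e => // x y Kx; exact: Ke.
Qed.

Section Contraction.
Context (R : realType) (n : nat) (Gamma : subgroupPO R n).
Context (Omega Lambda : set (RP R n)) (f : 'cV[R]_n.+2).
Hypothesis S : setting Gamma Omega Lambda f.
Local Notation vec := ('rV[R]_n.+2).
Local Notation phi := (chart_form f).
Local Notation cone := (cone Lambda f).
Local Notation null_pairs := (null_pairs Lambda f).

(* Rescaling [Q'] to [phi = 1] makes the set of triples [(P, Q, Q')] compact. *)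
Lemma horosphere_close (M e : R) : 0 < e -> exists2 d : R, 0 < d &
  forall P Q Q', null_pairs (P, Q) -> null_pairs (P, Q') ->
    phi P + phi Q <= M -> - form Q Q' < d -> `|Q - Q'| < e.
Proof.
move=> e0.
pose T := ((vec * vec) * vec)%type.
pose NM : set (vec * vec) := @nc R n Lambda f @` sublevel M.
have cNM : compact NM.
  apply: continuous_compact; last exact: (sublevel_compact S).
  by apply: continuous_subspaceT; exact: (nc_continuous S).
pose Y : set T := NM `*` section_set Lambda f.
have cY : compact Y by apply: compact_setX => //; exact: (section_set_compact S).
pose g1 (q : T) : R := form q.1.1 q.2.
pose g2 (q : T) : R := - form q.1.2 q.2.
have c11 : continuous (fun q : T => q.1.1).
  by move=> q; apply: (@continuous_comp _ _ _ fst fst); exact: continuous_fst.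
have c12 : continuous (fun q : T => q.1.2).
  by move=> q; apply: (@continuous_comp _ _ _ fst snd);
    [exact: continuous_fst|exact: continuous_snd].
have c2 : continuous (fun q : T => q.2) by move=> q; exact: continuous_snd.
have cg1 : continuous g1.
  by move=> q; apply: (@continuous_form _ _ _ (fun q : T => q.1.1));
    [exact: c11|exact: c2].
have cg2 : continuous g2.
  move=> q; apply: (@continuousN _ _ _ (fun q : T => form q.1.2 q.2)).
  by apply: (@continuous_form _ _ _ (fun q : T => q.1.2)); [exact: c12|exact: c2].
(* For [Q' = phi Q' *: x] the normalisation reads [phi Q' * g1 = -2], whence
   [g1 *: (Q - Q') = g1 *: Q + 2 *: x]; thus [0 <= h] says [|Q - Q'| >= e] without any division. *)
pose h (q : T) : R := `|g1 q *: q.1.2 + 2 *: q.2| - e * `|g1 q|.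
have ch : continuous h.
  move=> q; apply: (@continuousB _ _ _ (fun q : T => `|g1 q *: q.1.2 + 2 *: q.2|)
    (fun q : T => e * `|g1 q|)).
    apply: (@continuous_comp _ _ _ (fun q : T => g1 q *: q.1.2 + 2 *: q.2) Num.norm);
      last exact: norm_continuous.
    apply: (@continuousD _ _ _ (fun q : T => g1 q *: q.1.2) (fun q : T => 2 *: q.2)).
      by apply: continuousZ; [exact: cg1|exact: c12].
    apply: (@continuous_comp _ _ _ (fun q : T => q.2) ( *:%R 2)); first exact: c2.
    exact: scaler_continuous.
  apply: (@continuous_comp _ _ _ (fun q : T => `|g1 q|) ( *%R e)).
    apply: (@continuous_comp _ _ _ g1 Num.norm); first exact: cg1.
    exact: norm_continuous.
  exact: mulrl_continuous.
pose Bad : set T := Y `&` [set q | 0 <= h q].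
have cBad : compact Bad.
  apply: compact_closedI => //.
  apply: (@preimage_closed _ _ h [set r | 0 <= r]); last exact: closed_ge.
  by move=> q _; exact: ch.
have coneY q : Y q -> [/\ cone q.1.1, cone q.1.2, form q.1.1 q.1.2 = -2 & cone q.2].
  move=> [[w _ <-] [u1 Lu]]; have [? ? ?] := nc_null S w.
  by split => //; split => //; rewrite u1.
(* [g2] can vanish only if [x] is collinear to [Q]; the normalisation then makes the first term of
   [h] zero, so [h < 0]. *)
have g2pos q : Bad q -> 0 < g2 q.
  move=> [/coneY[cP cQ PQ cx] hq]; rewrite /g2 oppr_gt0.
  have [E|] := pselect (proj q.1.2 = proj q.2); last exact: (cone_lt0 S).
  exfalso; move: hq; rewrite /h/=/g1.
  have xE : q.2 = (phi q.2 / phi q.1.2) *: q.1.2.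
    rewrite [RHS](_ : _ = phi q.2 *: sec f (proj q.1.2)).
      by rewrite E -(cone_secE cx).
    by rewrite [X in _ *: X = _](cone_secE cQ) scalerA divfK// gt_eqF//; case: cQ.
  rewrite xE formZr PQ; set r := _ / _.
  have r0 : 0 < r by rewrite divr_gt0//; [case: cx|case: cQ].
  rewrite scalerA -scalerDl (_ : r * -2 + 2 * r = 0); last by ring.
  rewrite scale0r normr0 normrM normrN (gtr0_norm r0) normr_nat; nra.
have [d0 d00 d0P] : exists2 d0 : R, 0 < d0 & forall q, Bad q -> d0 <= g2 q.
  have [B0|nB] := pselect (Bad !=set0); last first.
    by exists 1 => // q Bq; exfalso; apply: nB; exists q.
  have [c cB cmin] := compact_EVT_min B0 cBad (continuous_subspaceT cg2).
  rewrite inE in cB; exists (g2 c); first exact: g2pos.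
  by move=> q Bq; apply: cmin; rewrite inE.
have [C C0 CP] : exists2 C : R, 0 < C & forall q, Y q -> - g1 q <= C.
  have [Y0|nY] := pselect (Y !=set0); last first.
    by exists 1 => // q Yq; exfalso; apply: nY; exists q.
  have cNg : continuous (fun q => - g1 q) by move=> q; apply: continuousN; exact: cg1.
  have [c cY' cmax] := compact_EVT_max Y0 cY (continuous_subspaceT cNg).
  exists (`|g1 c| + 1); first by rewrite ltr_wpDl.
  move=> q Yq; have := cmax q; rewrite inE => /(_ Yq) /le_trans; apply.
  by apply: (le_trans (ler_norm _)); rewrite normrN lerDl.
(* [- <Q | Q'>] equals [phi Q' * g2], where [phi Q' = 2 / (- g1) >= 2 / C], and [g2 >= d0] on bad
   triples. *)
exists (2 * d0 / C); first by rewrite divr_gt0// mulr_gt0.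
move=> P Q Q' n1 n2 PQM QQ'.
have [/= cP cQ PQ] := n1; have [_ /= cQ' PQ'] := n2.
have [q0 Lq'] := cQ'.
pose x := sec f (proj Q'); have Q'E : Q' = phi Q' *: x := cone_secE cQ'.
pose q : T := ((P, Q), x).
have Yq : Y q.
  split => /=.
    exists (of_null S n1); last by rewrite nc_of_null.
    by rewrite /sublevel/=/height nc_of_null.
  by split; rewrite ?(phi_sec1 S)// (proj_sec1 S).
have g1E : phi Q' * g1 q = -2 by rewrite /g1/= -formZr -Q'E.
have g1lt : g1 q < 0.
  by move: g1E; move: (g1 q) => r E; nra.
have nBad : ~ Bad q.
  move=> /d0P; apply/negP; rewrite -ltNge.
  have CQ := CP _ Yq.
  have qE : phi Q' * g2 q = - form Q Q' by rewrite /g2/= mulrN -formZr -Q'E.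
  have k1 : 2 <= phi Q' * C.
    by have : phi Q' * (- g1 q) <= phi Q' * C; [rewrite ler_pM2l|rewrite mulrN g1E opprK].
  have k2 : phi Q' * g2 q * C < 2 * d0 by rewrite qE -ltr_pdivlMr.
  rewrite ltNge; apply/negP => dg.
  have g20 : 0 <= g2 q by apply: le_trans dg; exact: ltW.
  have : 2 * g2 q <= phi Q' * C * g2 q by rewrite ler_wpM2r.
  by nra.
have hq : h q < 0 by rewrite ltNge; apply/negP => hq; apply: nBad.
have hE : g1 q *: (Q - Q') = g1 q *: Q + 2 *: x.
  by rewrite scalerBr {1}Q'E scalerA mulrC g1E scaleNr opprK.
move: hq; rewrite /h -hE normrZ subr_lt0 [e * _]mulrC ltr_pM2l//.
by rewrite normr_gt0 lt_eqF.
Qed.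

End Contraction.

(** * Separation of asymptotic geodesics in the orbit space *)

Section OrbitSpace.
Context (R : realType) (n : nat) (Gamma : subgroupPO R n).
Context (Omega Lambda : set (RP R n)) (f : 'cV[R]_n.+2).
Hypothesis S : setting Gamma Omega Lambda f.
Local Notation vec := ('rV[R]_n.+2).
Local Notation mat := ('M[R]_n.+2).
Local Notation phi := (chart_form f).
Local Notation N := (nonwandering Lambda (convex_core Lambda f)).
Local Notation quo := (@orbit_of R n Gamma N).
Local Notation null_pairs := (null_pairs Lambda f).
Local Notation pos_lift := (pos_lift Gamma Lambda f).
Local Notation nc := (@nc R n Lambda f).
Local Notation height := (@height R n Lambda f).
Local Notation sublevel := (@sublevel R n Lambda f).
Implicit Types (A B : mat) (z : vec * vec) (w : N) (M t : R) (b : bool).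

(* [b] is the direction of time, whose reversal exchanges the null coordinates. *)
Definition swap_if b (T : Type) (z : T * T) : T * T := if b then z else (z.2, z.1).

Definition dflow b t w : N := flow_on (if b then t else - t) w.

Lemma dflow_continuous b t : continuous (dflow b t).
Proof. exact: (flow_on_continuous S). Qed.

Lemma swap_null b z : null_pairs z -> null_pairs (swap_if b z).
Proof. by case: b z => -[P Q] //= [c1 c2 E]; split => //=; rewrite formC. Qed.

Lemma swap_nc_dflow b t w : swap_if b (nc (dflow b t w)) =
  (expR t *: (swap_if b (nc w)).1, expR (- t) *: (swap_if b (nc w)).2).
Proof. by rewrite /dflow (nc_flow S); case: b => //=; rewrite opprK. Qed.

Lemma swap_nc_actN b A (pA : pos_lift A) w : swap_if b (nc (actN S pA w)) =
  ((swap_if b (nc w)).1 *m A, (swap_if b (nc w)).2 *m A).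
Proof. by rewrite nc_actN; case: b. Qed.

Lemma swap_height b w : height w = phi (swap_if b (nc w)).1 + phi (swap_if b (nc w)).2.
Proof. by case: b => //=; rewrite addrC. Qed.

Lemma swap_norm b z z' : (swap_if b z).1 = (swap_if b z').1 ->
  `|z - z'| = `|(swap_if b z).2 - (swap_if b z').2|.
Proof.
case: b z z' => -[P Q] [P' Q'] /= ->; rewrite prod_normE/= subrr normr0.
  by rewrite max_r.
by rewrite max_l.
Qed.

Lemma quo_actN A (pA : pos_lift A) w : quo (actN S pA w) = quo w.
Proof. by apply/esym/(same_orbitP S); exists A, pA. Qed.

Lemma closed_quo (C : set (orbit_space Gamma N)) :
  closed C <-> closed (quo @^-1` C).
Proof.
by split => /closed_openC cC; rewrite -openC; exact: cC.
Qed.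

(** The part of [C1] visible in a sublevel set is compact and lies in the open complement of [C2],
    hence with a uniform margin [e]; from some time on, the two vectors are closer than [e] after a
    return to that sublevel set. *)
Lemma stable_separation b (C1 C2 : set (orbit_space Gamma N)) w w' :
  closed C1 -> closed C2 -> C1 `&` C2 = set0 ->
  (swap_if b (nc w)).1 = (swap_if b (nc w')).1 ->
  exists T : R, forall t, T <= t ->
    ~ (C1 (quo (dflow b t w)) /\ C2 (quo (dflow b t w'))).
Proof.
move=> cC1 cC2 C12 wE; have [M coc] := cocompact_sublevel S.
have oU : open (~` (quo @^-1` C2)) by apply: closed_openC; exact/closed_quo.
have [W oW WE] := open_nc oU.
pose K := nc @` (sublevel M `&` quo @^-1` C1).
have cK : compact K.
  apply: continuous_compact; first by apply: continuous_subspaceT; exact: (nc_continuous S).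
  by apply: compact_closedI; [exact: (sublevel_compact S)|exact/closed_quo].
have KW : K `<=` W.
  move=> _ [y [_ y1] <-]; rewrite -[W (nc y)]/((nc @^-1` W) y) -WE => y2.
  have : (C1 `&` C2) (quo y) by [].
  by rewrite C12.
have [e e0 eP] := compact_open_margin cK oW KW.
have [d d0 dP] := horosphere_close S M e0.
set P := (swap_if b (nc w)).1 in wE; pose Q := (swap_if b (nc w)).2.
pose Q' := (swap_if b (nc w')).2.
(* The product after time [t] is [e^-2t * <Q | Q'>]; the bound [1 + 2t <= e^2t] makes this threshold
   sufficient. *)
exists (- form Q Q' / d) => t tT [h1 h2].
(* [A] is chosen for the first vector only; applied to both, it keeps their common coordinate common
   and preserves [<Q | Q'>]. *)
have [A [pA AM]] := coc (dflow b t w).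
set y := actN S pA (dflow b t w) in AM; set y' := actN S pA (dflow b t w').
have yE : swap_if b (nc y) = (expR t *: P *m A, expR (- t) *: Q *m A).
  by rewrite swap_nc_actN swap_nc_dflow.
have y'E : swap_if b (nc y') = (expR t *: P *m A, expR (- t) *: Q' *m A).
  by rewrite swap_nc_actN swap_nc_dflow -wE.
have qy : quo y = quo (dflow b t w) by exact: quo_actN.
have qy' : quo y' = quo (dflow b t w') by exact: quo_actN.
clearbody y y'.
have n1 := swap_null b (nc_null S y); rewrite yE in n1.
have n2 := swap_null b (nc_null S y'); rewrite y'E in n2.
have yM : phi (expR t *: P *m A) + phi (expR (- t) *: Q *m A) <= M.
  by move: AM; rewrite /sublevel/= (swap_height b) yE.
have qd : - form (expR (- t) *: Q *m A) (expR (- t) *: Q' *m A) < d.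
  have [[iA _] _] := pA; rewrite iA formZl formZr mulrA -expRD.
  have q0 : 0 <= - form Q Q'.
    rewrite oppr_ge0; apply: (cone_le0 S).
      by have [] := swap_null b (nc_null S w).
    by have [] := swap_null b (nc_null S w').
  have t0 : 0 <= t by apply: le_trans tT; rewrite divr_ge0// ltW.
  have e1 : 1 + (t + t) <= expR (t + t) by exact: expR_ge1Dx.
  rewrite -opprD expRN -mulrN mulrC ltr_pdivrMr ?expR_gt0//.
  move: tT; rewrite ler_pdivrMr// => tT.
  have : d * (1 + (t + t)) <= d * expR (t + t) by rewrite ler_pM2l.
  nra.
have QQ := dP _ _ _ n1 n2 yM qd.
have : W (nc y').
  apply: (eP (nc y)); first by exists y => //; split => //=; rewrite qy.
  by rewrite (swap_norm (b := b)) yE y'E.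
rewrite -[W (nc y')]/((nc @^-1` W) y') -WE; apply.
by rewrite /= qy'.
Qed.

End OrbitSpace.

Lemma closed_finite_bigcup (T : topologicalType) (I : Type) (A : set I)
    (F : I -> set T) :
  finite_set A -> (forall i, A i -> closed (F i)) -> closed (\bigcup_(i in A) F i).
Proof. exact: (@closed_bigcup T {classic I}). Qed.

(** * Local injectivity of the projection, closed saturations and open sets of the quotient *)

Section Covering.
Context (R : realType) (n : nat) (Gamma : subgroupPO R n).
Context (Omega Lambda : set (RP R n)) (f : 'cV[R]_n.+2).
Hypothesis S : setting Gamma Omega Lambda f.
Local Notation vec := ('rV[R]_n.+2).
Local Notation mat := ('M[R]_n.+2).
Local Notation N := (nonwandering Lambda (convex_core Lambda f)).
Local Notation quo := (@orbit_of R n Gamma N).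
Local Notation pos_lift := (pos_lift Gamma Lambda f).
Local Notation nc := (@nc R n Lambda f).
Local Notation height := (@height R n Lambda f).
Local Notation sublevel := (@sublevel R n Lambda f).
Local Notation footN := (@footN R n Lambda f).
Implicit Types (A B : mat) (w y : N) (M : R).

Lemma footN_chart w : affine_chart f (footN w).
Proof. by apply: (setting_chart S); apply: subset_closure; exact: footN_Omega S w. Qed.

Lemma pos_lift_mul A B : pos_lift A -> pos_lift B -> pos_lift (A *m B).
Proof.
move=> [lA cA] [lB cB]; have uA := linear_lifts_unit lA.
have uB := linear_lifts_unit lB; case: lA lB => iA gA [iB gB]; split.
  by split; [exact: isometryM|rewrite pmapM//; exact: carrier_comp].
by move=> u cu; rewrite mulmxA; exact/cB/cA.
Qed.

Lemma pos_lift_uniq A B (pA : pos_lift A) (pB : pos_lift B) w :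
  pmap A = pmap B -> actN S pA w = actN S pB w.
Proof.
move=> AB; have uA := linear_lifts_unit (proj1 pA).
have uB := linear_lifts_unit (proj1 pB).
have pC := pos_lift_mul (pos_lift_inv S pA) pB.
have C1 : pmap (invmx A *m B) = id.
  by rewrite pmapM ?unitmx_inv// -AB -pmapM ?unitmx_inv// mulVmx// pmap1.
rewrite -[LHS](actN_id S pC _ C1); apply: nc_inj; rewrite !nc_actN/=.
by rewrite !mulmxA !mulmxK.
Qed.

Lemma open_height_lt M : open [set w : N | height w < M].
Proof.
rewrite (_ : [set w | _] = height @^-1` [set r | r < M])//.
apply: open_comp; last exact: open_lt.
by move=> w _; exact: (height_continuous S).
Qed.

(** Only the finitely many elements of a return set can identify two vectors of height below
    [height w + 1]. Each nontrivial one moves the foot of [w], the action being free, hence also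
    separates it from the feet of nearby vectors. *)
Lemma injective_nbhd w : exists U : set N,
  [/\ open U, U w, set_inj U quo & U `<=` sublevel (height w + 1)].
Proof.
pose M := height w + 1; pose G := return_set S M.
have /choice[V VP] : forall g : RP R n -> RP R n, exists V : set N,
    [/\ open V, V w & G g -> g <> id ->
      forall y y', V y -> V y' -> footN y' <> g (footN y)].
  move=> g; have [[Gg gid]|nG] := pselect (G g /\ g <> id); last first.
    by exists setT; split; [exact: openT|by []|move=> Gg gid; case: nG].
  have [A [pA [gA _]]] := Gg; have [lA _] := pA.
  have gf y : g (footN y) = footN (actN S pA y) by rewrite footN_actN gA.
  pose p1 := sec f (footN w); pose p2 := sec f (g (footN w)).
  have p12 : 0 < `|p1 - p2|.
    rewrite normr_gt0 subr_eq0; apply/eqP => p12; apply: gid.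
    rewrite gA; apply: (@pmap_footN_free _ _ _ _ _ _ S A pA w); rewrite -gA.
    rewrite -[RHS](proj_sec (footN_chart w)) -/p1 p12 /p2 gf proj_sec//.
    exact: footN_chart.
  pose e := `|p1 - p2| / 2; have e0 : 0 < e by rewrite divr_gt0.
  have c1 : {for w, continuous (fun y => sec f (footN y))}.
    apply: (@continuous_comp _ _ _ footN (sec f)); first exact: (footN_continuous S).
    by apply: sec_continuous; exact: footN_chart.
  have c2 : {for w, continuous (fun y => sec f (g (footN y)))}.
    apply: (@continuous_comp _ _ _ (fun y => g (footN y)) (sec f)).
      rewrite (_ : (fun y => _) = footN \o actN S pA); last first.
        by apply/funext => y /=; exact: gf.
      by apply: continuous_comp; [exact: actN_continuous|exact: (footN_continuous S)].
    by rewrite gf; apply: sec_continuous; exact: footN_chart.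
  have n1 : nbhs w [set y | `|p1 - sec f (footN y)| < e].
    by have := c1 (ball p1 e) (nbhsx_ballx _ _ e0); rewrite -ball_normE.
  have n2 : nbhs w [set y | `|p2 - sec f (g (footN y))| < e].
    by have := c2 (ball p2 e) (nbhsx_ballx _ _ e0); rewrite -ball_normE.
  have : nbhs w ([set y | `|p1 - sec f (footN y)| < e] `&`
      [set y | `|p2 - sec f (g (footN y))| < e]) by exact: filterI.
  rewrite nbhsE => -[V [oV Vw] VP].
  exists V; split => // _ _ y y' /VP[/= _ y1] /VP[/= y2 _] E.
  have : `|p1 - p2| < e + e.
    apply: (le_lt_trans (ler_distD (sec f (footN y')) p1 p2)).
    by apply: ltrD; [exact: y2|rewrite E distrC; exact: y1].
  by rewrite /e -splitr ltxx.
have fG : finite_set G by exact: return_set_finite.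
pose D := \bigcup_(g in G `&` [set g | g <> id]) ~` V g.
have cD : closed D.
  apply: closed_finite_bigcup; first exact: finite_setIl.
  by move=> g _; apply: open_closedC; have [] := VP g.
exists (~` D `&` [set y | height y < M]); split.
- by apply: openI; [exact: closed_openC|exact: open_height_lt].
- split; last by rewrite /= /M ltrDl.
  by move=> [g _ nVw]; apply: nVw; have [] := VP g.
- move=> y y'; rewrite !inE => -[nDy yM] [nDy' y'M] /(same_orbitP S)[A [pA y'E]].
  rewrite y'E; have [A1|gid] := pselect (pmap A = id).
    by rewrite (actN_id S pA y A1).
  have Gg : G (pmap A).
    by exists A, pA; split => //; exists y; rewrite /sublevel/= -y'E; split; exact: ltW.
  have DV y0 : ~ D y0 -> V (pmap A) y0.
    by move=> nD; apply: contrapT => nV; apply: nD; exists (pmap A).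
  have [_ _ /(_ Gg gid y y' (DV _ nDy) (DV _ nDy'))] := VP (pmap A).
  by rewrite y'E footN_actN.
- by move=> y [_ /ltW].
Qed.

(** Near [y], heights are bounded, so only finitely many translates of [K] come close, and each is
    compact. The translates are indexed by transformations rather than matrices, which is why
    [pos_lift_uniq] intervenes. *)
Lemma saturation_closed (K : set N) M : compact K -> K `<=` sublevel M ->
  closed (quo @` K).
Proof.
move=> cK KM; apply/closed_quo; rewrite -openC openE => y nKy.
pose M' := Num.max M (height y + 1); pose G := return_set S M'.
pose F g : set N := [set z | exists A (pA : pos_lift A), pmap A = g /\
  exists2 k, K k & z = actN S pA k].
have cF g : G g -> closed (F g).
  move=> [A [pA [gA _]]]; rewrite (_ : F g = actN S pA @` K).
    apply: (closed_compact_nc S); apply: continuous_compact => //.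
    by apply: continuous_subspaceT; exact: actN_continuous.
  apply/seteqP; split => z.
    move=> [B [pB [Bg [k Kk ->]]]]; exists k => //.
    by apply: pos_lift_uniq; rewrite -gA.
  by move=> [k Kk <-]; exists A, pA; split => //; exists k.
pose D := \bigcup_(g in G) F g.
have cD : closed D by apply: closed_finite_bigcup => //; exact: return_set_finite.
have oU : open (~` D `&` [set z : N | height z < height y + 1]).
  by apply: openI; [exact: closed_openC|exact: open_height_lt].
have : nbhs y (~` D `&` [set z : N | height z < height y + 1]).
  apply: open_nbhs_nbhs; split => //; split; last by rewrite /= ltrDl.
  move=> [g _ [A [pA [_ [k Kk yE]]]]]; apply: nKy; exists k => //.
  by rewrite yE quo_actN.
apply: filterS => z [nD zM] [k Kk /(same_orbitP S)[A [pA zE]]].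
apply: nD; exists (pmap A); last by exists A, pA; split => //; exists k.
exists A, pA; split => //; exists k; rewrite /sublevel/= -zE /M' !le_max.
by rewrite (KM _ Kk) (ltW zM) orbT.
Qed.

Lemma quo_surj (q : orbit_space Gamma N) : exists w, quo w = q.
Proof. by exists (repr q); exact: reprK. Qed.

(** The closed sets are built upstairs, where there is a norm: vectors of height at most [j] whose
    null coordinates stay at distance at least [1 / (j + 1)] from the complement of [W]. They are
    compact, so their images are closed. *)
Lemma orbit_space_Fsigma (U : set (orbit_space Gamma N)) : open U ->
  exists F : nat -> set (orbit_space Gamma N),
    (forall i, closed (F i)) /\ U = \bigcup_i F i.
Proof.
move=> oU; have [W oW WE] : exists2 W, open W & quo @^-1` U = nc @^-1` W.
  by apply: open_nc; exact: oU.
pose Wj j : set (vec * vec) := \bigcap_(z in ~` W) [set v : vec * vec | j.+1%:R^-1 <= `|z - v|].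
have cWj j : closed (Wj j).
  apply: closed_bigI => z _.
  rewrite (_ : [set v | _] = (fun v : vec * vec => `|z - v|) @^-1` [set r | j.+1%:R^-1 <= r])//.
  apply: preimage_closed; last exact: closed_ge.
  move=> v _; apply: (@continuous_comp _ _ _ (fun v : vec * vec => z - v) Num.norm);
    last exact: norm_continuous.
  apply: (@continuousB _ _ _ (fun=> z : vec * vec) (fun v : vec * vec => v)).
    exact: cst_continuous.
  by move=> U' nU'.
have WjW j : Wj j `<=` W.
  move=> z zj; apply: contrapT => nWz; have := zj z nWz.
  by rewrite /= subrr normr0 leNgt invr_gt0 ltr0Sn.
pose F j := quo @` (sublevel j%:R `&` nc @^-1` Wj j).
exists F; split => [j|].
  apply: (@saturation_closed _ j%:R); last by move=> w [].
  apply: compact_closedI; first exact: (sublevel_compact S).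
  by apply: preimage_closed => // w _; exact: (nc_continuous S).
apply/seteqP; split => [q Uq|q [j _ [w [_ /WjW Ww] <-]]]; last first.
  by rewrite -[U _]/((quo @^-1` U) w) WE.
have [w wq] := quo_surj q.
have Ww : (nc @^-1` W) w by rewrite -WE /= wq.
have : nbhs (nc w) W by apply: open_nbhs_nbhs.
move=> /nbhs_ballP[r /= r0 rW].
pose j := maxn (Num.trunc (height w)).+1 (Num.trunc r^-1).+1.
exists j => //; exists w => //; split.
  rewrite /sublevel/=; apply: ltW; apply: lt_le_trans (truncnS_gt _) _.
  by rewrite ler_nat leq_maxl.
move=> z nWz /=; rewrite leNgt; apply/negP => zw; apply: nWz; apply: rW.
rewrite -ball_normE/= distrC; apply: lt_trans zw _.
rewrite invf_plt ?posrE//; apply: lt_le_trans (truncnS_gt _) _.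
by rewrite ler_nat; apply: leq_trans (leqnSn _); exact: leq_maxr.
Qed.

End Covering.

(** * Measurability *)

Section MeasurableVectors.
Context (R : realType) (n : nat) (d : measure_display) (T : measurableType d).
Local Notation vec := ('rV[R]_n.+2).

Definition coord_measurable (g : T -> vec) : Prop :=
  forall i, measurable_fun setT (fun x => g x 0 i).

Lemma measurable_forall (k : nat) (P : 'I_k -> set T) :
  (forall i, measurable (P i)) -> measurable [set x | forall i, P i x].
Proof.
move=> mP; rewrite -(setCK [set x | _]); apply: measurableC.
rewrite (_ : ~` _ = \bigcup_i ~` P i).
  apply: countable_bigcupT_measurable => [|i]; first exact: countableP.
  exact: measurableC.
by apply/seteqP; split => [x /= /existsNP[i nP]|x [i _ nP] /= /(_ i)//]; exists i.
Qed.

Lemma norm_rV_lt (u : vec) (r : R) : (`|u| < r) <-> 0 < r /\ forall i, `|u 0 i| < r.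
Proof.
rewrite /Num.norm/= mx_normrE; split.
  move=> /bigmax_ltP[r0 ur]; split => // i.
  exact: (ur (0, i)).
move=> [r0 ur]; apply/bigmax_ltP; split => // -[i j] _ /=.
by rewrite (ord1 i); exact: ur.
Qed.

Lemma measurable_norm_lt (g : T -> vec) (q : vec) (r : R) : coord_measurable g ->
  measurable [set x | `|q - g x| < r].
Proof.
move=> mg; have [r0|r0] := ltP 0 r; last first.
  rewrite (_ : [set x | _] = set0)//; apply/seteqP; split => x //=.
  by rewrite ltNge (le_trans r0).
rewrite (_ : [set x | _] = [set x | forall i, `|q 0 i - g x 0 i| < r]).
  apply: measurable_forall => i.
  have mh : measurable_fun setT (fun x => `|q 0 i - g x 0 i|).
    apply: (@measurableT_comp _ _ _ _ _ _ (@Num.norm R R)) => //.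
    by apply: measurable_funB.
  have := mh measurableT `]-oo, r[%classic (measurable_itv _).
  by rewrite setTI.
apply/seteqP; split => x /=.
  by move=> /norm_rV_lt[_ h] i; have := h i; rewrite !mxE.
by move=> h; apply/norm_rV_lt; split => // i; rewrite !mxE.
Qed.

Lemma rational_approx (u : vec) (e : R) : 0 < e ->
  exists q : 'rV[rat]_n.+2, `|map_mx ratr q - u| < e.
Proof.
move=> e0; have /choice[q qP] : forall i, exists q : rat, u 0 i - e < ratr q < u 0 i + e.
  move=> i; have /rat_in_itvoo[q] : u 0 i - e < u 0 i + e by lra.
  by rewrite in_itv/=; exists q.
exists (\row_i q i); apply/norm_rV_lt; split => // i; rewrite !mxE.
by have := qP i; rewrite ltr_norml; lra.
Qed.

(* Open sets of pairs of vectors are countable unions of rational balls. *)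
Lemma open_preimage_measurable (Z : T -> vec * vec) (W : set (vec * vec)) :
  coord_measurable (fst \o Z) -> coord_measurable (snd \o Z) -> open W ->
  measurable (Z @^-1` W).
Proof.
move=> m1 m2 oW.
pose I := ('rV[rat]_n.+2 * 'rV[rat]_n.+2 * rat)%type.
pose B (k : I) : set (vec * vec) :=
  [set z | `|map_mx ratr k.1.1 - z.1| < ratr k.2 /\ `|map_mx ratr k.1.2 - z.2| < ratr k.2].
pose F (k : I) : set T := if `[< B k `<=` W >] then Z @^-1` B k else set0.
rewrite (_ : _ @^-1` _ = \bigcup_k F k).
  apply: countable_bigcupT_measurable => [|k]; first exact: countableP.
  rewrite /F; case: asboolP => // BW.
  by apply: measurableI; exact: measurable_norm_lt.
apply/seteqP; split => [x Wx|x [k _]]; last by rewrite /F; case: asboolP => // BW /BW.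
have : nbhs (Z x) W by exact: open_nbhs_nbhs.
move=> /nbhs_ballP[r /= r0 rW].
have /rat_in_itvoo[e] : r / 4 < r / 2 by lra.
rewrite in_itv/= => /andP[e1 e2]; have e0 : 0 < r / 4 by rewrite divr_gt0.
have [q1 q1P] := rational_approx (Z x).1 e0.
have [q2 q2P] := rational_approx (Z x).2 e0.
exists ((q1, q2), e) => //; rewrite /F; case: asboolP => [_|nBW].
  by split => /=; apply: lt_trans e1.
exfalso; apply: nBW => z [/= z1 z2]; apply: rW.
have key (a b c : vec) : `|b - a| < r / 4 -> `|b - c| < ratr e -> `|a - c| < r.
  move=> h1 h2; apply: le_lt_trans (ler_distD b _ _) _.
  by rewrite [X in X + _]distrC; move: h1 h2 e2; lra.
by split; rewrite -ball_normE /=; [exact: key q1P z1|exact: key q2P z2].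
Qed.

End MeasurableVectors.

Section MeasurableSection.
Context (R : realType) (n : nat) (f : 'cV[R]_n.+2).
Local Notation vec := ('rV[R]_n.+2).
Local Notation borelRP := (g_sigma_algebraType (@open (RP R n))).

Lemma measurable_sec : coord_measurable (sec f : borelRP -> vec).
Proof.
move=> i mD; apply: (measurability _ (RGenOInfty.measurableE R)) => //.
move=> _ [_ [a ->] <-]; rewrite setTI.
have mopen (U : set borelRP) : open (U : set (RP R n)) -> measurable U.
  exact: sub_sigma_algebra.
have mchart : measurable (affine_chart f : set borelRP).
  by apply: mopen; exact: open_affine_chart.
(* Continuity holds on the open chart only; outside it [sec] takes the default value 0, which
   accounts for the second set. *)
rewrite (_ : _ @^-1` _ = [set p | affine_chart f p /\ a < sec f p 0 i] `|`
   (~` affine_chart f `&` [set p | a < 0])).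
  apply: measurableU; last first.
    apply: measurableI; first exact: measurableC.
    have [a0|na0] := pselect (a < 0).
      rewrite (_ : [set _ | a < 0] = setT); first exact: measurableT.
      by apply/seteqP; split.
    rewrite (_ : [set _ | a < 0] = set0); first exact: measurable0.
    by apply/seteqP; split.
  apply: mopen; rewrite openE => p [pf ap].
  have c1 : {for p, continuous (fun p => sec f p 0 i)}.
    apply: (@continuous_comp _ _ _ (sec f) (fun v : vec => v 0 i)).
      exact: sec_continuous.
    exact: coord_continuous.
  have n1 : nbhs p [set p | a < sec f p 0 i].
    by apply: (c1 [set r | a < r]); apply: open_nbhs_nbhs; split => //; exact: open_gt.
  have n2 : nbhs p (affine_chart f).
    by apply: open_nbhs_nbhs; split => //; exact: open_affine_chart.
  by apply: filterS2 n2 n1 => q.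
have sec0 p : ~ affine_chart f p -> sec f p = 0.
  move=> /affine_chartE /negP /negPn /eqP p0.
  by rewrite /sec -lock p0 invr0 scale0r.
apply/seteqP; split => p /=; rewrite in_itv/= andbT.
  have [pf|npf] := pselect (affine_chart f p); first by left.
  by rewrite sec0// mxE; right.
by move=> [[]//|[npf a0]]; rewrite sec0// mxE.
Qed.

Context (d : measure_display) (T : measurableType d).

Lemma measurable_form (g h : T -> vec) : coord_measurable g -> coord_measurable h ->
  measurable_fun setT (fun x => form (g x) (h x)).
Proof.
move=> mg mh; rewrite /form; apply: measurable_sum => i.
by apply: measurable_funM => //; apply: measurable_funM.
Qed.

Lemma coord_measurableZ (a : T -> R) (g : T -> vec) :
  measurable_fun setT a -> coord_measurable g ->
  coord_measurable (fun x => a x *: g x).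
Proof.
move=> ma mg i; rewrite (_ : (fun x => _) = (fun x => a x * g x 0 i)).
  exact: measurable_funM.
by apply/funext => x; rewrite mxE.
Qed.

(** The inverse is written [a * (|a|^-1)^2] in terms of the real power, which is measurable; at 0
    both sides are 0. *)
Lemma measurable_inv (a : T -> R) : measurable_fun setT a ->
  measurable_fun setT (fun x => (a x)^-1).
Proof.
move=> ma; rewrite (_ : (fun x => _) = (fun x => a x * ((`|a x| `^ (-1)) ^+ 2))).
  apply: measurable_funM => //; apply: measurable_funX.
  apply: (measurableT_comp (measurable_powR (-1))).
  exact: (@measurableT_comp _ _ _ _ _ _ (@Num.norm R R)).
apply/funext => x; rewrite powR_inv1// -normfV -normrX ger0_norm ?sqr_ge0//.
have [->|a0] := eqVneq (a x) 0; first by rewrite invr0 mul0r.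
by field.
Qed.

End MeasurableSection.

Section Geodesics.
Context (R : realType) (n : nat) (Gamma : subgroupPO R n).
Context (Omega Lambda : set (RP R n)) (f : 'cV[R]_n.+2).
Hypothesis S : setting Gamma Omega Lambda f.
Local Notation vec := ('rV[R]_n.+2).
Local Notation phi := (chart_form f).
Local Notation sec := (sec f).
Local Notation N := (nonwandering Lambda (convex_core Lambda f)).
Local Notation null_pairs := (null_pairs Lambda f).
Local Notation nc := (@nc R n Lambda f).
Local Notation dflow := (@dflow R n Lambda f).
Local Notation borelRP := (g_sigma_algebraType (@open (RP R n))).
Local Notation ends := (borelRP * borelRP)%type.
Local Notation Dp := (distinct_pairs Lambda).
Implicit Types (p : ends) (q : ends * R) (t s : R) (b : bool) (xi : RP R n).

Definition boundary_form p : R := form (sec p.1) (sec p.2).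

Lemma coord_measurable_comp d d' (T : measurableType d) (T' : measurableType d')
    (g : T' -> vec) (h : T -> T') : coord_measurable g -> measurable_fun setT h ->
  coord_measurable (g \o h).
Proof. by move=> mg mh i; exact: (measurableT_comp (mg i) mh). Qed.

Lemma measurable_sec1 : coord_measurable (fun p => sec p.1).
Proof. by apply: coord_measurable_comp; [exact: measurable_sec|exact: measurable_fst]. Qed.

Lemma measurable_sec2 : coord_measurable (fun p => sec p.2).
Proof. by apply: coord_measurable_comp; [exact: measurable_sec|exact: measurable_snd]. Qed.

Lemma measurable_boundary_form : measurable_fun setT boundary_form.
Proof. by apply: measurable_form; [exact: measurable_sec1|exact: measurable_sec2]. Qed.

Lemma section_set_sec xi : Lambda xi <-> section_set Lambda f (sec xi).
Proof.
split=> [Lx|[p1]]; first by split; rewrite ?(phi_sec1 S)// (proj_sec1 S).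
rewrite proj_sec//; apply/affine_chartE; apply: contra_eq_neq p1 => p0.
by rewrite /sec -lock p0 invr0 scale0r phi0 eq_sym oner_neq0.
Qed.

Lemma measurable_limit_set : measurable (Lambda : set borelRP).
Proof.
rewrite -(setCK Lambda); apply: measurableC.
rewrite (_ : ~` _ = (fun xi : borelRP => (sec xi, sec xi)) @^-1`
    [set z | (~` section_set Lambda f) z.1]); last first.
  by apply/seteqP; split => xi /= nL L; apply: nL; exact/section_set_sec.
apply: open_preimage_measurable; [exact: measurable_sec|exact: measurable_sec|].
apply: open_comp; first by move=> z _; exact: continuous_fst.
apply: closed_openC; apply: compact_closed; last exact: (section_set_compact S).
exact: norm_hausdorff.
Qed.

Lemma boundary_form_lt0 p : Dp p -> boundary_form p < 0.
Proof. by move=> [L1 L2 p12]; exact: (form_sec_lt0 S). Qed.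

(** On the limit set, being distinct amounts to [boundary_form < 0]; measurability of the diagonal
    is thus not invoked. *)
Lemma measurable_distinct_pairs : measurable Dp.
Proof.
rewrite (_ : Dp = (fst @^-1` Lambda `&` snd @^-1` Lambda) `&`
    boundary_form @^-1` `]-oo, 0[%classic); last first.
  apply/seteqP; split => p; rewrite /= in_itv/=.
    by move=> Dpp; case: (Dpp) => L1 L2 _; split=> //; exact: boundary_form_lt0.
  move=> [[L1 L2] p0]; split => // p12.
  by move: p0; rewrite /boundary_form p12 (form_sec0 S L2) ltxx.
apply: measurableI.
  apply: measurableI.
    exact: (measurable_preimage measurable_fst measurable_limit_set).
  exact: (measurable_preimage measurable_snd measurable_limit_set).
by apply: measurable_preimage => //; exact: measurable_boundary_form.
Qed.

Lemma distinct_pairs_swap p : Dp p -> Dp (p.2, p.1).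
Proof. by move=> [L1 L2 p12]; split => // /esym. Qed.

(** The factor [- 2 / boundary_form] ensures [<P | Q> = -2]. The time origin is where [phi P = 1],
    so [P] depends only on the time and on [q.1.2]: geodesics sharing that endpoint are
    automatically synchronised. *)
Definition geo_coord q : vec * vec :=
  (expR q.2 *: sec q.1.2, (expR (- q.2) * (- 2 / boundary_form q.1)) *: sec q.1.1).

Lemma geo_null p t : Dp p -> null_pairs (geo_coord (p, t)).
Proof.
move=> Dpp; have b0 := boundary_form_lt0 Dpp; have [L1 L2 _] := Dpp.
split => /=.
- exact: (coneZ (expR_gt0 _) (cone_sec S L2)).
- apply: coneZ; last exact: (cone_sec S L1).
  by rewrite mulr_gt0 ?expR_gt0// nmulr_lgt0 ?invr_lt0//; lra.
- rewrite formZl formZr formC -/(boundary_form p) !mulrA -expRD subrr expR0 mul1r.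
  by rewrite divfK// lt_eqF.
Qed.

Section Parametrization.
Variable w0 : N.

(* For [b] true, the geodesic from [q.1.1] to [q.1.2] at time [q.2]; for [b] false,
   the geodesic from [q.1.2] to [q.1.1] at time [- q.2], for another choice of the
   origin of time; off [Dp], the irrelevant value [w0]. *)
Definition geo b q : N :=
  if pselect (Dp q.1) is left Dq then of_null S (swap_null b (geo_null q.2 Dq)) else w0.

Lemma nc_geo b p t : Dp p -> swap_if b (nc (geo b (p, t))) = geo_coord (p, t).
Proof.
move=> Dpp; rewrite /geo /=; case: pselect => // Dq; rewrite nc_of_null.
by case: b.
Qed.

Lemma swap_if_inj b (T : Type) (z z' : T * T) : swap_if b z = swap_if b z' -> z = z'.
Proof. by case: b z z' => -[a c] [a' c'] //= [-> ->]. Qed.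

Lemma dflow_geo b p s t : Dp p -> dflow b s (geo b (p, t)) = geo b (p, t + s).
Proof.
move=> Dpp; apply: nc_inj; apply: (@swap_if_inj b).
rewrite (swap_nc_dflow S) !nc_geo// /geo_coord/= !scalerA mulrA -!expRD.
by rewrite [t + s]addrC [- (s + t)]opprD.
Qed.

Lemma measurable_geo b :
  measurable_fun setT (geo b : ends * measurableTypeR R -> borel_at w0).
Proof.
apply: (@measurability _ _ (ends * measurableTypeR R)%type (borel_at w0) setT (geo b)
  (@open (pointed_at w0))).
  by [].
move=> _ [U oU <-]; rewrite setTI.
have [W oW ->] := open_nc oU.
pose W' : set (vec * vec) := [set z | W (swap_if b z)].
have mfst := @measurable_fst _ _ ends (measurableTypeR R).
have mDq : measurable (fst @^-1` Dp : set (ends * measurableTypeR R)).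
  by apply: measurable_preimage => //; exact: measurable_distinct_pairs.
have swapK b' (z : vec * vec) : swap_if b' (swap_if b' z) = z by case: b' z => -[].
have oW' : open W'.
  suff : forall b', open [set z : vec * vec | W (swap_if b' z)] by apply.
  case; first exact: oW.
  apply: open_comp => // z _.
  by apply: (@continuous_pair _ vec vec (fun z => z.2) (fun z => z.1));
    [exact: continuous_snd|exact: continuous_fst].
rewrite (_ : geo b @^-1` _ = fst @^-1` Dp `&` geo_coord @^-1` W' `|`
    (~` (fst @^-1` Dp) `&` [set _ | W (nc w0)])).
  apply: measurableU; last first.
    apply: measurableI; first exact: measurableC.
    have [Ww|nW] := pselect (W (nc w0)).
      by rewrite (_ : [set _ | _] = setT)//; apply/seteqP; split.
    by rewrite (_ : [set _ | _] = set0)//; apply/seteqP; split.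
  apply: measurableI => //; apply: open_preimage_measurable => //.
    apply: coord_measurableZ.
      by apply: (measurableT_comp (@measurable_expR R)); exact: measurable_snd.
    by apply: (coord_measurable_comp measurable_sec2); exact: measurable_fst.
  apply: coord_measurableZ; last first.
    by apply: (coord_measurable_comp measurable_sec1); exact: measurable_fst.
  apply: measurable_funM.
    apply: (measurableT_comp (@measurable_expR R)).
    by apply: measurable_funN; exact: measurable_snd.
  apply: measurable_funM => //; apply: measurable_inv.
  by apply: (measurableT_comp measurable_boundary_form); exact: measurable_fst.
apply/seteqP; split => -[p t] /=.
  have [Dpp Wg|nD] := pselect (Dp p).
    by left; split => //; rewrite /W' /= -(nc_geo b t Dpp) swapK.
  by rewrite /geo/=; case: pselect => //; right.
move=> [[Dpp]|[nD]]; last by rewrite /geo/=; case: pselect.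
by rewrite /W'/= -(nc_geo b t Dpp) swapK.
Qed.

Lemma nc_flow_val (w w' : N) t : set_val w' = flow t (set_val w) -> w' = flow_on t w.
Proof.
move=> E; apply: nc_inj; rewrite (nc_flow S); apply: nc_eq.
  exact: (null_pairs_flow _ (nc_null S w)).
by rewrite E -tvec_nc -flow_tvec; case: (nc w).
Qed.

Lemma param_geo (c : R -> N) p : Dp p -> unit_speed_param p.1 p.2 c ->
  exists s, forall t, c t = geo true (p, t + s).
Proof.
move=> Dpp [bc fc cE]; have [c1 c2 E] := nc_null S (c 0).
have pE : proj (nc (c 0)).1 = p.2.
  rewrite -fc -tvec_nc; have := cone_neq0 c1.
  by case: (nc (c 0)) => P Q /= P0; rewrite forward_end_tvec.
have qE : proj (nc (c 0)).2 = p.1.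
  rewrite -bc -tvec_nc; have := cone_neq0 c2.
  by case: (nc (c 0)) => P Q /= Q0; rewrite backward_end_tvec.
(* The shift is the time at which the normalised geodesic reaches [c 0], since [phi P] equals [e^t]
   along it. *)
exists (ln (phi (nc (c 0)).1)) => t.
rewrite (nc_flow_val (cE t)) -[flow_on t _]/(dflow true t _).
have [p1 _] := c1; have [p2 _] := c2.
rewrite [t + _]addrC -(dflow_geo true _ _ Dpp); congr dflow.
apply: nc_inj; rewrite -[nc (geo _ _)]/(swap_if true _) (nc_geo _ _ Dpp).
have E' : phi (nc (c 0)).1 * phi (nc (c 0)).2 * boundary_form p = - 2.
  rewrite -E [in RHS](cone_secE c1) [in RHS](cone_secE c2) formZl formZr mulrA pE qE.
  by rewrite formC.
have b0 := boundary_form_lt0 Dpp.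
rewrite /geo_coord/= expRN lnK ?posrE// -E' mulrK ?unitfE ?lt_eqF//.
rewrite mulKf ?gt_eqF// -pE -qE -(cone_secE c1) -(cone_secE c2).
by case: (nc _).
Qed.

(** Reversal moves the normalisation [phi = 1] from one endpoint to the other, hence the shift [s],
    which depends on [p]. *)
Lemma geo_swap p : Dp p -> exists s, forall t, geo false (p, t) = geo true ((p.2, p.1), s - t).
Proof.
move=> Dpp; have b0 := boundary_form_lt0 Dpp; have Dsp := distinct_pairs_swap Dpp.
have a0 : 0 < - 2 / boundary_form p by rewrite nmulr_lgt0 ?invr_lt0//; lra.
pose s := ln (- 2 / boundary_form p).
exists s => t; apply: nc_inj; apply: (@swap_if_inj false).
have E1 : expR (s - t) = expR (- t) * (- 2 / boundary_form p).
  by rewrite expRD mulrC lnK ?posrE.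
have E2 : expR (- (s - t)) = expR t / (- 2 / boundary_form p).
  by rewrite expRN E1 expRN invfM invrK.
have -> : nc (geo true (p.2, p.1, s - t)) = geo_coord (p.2, p.1, s - t).
  exact: (nc_geo true).
rewrite (nc_geo _ _ Dpp) /geo_coord/= E1 E2.
have -> : boundary_form (p.2, p.1) = boundary_form p by exact: formC.
by rewrite divfK// gt_eqF.
Qed.

End Parametrization.
End Geodesics.

(** * The Bowen-Margulis measure as a product measure *)

Lemma continuous_borel_measurable (T : ptopologicalType) (R : realType) (g : T -> R) :
  continuous g -> measurable_fun setT (g : g_sigma_algebraType (@open T) -> R).
Proof.
move=> cg; apply: (measurability _ (RGenOInfty.measurableE R)) => //.
move=> _ [_ [a ->] <-]; rewrite setTI; apply: open_borel.
rewrite (_ : _ @^-1` _ = g @^-1` [set r | a < r]).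
  by apply: open_comp => [w _|]; [exact: cg|exact: open_gt].
by apply/seteqP; split => w /=; rewrite in_itv/= andbT.
Qed.

Lemma continuous_pos_part (R : realType) (T : topologicalType) (g : T -> R) :
  continuous g -> continuous (fun y => Num.max 0 (g y)).
Proof.
move=> cg y; apply: (@continuous_max _ _ (fun=> 0) g); last exact: cg.
exact: cst_continuous.
Qed.

Section TestFunctions.
Local Open Scope ereal_scope.
Context (R : realType) (n : nat) (Gamma : subgroupPO R n).
Context (Omega Lambda : set (RP R n)) (f : 'cV[R]_n.+2).
Hypothesis S : setting Gamma Omega Lambda f.
Local Notation vec := ('rV[R]_n.+2).
Local Notation N := (nonwandering Lambda (convex_core Lambda f)).
Local Notation nc := (@nc R n Lambda f).
Local Notation height := (@height R n Lambda f).
Local Notation sublevel := (@sublevel R n Lambda f).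
Variable w0 : N.
Local Notation borelN := (borel_at w0).
Implicit Types (g : N -> R) (M : R).

Definition test_function g := [/\ continuous g, forall w, (0 <= g w)%R &
  exists M, forall w, (M < height w)%R -> g w = 0%R].

Lemma sublevel_closed M : closed (sublevel M).
Proof.
apply: (@preimage_closed _ _ height [set r : R | (r <= M)%R]); last exact: closed_le.
by move=> w _; exact: (height_continuous S).
Qed.

Lemma test_function_compact g : test_function g -> compact (closure [set w | g w != 0%R]).
Proof.
move=> [_ _ [M gM]]; have cM := @sublevel_compact _ _ _ _ _ _ S M.
apply: (subclosed_compact _ cM); first exact: closed_closure.
rewrite closureE => w; apply; split; first exact: sublevel_closed.
move=> y /= gy; rewrite /sublevel/= leNgt; apply/negP => /gM y0.
by rewrite y0 eqxx in gy.
Qed.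

Lemma test_function_measurable g : test_function g ->
  measurable_fun setT (g : borelN -> R).
Proof. by move=> [cg _ _]; exact: (@continuous_borel_measurable (pointed_at w0)). Qed.

Lemma test_functionM g (h : N -> R) : test_function g -> continuous h ->
  (forall w, (0 <= h w)%R) -> test_function (fun w => g w * h w)%R.
Proof.
move=> [cg g0 [M gM]] ch h0; split.
- by move=> w; apply: continuous_mul; [exact: cg|exact: ch].
- by move=> w; rewrite mulr_ge0.
- by exists M => w /gM ->; rewrite mul0r.
Qed.

Lemma test_function_trunc (k : R) g : (0 <= k)%R -> test_function g ->
  test_function (fun w => Num.min 1 (k * g w))%R.
Proof.
move=> k0 [cg g0 [M gM]]; split.
- move=> w; apply: (@continuous_min _ _ (fun=> 1%R) (fun w => k * g w)%R).
    exact: cst_continuous.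
  by apply: continuous_mul; [exact: cst_continuous|exact: cg].
- by move=> w; rewrite le_min ler01 mulr_ge0.
- by exists M => w /gM ->; rewrite mulr0 min_r.
Qed.

Definition height_cut M w : R := Num.max 0%R (M - height w)%R.

Lemma height_cut_test M : test_function (height_cut M).
Proof.
split => [|w|].
- apply: continuous_pos_part => w.
  apply: (@continuousB _ _ _ (fun=> M) height); first exact: cst_continuous.
  exact: (height_continuous S).
- by rewrite le_max lexx.
- by exists M => w Mw; apply/max_l; rewrite subr_le0 ltW.
Qed.

Lemma height_cut_gt0 M w : (0 < height_cut M w)%R = (height w < M)%R.
Proof. by rewrite /height_cut lt_max ltxx subr_gt0. Qed.

(** The truncations [min 1 (k * g)] increase to the indicator of the set where [g] is positive. *)
Lemma test_function_cvg (m : {measure set borelN -> \bar R}) g : test_function g ->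
  \int[m]_w (Num.min 1 (k%:R * g w))%:E @[k --> \oo] --> m [set w | (0 < g w)%R].
Proof.
move=> tg; have [cg g0 _] := tg.
have mg k : measurable_fun setT
    (fun w : borelN => (Num.min 1 (k%:R * g w))%:E).
  apply/measurable_EFinP; exact: (test_function_measurable (test_function_trunc (ler0n _ k) tg)).
have gk0 k w : setT w -> 0 <= (Num.min 1 (k%:R * g w))%:E.
  by move=> _; rewrite lee_fin le_min ler01 mulr_ge0.
have gnd w : setT w -> nondecreasing_seq (fun k : nat => (Num.min 1 (k%:R * g w))%:E).
  move=> _ j k jk; rewrite lee_fin le_min !ge_min lexx/= ler_wpM2r ?ler_nat ?orbT//.
have := @cvg_monotone_convergence _ _ _ m _ measurableT _ mg gk0 gnd.
rewrite (_ : \int[m]_(w in _) _ = m [set w | (0 < g w)%R])//.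
have mp : measurable [set w : borelN | (0 < g w)%R].
  have := measurable_preimage (test_function_measurable tg) (measurable_itv `]0%R, +oo[).
  by congr measurable; apply/seteqP; split => w /=; rewrite in_itv/= andbT.
rewrite -[X in _ = m X]setIT -integral_indic//; apply: eq_integral => w _.
apply/cvg_lim => //; apply: cvg_EFin; first exact: nearW.
have [gw|gw] := ltP 0%R (g w).
  apply: cvg_near_cst; near=> k; rewrite /= indicE mem_set//.
  apply/min_idPl; rewrite -ler_pdivrMr// mul1r.
  by near: k; exact: nbhs_infty_ger.
apply: cvg_near_cst; apply: nearW => k /=.
have -> : g w = 0%R by apply/le_anti; rewrite gw g0.
rewrite mulr0 min_r// indicE memNset//=.
by rewrite (le_gtF gw).
Unshelve. all: by end_near.
Qed.

(** The positivity sets of test functions are stable under intersection, by products. They generate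
    the Borel sets because the coordinates of [nc] are measurable for the sigma-algebra they
    generate. *)
Lemma test_measure_unique (m1 m2 : {measure set borelN -> \bar R}) :
  (forall g, test_function g -> \int[m1]_w (g w)%:E = \int[m2]_w (g w)%:E) ->
  (forall M, m2 (sublevel M) < +oo) ->
  forall B, measurable B -> m1 B = m2 B.
Proof.
move=> m12 m2fin; pose G := [set A : set borelN | exists2 g, test_function g &
  A = [set w | (0 < g w)%R]].
have Gm : G `<=` (@open (pointed_at w0)).
  move=> _ [g [cg _ _] ->].
  rewrite (_ : [set w | _] = g @^-1` [set r : R | (0 < r)%R])//.
  by apply: open_comp => [w _|]; [exact: cg|exact: open_gt].
have m12G A : G A -> m1 A = m2 A.
  move=> [g tg ->]; have h1 := @test_function_cvg m1 g tg.
  have h2 := @test_function_cvg m2 g tg.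
  rewrite -(cvg_lim _ h1)// -(cvg_lim _ h2)//; congr (limn _).
  by apply/funext => k; apply: m12; apply: (test_function_trunc _ tg); exact: ler0n.
pose h k : set borelN := [set w | (0 < height_cut k%:R w)%R].
have hE k : h k = [set w | (height w < k%:R)%R].
  by apply/seteqP; split => w; rewrite /h/= height_cut_gt0.
have Gh k : G (h k) by exists (height_cut k%:R) => //; exact: height_cut_test.
apply: (measure_unique G h) => //.
- rewrite -[LHS]/(<<s (@open (pointed_at w0)) >>); apply/seteqP; split; last first.
    exact: sub_sigma_algebra2.
  apply: smallest_sub; first exact: smallest_sigma_algebra.
  move=> U /open_nc[W oW ->].
  pose T := g_sigma_algebraType (G : set_system (pointed_at w0)).
  have key (c : N -> R) : continuous c -> measurable_fun setT (c : T -> R).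
    move=> cc; apply: (measurability _ (RGenOInfty.measurableE R)) => //.
    move=> _ [_ [a ->] <-]; rewrite setTI.
    (* The height cut turns the positive part of [c - a] into a test function; letting [k] grow
       recovers the whole set where [a < c]. *)
    pose g k w := (height_cut k%:R w * Num.max 0 (c w - a))%R.
    rewrite (_ : c @^-1` _ = \bigcup_k [set w | (0 < g k w)%R]).
      apply: bigcupT_measurable => k; apply: sub_sigma_algebra; exists (g k) => //.
      apply: test_functionM; first exact: height_cut_test.
        apply: continuous_pos_part => w.
        by apply: (@continuousB _ _ _ c (fun=> a)); [exact: cc|exact: cst_continuous].
      by move=> w; rewrite le_max lexx.
    apply/seteqP; split => w /=; rewrite in_itv/= andbT.
      move=> aw; exists (Num.trunc (height w)).+1 => //; rewrite /g /= mulr_gt0//.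
        by rewrite height_cut_gt0 truncnS_gt.
      by rewrite lt_max subr_gt0 aw orbT.
    move=> [k _]; rewrite /g /= => gw; rewrite ltNge; apply/negP => wa.
    by move: gw; rewrite [Num.max _ _]max_l ?mulr0 ?ltxx// subr_le0.
  have coord (p : vec * vec -> vec) : continuous p ->
      coord_measurable (p \o (nc : T -> vec * vec)).
    move=> cp i; apply: key => w.
    apply: (@continuous_comp _ _ _ (p \o nc) (fun v : vec => v ord0 i)).
      by apply: continuous_comp; [exact: (nc_continuous S)|exact: cp].
    exact: coord_continuous.
  apply: (@open_preimage_measurable _ _ _ T nc W) => //.
    by apply: coord => w; exact: continuous_fst.
  by apply: coord => w; exact: continuous_snd.
- move=> _ _ [g tg ->] [g' [cg' g'0 _] ->].
  exists (fun w => g w * g' w)%R; first exact: test_functionM.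
  have [_ g0 _] := tg.
  apply/seteqP; split => w /=; first by move=> [? ?]; exact: mulr_gt0.
  by rewrite !lt0r !mulr_ge0 ?g0 ?g'0//= mulf_eq0 negb_or !andbT => /andP[].
- apply/seteqP; split => // w _; exists (Num.trunc (height w)).+1 => //.
  by rewrite hE /= truncnS_gt.
- move=> k; rewrite m12G//; apply: le_lt_trans (m2fin k%:R).
  rewrite le_measure ?inE//; first by apply: (@open_borel (pointed_at w0)); exact: Gm.
    by apply: (@closed_borel (pointed_at w0)); exact: sublevel_closed.
  by rewrite hE => w /ltW.
Qed.

End TestFunctions.

Section SigmaFiniteCopy.
Context d (T : measurableType d) (R : realType) (m : {measure set T -> \bar R}).
Hypothesis sm : sigma_finite setT m.

(** An alias carrying the proof of sigma-finiteness, so that the restricted current can receive the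
    structure required by the theorems of Fubini and Tonelli. *)
Definition sigma_finite_copy of sigma_finite setT m : set T -> \bar R := m.

HB.instance Definition _ := Measure.copy (sigma_finite_copy sm) m.
HB.instance Definition _ :=
  Measure_isSigmaFinite.Build _ _ _ (sigma_finite_copy sm) sm.

End SigmaFiniteCopy.

(** * The geodesic current and its density *)

Section Current.
Context (R : realType) (n : nat) (Gamma : subgroupPO R n).
Context (Omega Lambda : set (RP R n)) (f : 'cV[R]_n.+2).
Hypothesis S : setting Gamma Omega Lambda f.
Local Notation vec := ('rV[R]_n.+2).
Local Notation sec := (sec f).
Local Notation borelRP := (g_sigma_algebraType (@open (RP R n))).
Local Notation ends := (borelRP * borelRP)%type.
Local Notation Dp := (distinct_pairs Lambda).
Local Notation boundary_form := (@boundary_form R n f).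
Implicit Types (p : ends) (t s : R) (b : bool) (xi : RP R n).

(** These sets exhaust [Dp] and stay uniformly away from the diagonal, so that the current is
    comparable there to [nu \x nu]. *)
Definition thick_pairs (j : nat) : set ends :=
  Dp `&` [set p | j.+1%:R^-1 <= - boundary_form p].

Lemma measurable_thick_pairs j : measurable (thick_pairs j).
Proof.
apply: measurableI; first exact: (measurable_distinct_pairs S).
have := measurable_preimage (measurable_boundary_form f) (measurable_itv `]-oo, - j.+1%:R^-1]).
by congr measurable; apply/seteqP; split => p /=; rewrite in_itv/= lerNr.
Qed.

Lemma bigcup_thick_pairs : \bigcup_j thick_pairs j = Dp.
Proof.
apply/seteqP; split => [p [j _ []]//|p Dpp].
have b0 : 0 < - boundary_form p by rewrite oppr_gt0 (boundary_form_lt0 S).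
exists (Num.trunc (- boundary_form p)^-1) => //; split => //=.
by rewrite invf_ple ?posrE// ltW// truncnS_gt.
Qed.

Lemma thick_pairs_mono i j : (i <= j)%N -> thick_pairs i `<=` thick_pairs j.
Proof.
move=> ij p [Dpp /= pi]; split => //=; apply: le_trans pi.
by rewrite lef_pV2 ?posrE// ler_nat.
Qed.

Section Density.
Variables (x : RP R n) (delta : R).
Hypothesis x_core : convex_core Lambda f x.
Local Notation ux := (ulift x).

(* [x] lies in the convex hull of [Lambda], on which [form (sec xi)] is
   nonpositive and vanishes only at [sec xi]. *)
Lemma form_sec_core xi : Lambda xi -> form (sec xi) ux != 0.
Proof.
move=> Lx; have [xA [y yhull yx]] := x_core.
pose K : set vec := [set y | form (sec xi) y < 0 \/ y = sec xi].
have KL : in_chart f Lambda `<=` K.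
  move=> u [/phiE u1 Lu]; have [E|ux] := pselect (proj u = xi).
    by right; rewrite -E sec_proj ?u1 ?oner_neq0// invr1 scale1r.
  left; have us : cone Lambda f u by split; rewrite ?u1.
  apply: (cone_lt0 S (cone_sec S Lx) us).
  by rewrite (proj_sec1 S Lx) => /esym.
have cK : @convex_set R vec K.
  apply/convex_setW => u v; rewrite !inE => Ku Kv k k0 k1.
  have k1' : 0 < 1 - k%:num by rewrite subr_gt0.
  have xi0 := form_sec0 S Lx.
  suff Kuv : K (k%:num *: u + (1 - k%:num) *: v). exact: (mem_set Kuv).
  rewrite /K/=; move: (k%:num) k0 k1 k1' => {}k k0 k1 k1'.
  rewrite formDr !formZr.
  case: Ku => [u0|->]; case: Kv => [v0|->]; rewrite ?xi0 ?mulr0 ?addr0 ?add0r.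
  - by left; nra.
  - by left; nra.
  - by left; nra.
  - by right; rewrite -scalerDl addrCA subrr addr0 scale1r.
have [xiy|yE] : K y by apply: yhull; split.
  have y0 : y != 0.
    by apply: contraTneq xiy => ->; rewrite -(scale0r (0 : vec)) formZr mul0r ltxx.
  have [c [c0 E]] := lift_proj y0.
  rewrite yx in E; rewrite /ulift formZr mulf_neq0//; last first.
    by rewrite E formZr mulf_neq0// lt_eqF.
  by rewrite invr_eq0 gt_eqF// sqrtr_gt0 oppr_gt0.
exfalso; move: xA; have := form_sec0 S Lx; rewrite -yx yE (proj_sec1 S Lx).
have [c [c0 E]] : exists c, c != 0 /\ lift xi = c *: sec xi.
  by rewrite -{1}(proj_sec1 S Lx); apply: lift_proj; exact: (cone_neq0 (cone_sec S Lx)).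
by rewrite /AdS/= E formZl formZr => ->; rewrite !mulr0 ltxx.
Qed.

Definition chart_gromov (z : vec * vec) : R :=
  form z.1 z.2 / (2 * form z.1 ux * form ux z.2).

(** The Gromov distance to the power [- 2 delta], computed with the lifts [sec], which unlike
    arbitrary representatives depend measurably on the point. *)
Definition density p : R :=
  Num.sqrt `|chart_gromov (sec p.1, sec p.2)| `^ (- (2 * delta)).

Lemma chart_gromov_neq0 p : Dp p -> chart_gromov (sec p.1, sec p.2) != 0.
Proof.
move=> Dpp; have [L1 L2 _] := Dpp.
rewrite /chart_gromov/= [form ux _]formC !mulf_neq0 ?invr_eq0 ?mulf_neq0 ?form_sec_core//.
by rewrite lt_eqF// (boundary_form_lt0 S Dpp).
Qed.

Lemma gromov_dist_density p : Dp p ->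
  gromov_dist x p.1 p.2 `^ (- (2 * delta)) = density p.
Proof.
move=> Dpp; have [L1 L2 _] := Dpp.
have n0 xi : Lambda xi -> exists c, c != 0 /\ lift xi = c *: sec xi.
  move=> Lx; rewrite -{1}(proj_sec1 S Lx).
  by apply: lift_proj; exact: (cone_neq0 (cone_sec S Lx)).
have [c [c0 E1]] := n0 _ L1; have [e [e0 E2]] := n0 _ L2.
have h1 := form_sec_core L1; have h2 := form_sec_core L2; rewrite formC in h2.
rewrite /density /gromov_dist /chart_gromov/=; congr (Num.sqrt `|_| `^ _).
move: ux h1 h2 => y h1 h2; rewrite E1 E2 !formZl !formZr.
by field; rewrite c0 e0 h1 h2.
Qed.

Lemma measurable_density : measurable_fun setT density.
Proof.
apply: (measurableT_comp (measurable_powR _)).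
apply: measurableT_comp.
  by apply: continuous_measurable_fun; exact: sqrt_continuous.
apply: (@measurableT_comp _ _ _ _ _ _ (@Num.norm R R)) => //.
have cst : coord_measurable (fun _ : ends => ux) by move=> i; exact: measurable_cst.
apply: measurable_funM; first exact: (measurable_boundary_form f).
apply: measurable_inv; apply: measurable_funM.
  apply: measurable_funM => //.
  by apply: measurable_form => //; exact: measurable_sec1.
by apply: measurable_form => //; exact: measurable_sec2.
Qed.

Lemma density_ge0 p : 0 <= density p.
Proof. exact: powR_ge0. Qed.

Lemma density_swap p : density (p.2, p.1) = density p.
Proof.
rewrite /density/chart_gromov/= [form (sec p.2) (sec p.1)]formC.
by rewrite [form (sec p.2) _]formC [form ux (sec p.1)]formC [2 * _ * _]mulrAC.
Qed.

(** The logarithm of the density is continuous on the compact set of pairs of sections with product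
    at most [- 1 / (j + 1)], hence bounded by some [M]; the constant is [expR M]. *)
Lemma density_bounded j : exists2 C, 0 < C &
  forall p, thick_pairs j p -> density p <= C /\ 1 <= C * density p.
Proof.
pose K : set (vec * vec) := (section_set Lambda f `*` section_set Lambda f) `&`
  [set z | j.+1%:R^-1 <= - form z.1 z.2].
have cf1 : continuous (fun z : vec * vec => form z.1 z.2).
  by move=> z; apply: continuous_form; [exact: continuous_fst|exact: continuous_snd].
have cK : compact K.
  apply: compact_closedI; first by apply: compact_setX; exact: (section_set_compact S).
  apply: (@preimage_closed _ _ (fun z : vec * vec => - form z.1 z.2)
    [set r | j.+1%:R^-1 <= r]); last exact: closed_ge.
  by move=> z _; apply: (@continuousN _ _ _ (fun z : vec * vec => form z.1 z.2)); exact: cf1.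
pose L z := - (2 * delta) * ln (Num.sqrt `|chart_gromov z|).
have secP u : section_set Lambda f u -> Lambda (proj u) /\ sec (proj u) = u.
  by move=> [u1 Lu]; split => //; rewrite sec_proj ?u1 ?oner_neq0// invr1 scale1r.
have cL : {within K, continuous L}.
  apply: continuous_in_subspaceT => z; rewrite inE => -[[/= /secP[L1 E1] /secP[L2 E2]] b].
  have Dz : Dp (proj z.1, proj z.2).
    split => //= E; move: b; rewrite -E1 -E2 -E (form_sec0 S L1) oppr0 leNgt invr_gt0.
    by rewrite ltr0Sn.
  have q0 : chart_gromov z != 0.
    by have := chart_gromov_neq0 Dz; rewrite /= E1 E2; case: (z).
  have h1 : form z.1 ux != 0 by rewrite -E1; exact: form_sec_core.
  have h2 : form ux z.2 != 0 by rewrite formC -E2; exact: form_sec_core.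
  apply: (@continuous_mul _ _ (fun=> - (2 * delta))
    (fun z => ln (Num.sqrt `|chart_gromov z|))); first exact: cst_continuous.
  apply: (@continuous_comp _ _ _ (fun z => Num.sqrt `|chart_gromov z|) (@ln R)); last first.
    by apply: continuous_ln; rewrite sqrtr_gt0 normr_gt0.
  apply: (@continuous_comp _ _ _ (fun z => `|chart_gromov z|) (@Num.sqrt R)); last first.
    exact: sqrt_continuous.
  apply: (@continuous_comp _ _ _ chart_gromov (@Num.norm R R)); last exact: norm_continuous.
  apply: (@continuous_mul _ _ (fun z : vec * vec => form z.1 z.2)
    (fun z => (2 * form z.1 ux * form ux z.2)^-1)); first exact: cf1.
  apply: (@continuousV _ _ (fun z : vec * vec => 2 * form z.1 ux * form ux z.2)).
    by rewrite !mulf_neq0.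
  apply: (@continuous_mul _ _ (fun z : vec * vec => 2 * form z.1 ux)
    (fun z => form ux z.2)).
    apply: (@continuous_mul _ _ (fun=> 2) (fun z : vec * vec => form z.1 ux)).
      exact: cst_continuous.
    by apply: continuous_form; [exact: continuous_fst|exact: cst_continuous].
  by apply: continuous_form; [exact: cst_continuous|exact: continuous_snd].
have [M MP] : exists M, forall z, K z -> `|L z| <= M.
  have /compact_bounded[M0 [_ bM]] := continuous_compact cL cK.
  exists (M0 + 1) => z Kz; apply: (bM (M0 + 1)); first by rewrite ltrDl.
  by exists z.
exists (expR M) => [|p [Dpp /= bp]]; first exact: expR_gt0.
have [L1 L2 _] := Dpp.
have /MP : K (sec p.1, sec p.2).
  by split => //; split => /=; apply/(section_set_sec S).
have -> : density p = expR (L (sec p.1, sec p.2)).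
  rewrite /density /powR gt_eqF// sqrtr_gt0 normr_gt0; exact: chart_gromov_neq0.
rewrite ler_norml => /andP[h1 h2]; split; first by rewrite ler_expR.
by rewrite -expRD -[1]expR0 ler_expR -lerBlDl sub0r.
Qed.

End Density.

Local Open Scope ereal_scope.

Section Reduced.
Variables (x : RP R n) (delta : R) (nu : {finite_measure set borelRP -> \bar R}).
Variable mu : {measure set ends -> \bar R}.
Hypothesis x_core : convex_core Lambda f x.
Hypothesis mu_current : geodesic_current Lambda delta x nu mu.
Local Notation nu2 := (nu \x nu).
Local Notation density := (density x delta).

Let mD := measurable_distinct_pairs S.

Lemma current_density (E : set ends) : measurable E ->
  mu (E `&` Dp) = \int[nu2]_(p in E `&` Dp) (density p)%:E.
Proof.
move=> mE; rewrite mu_current; [|exact: measurableI|exact: subIsetr].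
by apply: eq_integral => p; rewrite inE => -[_ Dpp]; rewrite gromov_dist_density.
Qed.

Let mk E : measurable_fun E (fun p => (density p)%:E).
Proof.
apply: (@measurable_funS _ _ _ _ setT) => //.
by apply/measurable_EFinP; exact: measurable_density.
Qed.

Lemma current_thick j : exists2 C : R, (0 < C)%R &
  forall E, measurable E -> E `<=` thick_pairs j ->
  mu (E `&` Dp) <= C%:E * nu2 E /\ nu2 E <= C%:E * mu (E `&` Dp).
Proof.
have [C C0 CP] := @density_bounded x delta x_core j; exists C => // E mE Ej.
have ED : E `&` Dp = E by apply/setIidPl => p /Ej[].
rewrite current_density// ED; split.
  rewrite -[leRHS](integral_cst nu2 mE); apply: ge0_le_integral => //.
  - by move=> p _; rewrite lee_fin density_ge0.
  - by move=> p /Ej/CP[kC _]; rewrite lee_fin.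
rewrite -ge0_integralZl//; last 2 first.
- by move=> p _; rewrite lee_fin density_ge0.
- by rewrite lee_fin ltW.
rewrite -[leLHS]mul1e -[leLHS](integral_cst nu2 mE); apply: ge0_le_integral => //.
- by apply: emeasurable_funM => //; exact: mk.
- by move=> p /Ej/CP[_ kC]; rewrite -EFinM lee_fin.
Qed.

Lemma current_thick_finite j : mu (thick_pairs j `&` Dp) < +oo.
Proof.
have [C C0 CP] := current_thick j; have mt := @measurable_thick_pairs j.
have [+ _] := CP _ mt (@subset_refl _ _).
move=> /le_lt_trans; apply; rewrite lte_mul_pinfty ?lee_fin 1?ltW//.
apply: (@le_lt_trans _ _ (nu2 setT)); first by rewrite le_measure ?inE.
by rewrite -setXTT product_measure1E// ltey_eq fin_numM// fin_num_measure.
Qed.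

Lemma current_null E : measurable E -> E `<=` Dp -> nu2 E = 0 -> mu (E `&` Dp) = 0.
Proof.
move=> mE ED E0; rewrite current_density// (setIidl ED).
exact: null_set_integral.
Qed.

Lemma current_sigma_finite : exists mu0 : {sigma_finite_measure set ends -> \bar R},
  forall E, mu0 E = mu (E `&` Dp).
Proof.
suff sm : sigma_finite setT (mrestr mu mD).
  by exists (sigma_finite_copy sm : {sigma_finite_measure set ends -> \bar R}).
(* The complement of [Dp] is added to every piece in order to cover the whole space; the restricted
   measure does not charge it. *)
exists (fun j => thick_pairs j `|` ~` Dp).
  apply/seteqP; split => // p _; have [Dpp|nD] := pselect (Dp p); last by exists 0%N; [|right].
  by move: (Dpp); rewrite -{1}bigcup_thick_pairs => -[j _ pj]; exists j => //; left.
move=> j; split.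
  by apply: measurableU; [exact: measurable_thick_pairs|exact: measurableC].
rewrite /= /mrestr setIUl setICl setU0; exact: current_thick_finite.
Qed.

End Reduced.

End Current.

Section LebesgueIntegral.
Local Open Scope ereal_scope.
Context (R : realType).
Local Notation lambda := (@lebesgue_measure R).

Lemma integral_shift (c : R) (h : R -> \bar R) : measurable_fun setT h ->
  (forall t, 0 <= h t) -> \int[lambda]_t h (t + c)%R = \int[lambda]_t h t.
Proof.
move=> mh h0; have ms : measurable_fun setT
    ((fun t : R => (t + c)%R) : measurableTypeR R -> measurableTypeR R).
  by apply: measurable_funD => //; exact: measurable_cst.
have := @ge0_integral_pushforward _ _ _ _ _ _ ms lambda setT h measurableT mh.
rewrite preimage_setT => <-; last by move=> y _; exact: h0.
apply: eq_measure_integral => A mA _; exact: lebesgue_measure_shift.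
Qed.

End LebesgueIntegral.

Section MeasureFormula.
Local Open Scope ereal_scope.
Context (R : realType) (n : nat) (Gamma : subgroupPO R n).
Context (Omega Lambda : set (RP R n)) (f : 'cV[R]_n.+2).
Hypothesis S : setting Gamma Omega Lambda f.
Local Notation vec := ('rV[R]_n.+2).
Local Notation sec := (sec f).
Local Notation N := (nonwandering Lambda (convex_core Lambda f)).
Local Notation height := (@height R n Lambda f).
Local Notation sublevel := (@sublevel R n Lambda f).
Local Notation borelRP := (g_sigma_algebraType (@open (RP R n))).
Local Notation ends := (borelRP * borelRP)%type.
Local Notation Dp := (distinct_pairs Lambda).
Local Notation boundary_form := (@boundary_form R n f).
Local Notation thick_pairs := (@thick_pairs R n Lambda f).
Local Notation lambda := (@lebesgue_measure R).
Implicit Types (p : ends) (t s M : R) (b : bool) (E : set ends).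

Let mD := measurable_distinct_pairs S.
Let swap p : ends := (p.2, p.1).

Section Symmetry.
Variables (x : RP R n) (delta : R) (nu : {finite_measure set borelRP -> \bar R}).
Variable mu : {measure set ends -> \bar R}.
Hypothesis x_core : convex_core Lambda f x.
Hypothesis mu_current : geodesic_current Lambda delta x nu mu.
Local Notation nu2 := (nu \x nu).

Lemma current_swap E : measurable E -> mu (swap @^-1` E `&` Dp) = mu (E `&` Dp).
Proof.
move=> mE; have msw := @measurable_swap _ borelRP.
have mED : measurable (E `&` Dp) by exact: measurableI.
have mswE : measurable (swap @^-1` E) by exact: (measurable_preimage msw).
rewrite !(current_density S x_core mu_current)//.
have sDp : swap @^-1` E `&` Dp = swap @^-1` (E `&` Dp).
  by apply/seteqP; split => -[a c] [/= ? ?]; split => //; exact: (@distinct_pairs_swap _ _ _ (_, _)).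
have := @ge0_integral_pushforward _ _ _ _ _ _ msw nu2 (E `&` Dp)
  (fun p => (density f x delta p)%:E) mED.
rewrite sDp => H; transitivity
  (\int[nu2]_(p in swap @^-1` (E `&` Dp)) ((fun p => (density f x delta p)%:E) \o swap) p).
  by apply: eq_integral => p _ /=; rewrite density_swap.
rewrite -H; last 2 first.
- apply: (@measurable_funS _ _ _ _ setT); [exact: measurableT|exact: subsetT|].
  by apply/measurable_EFinP; exact: measurable_density.
- by move=> p _; rewrite lee_fin density_ge0.
by apply: eq_measure_integral => A mA _; exact: nu2_swap.
Qed.

End Symmetry.

Lemma boundary_form_bounded : exists2 C : R, (0 < C)%R &
  forall p, Dp p -> (- boundary_form p <= C)%R.
Proof.
pose K := section_set Lambda f `*` section_set Lambda f.
have cK : compact K by apply: compact_setX; exact: (section_set_compact S).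
have cf1 : {within K, continuous (fun z : vec * vec => form z.1 z.2)}.
  apply: continuous_subspaceT => z.
  by apply: continuous_form; [exact: continuous_fst|exact: continuous_snd].
have /compact_bounded[M0 [_ bM]] := continuous_compact cf1 cK.
exists (Num.max 1 (M0 + 1))%R; first by rewrite lt_max ltr01.
move=> p [L1 L2 _]; rewrite le_max; apply/orP; right.
apply: (le_trans (ler_norm _)); rewrite normrN.
apply: (bM (M0 + 1)%R); first by rewrite ltrDl.
by exists (sec p.1, sec p.2) => //; split; apply/(section_set_sec S).
Qed.

Section Formula.
Variables (mu0 : {sigma_finite_measure set ends -> \bar R}) (w0 : N).
Hypothesis mu0_null : mu0 (~` Dp) = 0.
Hypothesis mu0_swap : forall E, measurable E -> mu0 (swap @^-1` E) = mu0 E.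
Hypothesis mu0_thick : forall j, mu0 (thick_pairs j) < +oo.
Local Notation geo := (geo S w0).
Local Notation borelN := (borel_at w0).
Local Notation prod_measure := (mu0 \x lambda).

Lemma measurable_geo_preimage b (B : set borelN) : measurable B ->
  measurable (geo b @^-1` B : set (ends * measurableTypeR R)).
Proof. exact: (measurable_preimage (@measurable_geo _ _ _ _ _ _ S w0 b)). Qed.

Lemma height_geo b p t : Dp p ->
  height (geo b (p, t)) = (expR t + expR (- t) * (- 2 / boundary_form p))%R.
Proof.
move=> Dpp; have [L1 L2 _] := Dpp.
by rewrite (swap_height b) nc_geo// /geo_coord/= !phiZ !(phi_sec1 S)// !mulr1.
Qed.

(** With [d = - boundary_form p], the height is [e^t + e^-t * (2 / d)]. The product [2 / d] of its
    two terms bounds [d] from below, and each term bounds the time on one side. *)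
Lemma geo_sublevel b M : exists j (T : R), forall p t, Dp p ->
  sublevel M (geo b (p, t)) -> thick_pairs j p /\ (- T <= t <= T)%R.
Proof.
have [C C0 CP] := boundary_form_bounded.
pose M' := Num.max 1%R M; have M'0 : (0 < M')%R by rewrite lt_max ltr01.
(* [2 / d <= M' ^ 2] yields the index; [e^t <= M'] and [e^-t <= M' * d / 2 <= M' * C / 2] yield the
   two bounds on time. *)
exists (Num.trunc (M' ^+ 2 / 2)), (Num.max (ln M') (ln (M' * C / 2)))%R.
move=> p t Dpp; have b0 := boundary_form_lt0 S Dpp.
rewrite /sublevel/= height_geo// => hM.
have {hM} : (expR t + expR (- t) * (- 2 / boundary_form p) <= M')%R.
  by rewrite (le_trans hM)// le_max lexx orbT.
have bC := CP _ Dpp; move: b0 bC; set d := (- boundary_form p)%R => b0 bC.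
have d0 : (0 < d)%R by rewrite oppr_gt0.
have -> : (- 2 / boundary_form p = 2 / d)%R by rewrite /d invrN mulrN mulNr.
have e0 := expR_gt0 t; have eN0 := expR_gt0 (- t).
have ee : (expR t * expR (- t) = 1)%R by rewrite -expRD subrr expR0.
have q0 : (0 < 2 / d)%R by rewrite divr_gt0.
have dq : (d * (2 / d) = 2)%R by field; rewrite gt_eqF.
move=> hM; have h1 : (expR t <= M')%R by apply: le_trans hM; rewrite lerDl mulr_ge0 ?ltW.
have h2 : (expR (- t) * (2 / d) <= M')%R by apply: le_trans hM; rewrite lerDr ltW.
split; [split => //=|].
- rewrite -/d invf_ple ?posrE//; apply: ltW; apply: le_lt_trans (truncnS_gt _).
  have h3 : (2 / d <= M' * M')%R.
    have -> : (2 / d = expR t * (expR (- t) * (2 / d)))%R by rewrite mulrA ee mul1r.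
    apply: ler_pM => //; by rewrite mulr_ge0 ?ltW.
  have := ltW q0; rewrite expr2; move: h3; rewrite [(2 / d)%R]mulrC; lra.
- apply/andP; split.
    rewrite lerNl le_max; apply/orP; right.
    rewrite -ler_expR lnK ?posrE ?divr_gt0 ?mulr_gt0//.
    have : (expR (- t) * 2 <= M' * d)%R by rewrite -ler_pdivrMr// -mulrA.
    by rewrite ler_pdivlMr// => /le_trans; apply; rewrite ler_pM2l.
  by rewrite le_max -ler_expR lnK ?posrE// h1.
Qed.

Lemma prod_measure_sublevel M : prod_measure (geo true @^-1` sublevel M) < +oo.
Proof.
have [j [T jT]] := geo_sublevel true M.
have mt := @measurable_thick_pairs _ _ _ _ _ _ S j.
have ms : measurable (sublevel M : set borelN).
  by apply: (@closed_borel (pointed_at w0)); exact: (sublevel_closed S).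
have mDT : measurable (~` Dp `*` setT : set (ends * measurableTypeR R)).
  by apply: measurableX => //; exact: measurableC.
have mI : measurable (`[(- T)%R, T]%classic : set (measurableTypeR R)).
  exact: measurable_itv.
have mtI : measurable (thick_pairs j `*` `[(- T)%R, T]%classic : set (ends * measurableTypeR R)).
  exact: measurableX.
apply: (@le_lt_trans _ _ (prod_measure ((~` Dp `*` setT) `|` (thick_pairs j `*` `[(- T)%R, T]%classic)))).
  rewrite le_measure ?inE//; first exact: measurable_geo_preimage.
    exact: measurableU.
  move=> [p t] /= st; have [Dpp|nD] := pselect (Dp p); last by left.
  by right; have [? ?] := jT _ _ Dpp st; split => //=; rewrite in_itv.
apply: (le_lt_trans (measureU2 _ _ _)) => //.
apply: lte_add_pinfty.
  rewrite [X in X < _](_ : _ = mu0 (~` Dp) * lambda setT).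
    by rewrite mu0_null mul0e.
  by apply: product_measure1E => //; exact: measurableC.
rewrite [X in X < _](_ : _ = mu0 (thick_pairs j) * lambda `[(- T)%R, T]%classic);
  last exact: product_measure1E.
rewrite lebesgue_measure_itv; case: ifP => _; last by rewrite mule0.
rewrite -EFinB; apply: lte_mul_pinfty; [exact: measure_ge0| |exact: ltry].
by apply/fin_numPlt; rewrite mu0_thick andbT; apply: lt_le_trans (measure_ge0 mu0 _).
Qed.

(** Reversal exchanges the endpoints and reflects time about a point depending on the pair; [mu0] is
    invariant under the first operation and the Lebesgue measure under the second. *)
Lemma geo_swap_formula (B : set borelN) : measurable B ->
  prod_measure (geo false @^-1` B) = prod_measure (geo true @^-1` B).
Proof.
move=> mB; have mt := measurable_geo_preimage true mB.
pose L p := lambda (xsection (geo true @^-1` B) p).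
have mL : measurable_fun setT L by exact: measurable_fun_xsection.
have msw := @measurable_swap _ borelRP.
transitivity (\int[mu0]_p (L \o swap) p).
  apply: eq_integral => p _; rewrite /L/=.
  have [Dpp|nD] := pselect (Dp p); last first.
    have nDs : ~ Dp (swap p) by case: (p) nD => a e nD /distinct_pairs_swap /nD.
    congr (lambda _); apply/seteqP; split => t; rewrite /xsection/= !inE/= /geo/=;
      by case: pselect => // _; case: pselect.
  have [s sE] := geo_swap S w0 Dpp.
  rewrite -[RHS](lebesgue_measure_reflect s); last exact: (measurable_xsection _ mt).
  congr (lambda _); apply/seteqP; split => t; rewrite /xsection/= !inE/=;
    by rewrite sE.
have := @ge0_integral_pushforward _ _ _ _ _ _ msw mu0 setT L measurableT mL.
rewrite preimage_setT => <-; last by move=> y _; exact: measure_ge0.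
by apply: eq_measure_integral => A mA _; exact: mu0_swap.
Qed.

Variables (mu : {measure set ends -> \bar R}) (c : RP R n -> RP R n -> R -> N).
Variable m : {measure set borelN -> \bar R}.
Hypothesis mu0E : forall E, mu0 E = mu (E `&` Dp).
Hypothesis cP : forall p, Dp p -> unit_speed_param p.1 p.2 (c p.1 p.2).
Hypothesis m_int : forall F : N -> R, continuous F -> compact (closure [set w | F w != 0%R]) ->
  \int[m]_w (F w)%:E = \int[mu]_(p in Dp) \int[lambda]_t (F (c p.1 p.2 t))%:E.

(** On test functions both sides agree, since translating time absorbs the difference between [c]
    and [geo]. The product form is needed for both directions of time, hence for both values of
    [b]. *)
Lemma current_formula b (B : set borelN) : measurable B ->
  m B = prod_measure (geo b @^-1` B).
Proof.
move=> mB; transitivity (prod_measure (geo true @^-1` B)); last first.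
  by case: b; [reflexivity|rewrite geo_swap_formula].
pose mg := @measurable_geo _ _ _ _ _ _ S w0 true.
pose gt : ends * measurableTypeR R -> borelN := geo true.
pose m' : {measure set borelN -> \bar R} := pushforward prod_measure gt.
rewrite -[RHS]/(m' mg B).
apply: (test_measure_unique S) => // [g tg|M]; last exact: prod_measure_sublevel.
have mgt := @test_function_measurable _ _ _ _ w0 g tg; have [cg g0 _] := tg.
have mgE : measurable_fun setT (fun w : borelN => (g w)%:E).
  exact/measurable_EFinP.
have mgg : measurable_fun setT (fun q : ends * measurableTypeR R => (g (geo true q))%:E).
  exact: (measurableT_comp mgE).
rewrite m_int//; last exact: (test_function_compact S).
have := @ge0_integral_pushforward _ _ _ _ _ _ mg prod_measure setT
  (fun w => (g w)%:E) measurableT mgE.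
rewrite preimage_setT => ->; last by move=> w _; rewrite lee_fin.
rewrite fubini_tonelli1//; last by move=> q; rewrite lee_fin.
have mF := @measurable_fun_fubini_tonelli_F _ _ _ _ _ lambda _ mgg.
transitivity (\int[mu]_(p in Dp) \int[lambda]_t (g (geo true (p, t)))%:E).
  apply: eq_integral => p; rewrite inE => Dpp.
  have [s sE] := param_geo S w0 Dpp (cP Dpp).
  rewrite -[RHS](integral_shift s); first by apply: eq_integral => t _; rewrite sE.
    apply: (measurableT_comp mgg); exact: measurable_pair1.
  by move=> t; rewrite lee_fin.
rewrite [RHS](@ge0_negligible_integral _ _ _ _ _ (~` Dp))//.
- rewrite setTD setCK; apply: eq_measure_integral => A mA AD.
  by rewrite -{1}(setIidl AD) -mu0E.
- exact: measurableC.
- by apply: mF => q; rewrite lee_fin.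
- by move=> p _; apply: integral_ge0 => t _; rewrite lee_fin.
Qed.

End Formula.
End MeasureFormula.

(** * The measure on the quotient *)

Section Quotient.
Local Open Scope ereal_scope.
Context (R : realType) (n : nat) (Gamma : subgroupPO R n).
Context (Omega Lambda : set (RP R n)) (f : 'cV[R]_n.+2).
Hypothesis S : setting Gamma Omega Lambda f.
Local Notation N := (nonwandering Lambda (convex_core Lambda f)).
Local Notation quo := (@orbit_of R n Gamma N).
Local Notation sublevel := (@sublevel R n Lambda f).
Local Notation dflow := (@dflow R n Lambda f).
Local Notation borelRP := (g_sigma_algebraType (@open (RP R n))).
Local Notation ends := (borelRP * borelRP)%type.
Local Notation Dp := (distinct_pairs Lambda).
Local Notation thick_pairs := (@thick_pairs R n Lambda f).
Local Notation lambda := (@lebesgue_measure R).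
Implicit Types (p : ends) (t s M : R) (b : bool).

Lemma finite_injective_cover M : exists (k : nat) (U : nat -> set N) (M' : R),
  [/\ forall i, (i < k)%N -> open (U i),
      forall i, (i < k)%N -> set_inj (U i) quo,
      forall i, (i < k)%N -> U i `<=` sublevel M' &
      sublevel M `<=` \big[setU/set0]_(i < k) U i].
Proof.
have /choice[V VP] := injective_nbhd S.
have [->|/set0P[w1 _]] := eqVneq (sublevel M) set0.
  by exists 0%N, (fun=> set0), 0%R; split => //; exact: sub0set.
have : compact (sublevel M : set (pointed_at w1)) by exact: (sublevel_compact S).
rewrite compact_cover.
move=> /(_ {classic N} (sublevel M) V)[w _|w Mw|D DM cov]; first by have [] := VP w.
  by exists w => //; have [] := VP w.
pose s := finmap.enum_fset D.
have sM i : (i < size s)%N -> sublevel M (nth (w1 : {classic N}) s i).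
  by move=> /(mem_nth (w1 : {classic N}))/DM; rewrite inE.
exists (size s), (fun i => V (nth w1 s i)), (M + 1)%R; split.
- by move=> i _; have [] := VP (nth w1 s i).
- by move=> i _; have [] := VP (nth w1 s i).
- move=> i /sM sMi w Vw; have [_ _ _ /(_ _ Vw)] := VP (nth w1 s i).
  rewrite /sublevel/= => /le_trans; apply; rewrite lerD2r; exact: sMi.
- move=> w /cov[w' Dw' Vw]; rewrite -(bigcup_mkord _ (fun i => V (nth (w1 : {classic N}) s i))); exists (index w' s).
    by rewrite /= index_mem.
  by rewrite nth_index.
Qed.

Lemma measure_cover_le d (T : measurableType d) (m : {measure set T -> \bar R})
    (k : nat) (U : nat -> set T) (A : set T) (C : \bar R) :
  measurable A -> (forall i, (i < k)%N -> measurable (U i)) ->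
  A `<=` \big[setU/set0]_(i < k) U i ->
  (forall i, (i < k)%N -> m (A `&` U i) <= C) -> m A <= k%:R%:E * C.
Proof.
move=> mA mU AU mC.
have AE : A `<=` \big[setU/set0]_(i < k) (A `&` U i).
  by rewrite -big_distrr/= => x Ax; split => //; exact: AU.
apply: (@le_trans _ _ (\sum_(i < k) m (A `&` U i))).
  apply: (@content_subadditive _ _ _ m _ (fun i => A `&` U i) k) => // i ik.
  by apply: measurableI => //; exact: mU.
apply: (@le_trans _ _ (\sum_(i < k) C)).
  by apply: lee_sum => i _; exact: mC.
elim: (k) => [|j IH]; first by rewrite big_ord0 mul0e.
rewrite big_ord_recr/= -natr1 EFinD ge0_muleDl ?lee_fin// mul1e.
by apply: leeD.
Qed.

Lemma dflowK b s t (w : N) : (s + t = 0)%R -> dflow b s (dflow b t w) = w.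
Proof.
move=> st; rewrite /dflow (flow_onD S) (_ : (_ + _)%R = 0%R) ?(flow_on0 S)//.
by case: b; rewrite -?opprD st ?oppr0.
Qed.

Section Measures.
Variables (mu0 : {sigma_finite_measure set ends -> \bar R}) (w0 : N).
Local Notation borelN := (borel_at w0).
Local Notation borelX := (borel_at (quo w0)).
Local Notation geo := (geo S w0).
Variables (m : {measure set borelN -> \bar R}) (mbar : {measure set borelX -> \bar R}).
Hypothesis mu0_null : mu0 (~` Dp) = 0.
Hypothesis mu0_thick : forall j, mu0 (thick_pairs j) < +oo.
Hypothesis mE : forall b (B : set borelN), measurable B ->
  m B = (mu0 \x lambda) (geo b @^-1` B).
Hypothesis mbar_m : descends_to m mbar.

Lemma open_borelN (U : set N) : open U -> measurable (U : set borelN).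
Proof. exact: (@open_borel (pointed_at w0)). Qed.

Lemma open_borelX (U : set (orbit_space Gamma N)) : open U -> measurable (U : set borelX).
Proof. exact: (@open_borel (pointed_at (quo w0))). Qed.

Lemma measurable_sublevel M : measurable (sublevel M : set borelN).
Proof. by apply: (@closed_borel (pointed_at w0)); exact: (sublevel_closed S). Qed.

Lemma measurable_continuous (g : N -> N) : continuous g ->
  measurable_fun setT (g : borelN -> borelN).
Proof.
move=> cg; apply: (@measurability _ _ borelN borelN setT g (@open (pointed_at w0))) => //.
move=> _ [U oU <-]; rewrite setTI; apply: open_borelN.
by apply: open_comp => // w _; exact: cg.
Qed.

Lemma measurable_quo : measurable_fun setT (quo : borelN -> borelX).
Proof.
apply: (@measurability _ _ borelN borelX setT quo (@open (pointed_at (quo w0)))) => //.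
by move=> _ [U oU <-]; rewrite setTI; apply: open_borelN.
Qed.

Lemma sublevel_finite M : m (sublevel M) < +oo.
Proof.
by rewrite (mE true (measurable_sublevel M)); exact: prod_measure_sublevel.
Qed.

(** Along each geodesic the flow is a translation of time. The integral is first restricted to [Dp],
    off which [geo] is a constant that the flow does not follow. *)
Lemma measure_dflow b t (B : set borelN) : measurable B ->
  m (dflow b t @^-1` B) = m B.
Proof.
move=> mB; have mtB : measurable (dflow b t @^-1` B : set borelN).
  apply: (measurable_preimage (@measurable_continuous (dflow b t) _)) => //.
  exact: (dflow_continuous S).
rewrite !(mE b)//.
have mg B' (mB' : measurable B') := @measurable_geo_preimage _ _ _ _ _ _ S w0 b B' mB'.
have mD := measurable_distinct_pairs S.
have red (Q : set (ends * measurableTypeR R)) : measurable Q -> (mu0 \x lambda) Q =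
    \int[mu0]_(p in Dp) lambda (xsection Q p).
  move=> mQ; rewrite [LHS](@ge0_negligible_integral _ _ _ _ _ (~` Dp))//.
  - by rewrite setTD setCK.
  - exact: measurableC.
  - exact: measurable_fun_xsection.
rewrite !red; [|exact: mg|exact: mg].
apply: eq_integral => p; rewrite inE => Dpp.
rewrite -[RHS](lebesgue_measure_shift t); last first.
  by apply: (measurable_xsection p); exact: mg.
congr (lambda _); apply/seteqP; split => s; rewrite /xsection/= !inE/=;
  by rewrite dflow_geo.
Qed.

Lemma quo_image (U : set N) (A : set (orbit_space Gamma N)) :
  quo @` (U `&` quo @^-1` A) = quo @` U `&` A.
Proof.
apply/seteqP; split => [_ [w [Uw Aw] <-]|_ [[w Uw <-] Aw]]; first by split => //; exists w.
by exists w.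
Qed.

Lemma descends_open (U : set N) (A : set borelX) : open U -> set_inj U quo ->
  measurable A -> m (U `&` quo @^-1` A) <= mbar A.
Proof.
move=> oU Uinj mA.
have mUA : measurable (U `&` quo @^-1` A : set borelN).
  apply: measurableI; first exact: open_borelN.
  exact: (measurable_preimage measurable_quo).
rewrite -mbar_m//; last by move=> w w'; rewrite !inE => -[Uw _] [Uw' _]; apply: Uinj; rewrite inE.
rewrite [X in mbar X]quo_image le_measure ?inE//.
by apply: measurableI => //; apply: open_borelX; exact: (open_orbit_image S).
Qed.

(** The flow commutes with the projection, so a set on which the latter is injective remains so when
    moved by the flow. The same finite cover therefore serves all times, and [l] is its cardinal. *)
Lemma quotient_bound M : exists l : nat, forall b t (A : set borelX), measurable A ->
  m (sublevel M `&` dflow b t @^-1` (quo @^-1` A)) <= l%:R%:E * mbar A.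
Proof.
have [k [U [M' [oU iU _ cov]]]] := finite_injective_cover M.
exists k => b t A mA.
have mqA : measurable (quo @^-1` A : set borelN) by exact: (measurable_preimage measurable_quo).
have mdf s := @measurable_continuous (dflow b s) (@dflow_continuous _ _ _ _ _ _ S b s).
apply: (@measure_cover_le _ _ m k U).
- apply: measurableI; first exact: measurable_sublevel.
  exact: (measurable_preimage (mdf t)).
- by move=> i /oU; exact: open_borelN.
- by move=> w [/cov].
- move=> i ik; pose V := dflow b (- t) @^-1` U i.
  have oV : open V.
    by apply: open_comp; [move=> w _; exact: (dflow_continuous S)|exact: oU].
  have Vinj : set_inj V quo.
    move=> w w'; rewrite !inE => Vw Vw' E.
    rewrite -[w](@dflowK b t (- t)%R) ?subrr// -[w'](@dflowK b t (- t)%R) ?subrr//.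
    congr dflow.
    apply: (iU i ik); rewrite ?inE//.
    by rewrite /dflow -!(quotient_flow_orbit S) E.
  apply: (le_trans _ (descends_open oV Vinj mA)).
  rewrite -(measure_dflow b t (B := V `&` quo @^-1` A)); last first.
    by apply: measurableI => //; exact: open_borelN.
  rewrite le_measure ?inE//.
  + apply: measurableI; last by apply: open_borelN; exact: oU.
    apply: measurableI; first exact: measurable_sublevel.
    exact: (measurable_preimage (mdf t)).
  + apply: (measurable_preimage (mdf t)).
    by apply: measurableI => //; exact: open_borelN.
  + by move=> w [[_ Aw] Uw]; split => //=; rewrite /V/= dflowK// addNr.
Qed.

Lemma quotient_finite : mbar setT < +oo.
Proof.
have [M MP] := cocompact_sublevel S.
have [k [U [M' [oU iU UM' cov]]]] := finite_injective_cover M.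
have mq i : (i < k)%N -> measurable (quo @` U i : set borelX).
  by move=> ik; apply: open_borelX; apply: (open_orbit_image S); exact: oU.
apply: (@le_lt_trans _ _ (k%:R%:E * m (sublevel M'))); last first.
  rewrite lte_mul_pinfty//.
  exact: sublevel_finite.
apply: (@measure_cover_le _ _ mbar k (fun i => quo @` U i)) => //.
- move=> q _; have [w <-] := quo_surj q.
  have [A [pA Mw]] := MP w.
  rewrite -(bigcup_mkord _ (fun i => quo @` U i)).
  have := cov _ Mw; rewrite -bigcup_mkord => -[i ik Uw].
  by exists i => //; exists (actN S pA w); rewrite ?quo_actN.
- move=> i ik; rewrite setTI; have oUi := open_borelN (oU i ik).
  rewrite (mbar_m oUi (iU i ik)) le_measure ?inE//; last exact: UM'.
  exact: measurable_sublevel.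
Qed.

(** The images of finitely many injective open sets cover the quotient, and in each of them [A] is
    the injective image of a null set. *)
Lemma quotient_null (A : set borelX) : measurable A -> m (quo @^-1` A) = 0 -> mbar A = 0.
Proof.
move=> mA A0; have [M MP] := cocompact_sublevel S.
have [k [U [M' [oU iU UM' cov]]]] := finite_injective_cover M.
have mqA : measurable (quo @^-1` A : set borelN) by exact: (measurable_preimage measurable_quo).
apply/eqP; rewrite eq_le measure_ge0 andbT -[leRHS](mule0 k%:R%:E).
apply: (@measure_cover_le _ _ mbar k (fun i => quo @` U i)) => //.
- by move=> i ik; apply: open_borelX; apply: (open_orbit_image S); exact: oU.
- move=> q _; have [w <-] := quo_surj q.
  have [B [pB Mw]] := MP w.
  rewrite -(bigcup_mkord _ (fun i => quo @` U i)).
  have := cov _ Mw; rewrite -bigcup_mkord => -[i ik Uw].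
  by exists i => //; exists (actN S pB w); rewrite ?quo_actN.
- move=> i ik; rewrite setIC -quo_image.
  have mUA : measurable (U i `&` quo @^-1` A : set borelN).
    by apply: measurableI => //; apply: open_borelN; exact: oU.
  rewrite mbar_m//; last first.
    by move=> w w'; rewrite !inE => -[Uw _] [Uw' _]; apply: (iU i ik); rewrite inE.
  by rewrite -A0 le_measure ?inE//; exact: subIsetr.
Qed.

End Measures.
End Quotient.

(** * Hopf's argument *)

Section Hopf.
Local Open Scope ereal_scope.
Context (R : realType) (n : nat) (Gamma : subgroupPO R n).
Context (Omega Lambda : set (RP R n)) (f : 'cV[R]_n.+2).
Hypothesis S : setting Gamma Omega Lambda f.
Local Notation N := (nonwandering Lambda (convex_core Lambda f)).
Local Notation quo := (@orbit_of R n Gamma N).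
Local Notation sublevel := (@sublevel R n Lambda f).
Local Notation dflow := (@dflow R n Lambda f).
Local Notation borelRP := (g_sigma_algebraType (@open (RP R n))).
Local Notation ends := (borelRP * borelRP)%type.
Local Notation Dp := (distinct_pairs Lambda).
Local Notation thick_pairs := (@thick_pairs R n Lambda f).
Local Notation lambda := (@lebesgue_measure R).
Variables (mu0 : {sigma_finite_measure set ends -> \bar R}) (w0 : N).
Local Notation borelN := (borel_at w0).
Local Notation borelX := (borel_at (quo w0)).
Local Notation geo := (geo S w0).
Variables (m : {measure set borelN -> \bar R}) (mbar : {measure set borelX -> \bar R}).
Variable nu : {finite_measure set borelRP -> \bar R}.
Local Notation nu2 := (nu \x nu).
Local Notation nu3 := (nu2 \x nu).
Hypothesis mu0_null : mu0 (~` Dp) = 0.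
Hypothesis mu0_thick : forall j, mu0 (thick_pairs j) < +oo.
Hypothesis nu2_thick : forall j, exists2 C : R, (0 < C)%R &
  forall E, measurable E -> E `<=` thick_pairs j -> nu2 E <= C%:E * mu0 E.
Hypothesis mu0_nu2 : forall E, measurable E -> E `<=` Dp -> nu2 E = 0 -> mu0 E = 0.
Hypothesis mE : forall b (B : set borelN), measurable B ->
  m B = (mu0 \x lambda) (geo b @^-1` B).
Hypothesis mbar_m : descends_to m mbar.
Variable A : set borelX.
Hypothesis mA : measurable A.
Hypothesis A_inv : forall t, @quotient_flow R n Gamma N t @^-1` A = A.
Implicit Types (p : ends) (b : bool) (t : R).

Let mD := measurable_distinct_pairs S.
Let mq (B : set borelX) : measurable B -> measurable (quo @^-1` B : set borelN) :=
  measurable_preimage (@measurable_quo R n Gamma Lambda f w0).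

Definition ends_set b : set ends := [set p | A (quo (geo b (p, 0%R)))].

Lemma geo_section_measurable b t (B : set borelX) : measurable B ->
  measurable [set p | B (quo (geo b (p, t)))].
Proof.
move=> mB.
have := measurable_ysection t (@measurable_geo_preimage _ _ _ _ _ _ S w0 b _ (mq mB)).
by congr measurable; apply/seteqP; split => p; rewrite /ysection/= inE.
Qed.

Lemma ends_setP b p t : Dp p -> A (quo (geo b (p, t))) <-> ends_set b p.
Proof.
move=> Dpp; rewrite /ends_set/= -{1}[t]add0r -(dflow_geo S w0 b t 0%R Dpp) /dflow.
rewrite -(quotient_flow_orbit S).
by rewrite -[A _]/((@quotient_flow R n Gamma N _ @^-1` A) _) A_inv.
Qed.

Lemma height_geo_thick b j p t : thick_pairs j p -> (0 <= t <= 1)%R ->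
  sublevel (expR 1 + 2 * j.+1%:R)%R (geo b (p, t)).
Proof.
move=> [Dpp /= pj] /andP[t0 t1]; have b0 := boundary_form_lt0 S Dpp.
rewrite /sublevel/= height_geo//; apply: lerD; first by rewrite ler_expR.
have d0 : (0 < - boundary_form f p)%R by rewrite oppr_gt0.
have -> : (- 2 / boundary_form f p = 2 * (- boundary_form f p)^-1)%R.
  by rewrite invrN mulrN mulNr.
rewrite -[leRHS]mul1r; apply: ler_pM.
- exact: expR_ge0.
- by rewrite mulr_ge0// invr_ge0 ltW.
- by rewrite -expR0 ler_expR oppr_le0.
- by rewrite ler_pM2l// invf_ple ?posrE.
Qed.

(* Fubini's theorem on the flow box over [thick_pairs j] translated by the time
   [i], whose part above [B] has mass at most [l * mbar B]. *)
Lemma good_time b j (e : R) : (0 < e)%R -> exists2 e' : R, (0 < e')%R &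
  forall B : set borelX, measurable B -> mbar B <= e'%:E ->
  forall i : nat, exists2 t, (i%:R <= t)%R &
    nu2 (thick_pairs j `&` [set p | B (quo (geo b (p, t)))]) <= e%:E.
Proof.
move=> e0; have [C C0 CP] := nu2_thick j.
pose M : R := (expR 1 + 2 * j.+1%:R)%R.
have [l lP] := quotient_bound mu0_null mE mbar_m M.
have lC : (0 < C * (l%:R + 1))%R by rewrite mulr_gt0// ltr_wpDl.
(* With [l + 1] in place of [l], the flow box has mass strictly below [e / C], and [l = 0] causes no
   division by zero. *)
exists (e / (C * (l%:R + 1)))%R; first by rewrite divr_gt0.
move=> B mB Be i.
have mt := @measurable_thick_pairs _ _ _ _ _ _ S j.
pose Q : set (ends * measurableTypeR R) := (thick_pairs j `*` `[0%R, 1%R]%classic) `&`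
  geo b @^-1` (dflow b i%:R @^-1` (quo @^-1` B)).
have mdB : measurable (dflow b i%:R @^-1` (quo @^-1` B) : set borelN).
  apply: measurable_preimage (mq mB).
  exact: (measurable_continuous (@dflow_continuous _ _ _ _ _ _ S b _)).
have mgB := @measurable_geo_preimage _ _ _ _ _ _ S w0 b _ mdB.
have mQ : measurable Q.
  by apply: measurableI => //; apply: measurableX => //; exact: measurable_itv.
have QE t : (0 <= t <= 1)%R ->
    ysection Q t = thick_pairs j `&` [set p | B (quo (geo b (p, t + i%:R)%R))].
  move=> t01; apply/seteqP; split => p; rewrite /ysection/= inE /Q /=.
    by move=> [[tp _]]; rewrite dflow_geo//; case: tp.
  by move=> [tp Bp]; split; [split => //=; rewrite in_itv|rewrite dflow_geo//; case: tp].
have Qle : (mu0 \x lambda) Q <= (l%:R * (e / (C * (l%:R + 1))))%:E.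
  apply: (@le_trans _ _ (l%:R%:E * mbar B)); last first.
    by rewrite EFinM lee_wpmul2l// lee_fin.
  apply: le_trans (lP b i%:R B mB).
  have mS : measurable (sublevel M : set borelN) by exact: (measurable_sublevel S).
  rewrite (mE b); last exact: measurableI.
  rewrite le_measure ?inE//.
    by apply: measurable_geo_preimage; exact: measurableI.
  move=> [p t] [[/= tp]]; rewrite in_itv/= => t01 Bp; split => //=.
  exact: height_geo_thick.
suff [t t01 tQ] : exists2 t, (0 <= t <= 1)%R & mu0 (ysection Q t) <= (e / C)%:E.
  exists (t + i%:R)%R; first by rewrite lerDr; case/andP: t01.
  rewrite -QE//; apply: (le_trans (CP _ _ _)).
  - exact: measurable_ysection.
  - by rewrite QE//; exact: subIsetl.
  - rewrite -[leRHS](_ : C%:E * (e / C)%:E = _); last first.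
      by rewrite -EFinM mulrC divfK// gt_eqF.
    by rewrite lee_wpmul2l// lee_fin ltW.
(* If every slice with time in [[0, 1]] had mass above [e / C], so would the box have mass at least
   [e / C], contradicting [Qle]. *)
apply: contrapT => nt; move: Qle; apply/negP; rewrite -ltNge.
have m01 : measurable (`[0%R, 1%R]%classic : set (measurableTypeR R)) by exact: measurable_itv.
apply: (@lt_le_trans _ _ (e / C)%:E).
  have l0 : (0 < l%:R + 1 :> R)%R by rewrite ltr_wpDl.
  rewrite lte_fin (_ : (l%:R * _)%R = (e / C * (l%:R / (l%:R + 1)))%R); last first.
    by field; rewrite !gt_eqF.
  by rewrite gtr_pMr ?divr_gt0// ltr_pdivrMr// mul1r ltrDl.
have mys : measurable_fun setT (fun t => mu0 (ysection Q t)) by exact: measurable_fun_ysection.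
rewrite prod_ysectionE//.
apply: (@le_trans _ _ (\int[lambda]_(t in `[0%R, 1%R]%classic) mu0 (ysection Q t))); last first.
  exact: ge0_subset_integral.
apply: (@le_trans _ _ (\int[lambda]_(t in `[0%R, 1%R]%classic) (e / C)%:E)).
  rewrite [leRHS](_ : _ = (e / C)%:E * lambda `[0%R, 1%R]%classic); last exact: integral_cst.
  by rewrite lebesgue_measure_itv/= lte_fin ltr01 oppr0 adde0 mule1.
apply: ge0_le_integral => //.
- by move=> t _; rewrite lee_fin divr_ge0 ?ltW.
- exact: measurable_funTS.
- move=> t; rewrite /= in_itv/= => t01; rewrite leNgt; apply/negP => /ltW h.
  by apply: nt; exists t.
Qed.

(** This instantiates [fiber_const_null]: [C1] and [C2] consist of the geodesics found at the good
    time [t i] in closed sets [K1] inside [A] and [K2] inside its complement. Invariance of [A]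
    makes the time immaterial for membership in [H]. *)
Lemma hopf_thick b j :
  nu3 [set q | (thick_pairs j `&` ends_set b) (pair_left q) /\
               (thick_pairs j `\` ends_set b) (pair_right q)] = 0.
Proof.
have mt := @measurable_thick_pairs _ _ _ _ _ _ S j.
have mH : measurable (ends_set b) by exact: geo_section_measurable.
apply: fiber_const_null => // e e0.
have [e' e'0 eP] := good_time b j e0.
have e2 : (0 < e' / 2)%R by rewrite divr_gt0.
have mbarT := quotient_finite mu0_null mu0_thick mE mbar_m.
have Fs := @orbit_space_Fsigma _ _ _ _ _ _ S.
have [K1 [cK1 K1A K1e]] := @closed_inner_regular (pointed_at (quo w0)) R mbar mbarT Fs A _ mA e2.
have mAC : measurable (~` A) by exact: measurableC.
have [K2 [cK2 K2A K2e]] := @closed_inner_regular (pointed_at (quo w0)) R mbar mbarT Fs (~` A) _ mAC e2.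
have mK1 : measurable (K1 : set borelX) by exact: (@closed_borel (pointed_at (quo w0))).
have mK2 : measurable (K2 : set borelX) by exact: (@closed_borel (pointed_at (quo w0))).
(* What [K1] and [K2] leave out; a geodesic outside [B] at time [t i] is in one of the two closed
   sets. *)
pose B := A `\` K1 `|` ~` A `\` K2.
have mB : measurable B by apply: measurableU; exact: measurableD.
have Be : mbar B <= e'%:E.
  apply: (le_trans (measureU2 _ _ _)); [exact: measurableD|exact: measurableD|].
  by rewrite [e' in leRHS]splitr EFinD leeD.
have /choice[t tP] : forall i : nat, exists t, (i%:R <= t)%R /\
    nu2 (thick_pairs j `&` [set p | B (quo (geo b (p, t)))]) <= e%:E.
  by move=> i; have [t it te] := eP B mB Be i; exists t.
exists (fun i => Dp `&` [set p | K1 (quo (geo b (p, t i)))]),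
       (fun i => Dp `&` [set p | K2 (quo (geo b (p, t i)))]); split.
- by move=> i; split; apply: measurableI => //; exact: geo_section_measurable.
- move=> i; split => p [Dpp /=]; first by move=> /K1A /(ends_setP _ _ Dpp).
  by move=> /K2A nA /(ends_setP b (t i) Dpp).
- move=> i; have [_ te] := tP i; apply: (le_trans _ te); rewrite le_measure ?inE//.
  + apply: measurableD => //; apply: measurableU;
      by apply: measurableI => //; exact: geo_section_measurable.
  + by apply: measurableI => //; exact: geo_section_measurable.
  + move=> p [tp nK]; split => //=; have [Dpp _] := tp.
    have [Ap|nAp] := pselect (A (quo (geo b (p, t i)))).
      by left; split => // Kp; apply: nK; left.
    by right; split => // Kp; apply: nK; right.
- move=> x x' y [D1 _] [D2 _].
  have cc : (swap_if b (nc (geo b ((x, y), 0%R)))).1 =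
      (swap_if b (nc (geo b ((x', y), 0%R)))).1 by rewrite !nc_geo.
  have [T TP] : exists T : R, forall s, (T <= s)%R ->
      ~ (K1 (quo (dflow b s (geo b ((x, y), 0%R)))) /\
         K2 (quo (dflow b s (geo b ((x', y), 0%R))))).
    by apply: (stable_separation S) => //; rewrite -subset0 => q [/K1A Aq /K2A].
  near=> i; have iT : (T <= t i)%R.
    have [it _] := tP i; apply: le_trans it.
    by near: i; exact: nbhs_infty_ger.
  by have := TP _ iT; rewrite !dflow_geo// !add0r => nK [[_ k1] [_ k2]]; apply: nK.
Unshelve. all: by end_near.
Qed.

Lemma hopf_pairs b : nu3 [set q | (Dp `&` ends_set b) (pair_left q) /\
                                  (Dp `\` ends_set b) (pair_right q)] = 0.
Proof.
have mH : measurable (ends_set b) by exact: geo_section_measurable.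
have mset (V : set ends) : measurable V -> measurable [set q : borelRP * borelRP * borelRP |
    (V `&` ends_set b) (pair_left q) /\ (V `\` ends_set b) (pair_right q)].
  move=> mV; apply: measurableI.
    by apply: (measurable_preimage (@measurable_pair_left _ borelRP)); exact: measurableI.
  by apply: (measurable_preimage (@measurable_pair_right _ borelRP)); exact: measurableD.
have mt := @measurable_thick_pairs _ _ _ _ _ _ S.
apply: measure_negligible; first exact: mset.
apply: (@negligibleS _ _ _ _ (\bigcup_j [set q | (thick_pairs j `&` ends_set b) (pair_left q) /\
  (thick_pairs j `\` ends_set b) (pair_right q)])); last first.
  apply: negligible_bigcup => j; apply/negligibleP; last exact: hopf_thick.
  exact: mset.
move=> q [[Dl Hl] [Dr Hr]].
move: Dl Dr; rewrite -(bigcup_thick_pairs S) => -[i _ il] [j _ jr].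
exists (maxn i j) => //; split; split => //.
  by apply: thick_pairs_mono il; exact: leq_maxl.
by apply: thick_pairs_mono jr; exact: leq_maxr.
Qed.

(** Flow invariance absorbs the time shift of [geo_swap]. The endpoint sets of the two time
    directions are thus transposes of each other, which lets a single set [H] be tested along both
    factors. *)
Lemma ends_set_swap p : Dp p -> ends_set true (p.2, p.1) <-> ends_set false p.
Proof.
move=> Dpp; have [s sE] := geo_swap S w0 Dpp.
have Dsp := distinct_pairs_swap Dpp.
rewrite -(ends_setP true (s - 0)%R Dsp) -(ends_setP false 0%R Dpp).
by rewrite sE.
Qed.

Lemma hopf_dichotomy (W : 'I_3 -> set borelRP) :
  nu (~` Lambda) = 0 ->
  (forall i, measurable (W i) /\ 0 < nu (W i)) -> \bigcup_i W i = setT ->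
  (forall x i j, W i x -> W j x -> i = j) ->
  mbar A = 0 \/ mbar (~` A) = 0.
Proof.
move=> nuL WP WT Wtriv.
have mH b : measurable (ends_set b) by exact: geo_section_measurable.
(* A null set of endpoint pairs carries a null set of tangent vectors, [m] being a product in the
   coordinates of [geo]; pairs outside [Dp], all sent to [w0], are null for [mu0]. *)
have null_of b' (E : set ends) (B : set borelX) : measurable E -> E `<=` Dp -> nu2 E = 0 ->
    measurable B -> (forall p t, Dp p -> B (quo (geo b' (p, t))) -> E p) -> mbar B = 0.
  move=> mEs ED E0 mB BE; apply: (quotient_null S mbar_m) => //.
  rewrite (mE b' (mq mB)).
  have mu0E : mu0 (E `|` ~` Dp) = 0.
    apply: null_measureU => //; first exact: measurableC.
    exact: mu0_nu2.
  have mU : measurable (E `|` ~` Dp) by apply: measurableU => //; exact: measurableC.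
  apply/eqP; rewrite eq_le measure_ge0 andbT.
  apply: (@le_trans _ _ ((mu0 \x lambda) ((E `|` ~` Dp) `*` setT))).
    rewrite le_measure ?inE//; first by apply: measurable_geo_preimage; exact: mq.
      exact: measurableX.
    move=> [p t] /= Bpt; split => //=; have [Dpp|nD] := pselect (Dp p); last by right.
    by left; exact: (BE p t).
  rewrite [leLHS](_ : _ = mu0 (E `|` ~` Dp) * lambda setT).
    by rewrite mu0E mul0e.
  exact: product_measure1E.
have WD x y i j : Lambda x -> Lambda y -> W i x -> W j y -> i != j -> Dp (x, y).
  move=> Lx Ly Wx Wy; move=> ij; split => //= xy.
  by move: ij; rewrite (Wtriv x i j) ?eqxx// xy.
have [||H0|H0] := product_ergodic mD (mH true) (measurable_limit_set S) nuL WP WT WD.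
- exact: hopf_pairs.
- rewrite /= -[RHS](hopf_pairs false); congr (nu3 _).
  have sDp p : Dp (p.2, p.1) -> Dp p.
    by move=> /distinct_pairs_swap; case: p.
  apply/seteqP; split => q [[Dl Hl] [Dr Hr]].
    have {}Dl := sDp (pair_left q) Dl; have {}Dr := sDp (pair_right q) Dr; split; split => //.
      exact/(ends_set_swap Dl).
    by move=> /(ends_set_swap Dr).
  split; split; [exact: (distinct_pairs_swap Dl)|by apply/(ends_set_swap Dl); exact: Hl|
    exact: (distinct_pairs_swap Dr)|].
  by move=> h; apply: Hr; apply/(ends_set_swap Dr); exact: h.
- left; apply: (null_of true _ _ _ _ H0) => //; first exact: measurableI.
  by move=> p t Dpp /(ends_setP _ _ Dpp).
- right; apply: (null_of true _ _ _ _ H0) => //.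
  + exact: measurableD.
  + exact: measurableC.
  + by move=> p t Dpp nA; split => // /(ends_setP true t Dpp).
Qed.

End Hopf.

(** * A partition into three sets of positive measure *)

Section Separation.
Context (R : realType) (n : nat) (Gamma : subgroupPO R n).
Context (Omega Lambda : set (RP R n)) (f : 'cV[R]_n.+2).
Hypothesis S : setting Gamma Omega Lambda f.
Local Notation vec := ('rV[R]_n.+2).
Local Notation sec := (sec f).
Local Notation borelRP := (g_sigma_algebraType (@open (RP R n))).
Variable nu : {finite_measure set borelRP -> \bar R}.
Hypothesis nu_support : support nu = Lambda.

Lemma open_section_ball (v : vec) (r : R) :
  open (affine_chart f `&` [set p | `|v - sec p| < r]).
Proof.
rewrite openE => p [pf vp].
have c1 : {for p, continuous (fun p => `|v - sec p|)}.
  apply: (@continuous_comp _ _ _ (fun p => v - sec p) (@Num.norm _ vec)); last first.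
    exact: norm_continuous.
  by apply: (@continuousB _ _ _ (fun=> v) sec); [exact: cst_continuous|exact: sec_continuous].
have n1 : nbhs p [set p | `|v - sec p| < r].
  by apply: (c1 [set s | s < r]); apply: open_nbhs_nbhs; split => //; exact: open_lt.
by apply: filterI => //; apply: open_nbhs_nbhs; split => //; exact: open_affine_chart.
Qed.

(** Disjoint balls around three limit points have positive measure because [Lambda] is the support
    of [nu]; the third is then enlarged to the complement of the first two to obtain a partition. *)
Lemma three_charged_sets : exists W : 'I_3 -> set borelRP,
  [/\ forall i, measurable (W i) /\ (0 < nu (W i))%E, \bigcup_i W i = setT &
      forall x i j, W i x -> W j x -> i = j].
Proof.
have [x [x_inj Lx]] := limit_set_three_points S.
pose s i := sec (x i); have s_inj : injective s.
  move=> i j ij; apply: x_inj.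
  by rewrite -(proj_sec1 S (Lx i)) -[RHS](proj_sec1 S (Lx j)); congr proj.
have [r r0 rP] : exists2 r : R, 0 < r & forall i j, i != j -> r + r <= `|s i - s j|.
  pose D := [seq `|s p.1 - s p.2| | p <- enum {: 'I_3 * 'I_3} & p.1 != p.2].
  have D0 : all (fun d => 0 < d) D.
    apply/allP => _ /mapP[[i j] + ->]; rewrite mem_filter/= normr_gt0 subr_eq0 => /andP[ij _].
    by apply: contra_neq ij => /s_inj.
  (* Half the least distance between two of the three sections, capped by 1 so that the minimum has
     a neutral starting value. *)
  exists (\big[Num.min/1]_(d <- D) d / 2).
    rewrite divr_gt0//; elim: D D0 => [|d D IH]; first by rewrite big_nil.
    by rewrite big_cons lt_min => /andP[-> /IH].
  move=> i j ij; rewrite -splitr.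
  have : `|s i - s j| \in D.
    by apply/mapP; exists (i, j) => //; rewrite mem_filter/= ij mem_enum.
  elim: D {D0} => // d D IH; rewrite inE big_cons ge_min => /orP[/eqP->|/IH ->].
    by rewrite lexx.
  by rewrite orbT.
pose U i : set borelRP := affine_chart f `&` [set p | `|s i - sec p| < r].
have oU i : open (U i : set (RP R n)) by exact: open_section_ball.
have mU i : measurable (U i) by exact: open_borel.
have U_pos i : (0 < nu (U i))%E.
  have := Lx i; rewrite -{1}nu_support; apply => //.
  split; first exact: (limit_set_chart (setting_qF S) (setting_chart S)).
  by rewrite /= subrr normr0.
have U_triv y i j : U i y -> U j y -> i = j.
  move=> [_ /= iy] [_ /= jy]; apply: contrapT => /eqP /rP; apply/negP; rewrite -ltNge.
  by apply: (le_lt_trans (ler_distD (sec y) _ _)); rewrite ltrD// distrC.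
pose W i : set borelRP :=
  if i == ord_max then ~` (U ord0 `|` U (inord 1)) else U i.
have UW i : U i `<=` W i.
  move=> y Uy; rewrite /W; case: eqVneq => // iE [/(U_triv _ _ _ Uy)|/(U_triv _ _ _ Uy)];
    by rewrite iE => /(congr1 val) /=; rewrite ?inordK.
exists W; split.
- move=> i; have mW : measurable (W i).
    by rewrite /W; case: ifP => // _; apply: measurableC; exact: measurableU.
  by split => //; apply: (lt_le_trans (U_pos i)); rewrite le_measure ?inE.
- apply/seteqP; split => // y _.
  have [Uy|nU] := pselect ((U ord0 `|` U (inord 1)) y); last first.
    by exists ord_max => //; rewrite /W eqxx.
  by case: Uy => /UW Wy; [exists ord0|exists (inord 1)].
- have WU y i : i != ord_max -> W i y -> U i y by rewrite /W => /negPf ->.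
  have Wmax y i : i != ord_max -> W i y -> ~ W ord_max y.
    move=> im /(WU _ _ im) Uy; rewrite {1}/W eqxx; apply.
    case: i im Uy => -[|[|[|//]]] ki im Uy; [left|right|by case/eqP: im; exact: val_inj].
      by move: Uy; congr (U _ y); exact: val_inj.
    by move: Uy; congr (U _ y); apply: val_inj; rewrite /= inordK.
  move=> y i j; have [->|im] := eqVneq i ord_max; have [->|jm] := eqVneq j ord_max => //.
  + by move=> W1 W2; have := Wmax _ _ jm W2.
  + by move=> /(Wmax _ _ im).
  + by move=> /(WU _ _ im) W1 /(WU _ _ jm); exact: U_triv.
Qed.

End Separation.

Theorem theorem6p4 (R : realType) (n : nat) (n_ge2 : (2 <= n)%N)
  (Gamma : subgroupPO R n) (Gamma_tf : torsion_free Gamma)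
  (Omega Lambda : set (RP R n))
  (Gamma_qF : quasi_Fuchsian Gamma Omega Lambda)
  (f : 'cV[R]_n.+2) (f_neq0 : f != 0)
  (f_chart : closure Omega `<=` affine_chart f)
  (o : RP R n) (o_core : convex_core Lambda f o)
  (x : RP R n) (x_core : convex_core Lambda f x)
  (nu : RP R n -> {finite_measure set (g_sigma_algebraType (@open (RP R n))) -> \bar R})
  (nu_PS : Patterson_Sullivan Gamma Lambda (convex_core Lambda f)
             (critical_exponent Gamma o) nu)
  (w0 : nonwandering Lambda (convex_core Lambda f))
  (m : {measure set (borel_at w0) -> \bar R})
  (m_BM : Bowen_Margulis Lambda (critical_exponent Gamma o) x (nu x) m)
  (mbar : {measure set (borel_at (orbit_of Gamma w0)) -> \bar R})
  (mbar_m : descends_to m mbar) :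
  ergodic mbar (@quotient_flow R n Gamma (nonwandering Lambda (convex_core Lambda f))).
Proof.
have [mu [c [mu_current cP m_int]]] := m_BM.
have S : setting Gamma Omega Lambda f.
  split => // xi eta Lx Le xe; have [bc fc _] := cP (xi, eta) (And3 Lx Le xe).
  by exists (set_val (c xi eta 0)); split => //; exact: set_valP.
have [nu_null nu_support] : nu x (~` Lambda) = 0%E /\ support (nu x) = Lambda.
  by have [] := nu_PS; move=> /(_ x x_core).
have [mu0 mu0E] := current_sigma_finite S x_core mu_current.
have mu0_null : mu0 (~` distinct_pairs Lambda) = 0%E by rewrite mu0E setICl measure0.
have mu0_thick j : (mu0 (thick_pairs Lambda f j) < +oo)%E.
  by rewrite mu0E; exact: (current_thick_finite S x_core mu_current).
have mu0_swap E : measurable E -> mu0 ((fun p => (p.2, p.1)) @^-1` E) = mu0 E.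
  by move=> mEs; rewrite !mu0E; exact: (current_swap S x_core mu_current).
have mE := @current_formula _ _ _ _ _ _ S mu0 w0 mu0_null mu0_swap mu0_thick
  mu c m mu0E cP m_int.
have [W [WP WT Wtriv]] := three_charged_sets S nu_support.
move=> A mA A_inv; apply: (hopf_dichotomy mu0_null mu0_thick _ _ mE mbar_m mA A_inv
  nu_null WP WT Wtriv).
- move=> j; have [C C0 CP] := current_thick S x_core mu_current j; exists C => // E mEs Ej.
  by rewrite mu0E; have [] := CP E mEs Ej.
- by move=> E mEs ED E0; rewrite mu0E; exact: (current_null S x_core mu_current).
Qed.
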